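(* Let $\ell\ge 5$ be an integer, let $n\ge \ell$, and let $\pi=(d_1,\ldots,d_n)\in GS_n$ satisfy $d_{\ell+1-i}\ge i+1$ for every integer $i$ with $1\le i<\frac{\ell}{2}$ (i.e., $i=1,\ldots,\lceil\frac{\ell}{2}\rceil-1$). Then $\pi$ is potentially $_3C_\ell$-graphic.
   Context: A sequence of nonnegative integers is graphic if it is the degree sequence of a simple graph; such a graph is a realization of the sequence. $GS_n$ denotes the set of graphic sequences $(d_1,\ldots,d_n)$ of nonnegative integers with $d_1\ge\cdots\ge d_n$ and $d_1\le n-1$. A sequence $\pi\in GS_n$ is potentially $_3C_\ell$-graphic if some realization of $\pi$ contains a cycle of every length $r$ with $3\le r\le \ell$. *)

(* Defs.v *)
From mathcomp Require Import all_boot.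

Set Implicit Arguments.
Unset Strict Implicit.
Unset Printing Implicit Defensive.

Record sgraph := SGraph {
  vertex :> finType;
  adj : rel vertex;
  adj_sym : symmetric adj;
  adj_irr : irreflexive adj
}.

Definition degree (G : sgraph) (x : G) : nat := #|[set y | adj x y]|.

Definition realization (G : sgraph) (s : seq nat) : Prop :=
  perm_eq [seq degree x | x <- enum G] s.

Definition graphic (s : seq nat) : Prop := exists G : sgraph, realization G s.

(* The paper's d_i, with indices starting at 1. *)
Definition dterm (s : seq nat) (i : nat) : nat := nth 0 s i.-1.

Definition GS (n : nat) (s : n.-tuple nat) : Prop :=
  [/\ graphic s, sorted geq s & dterm s 1 <= n - 1].

(* The bound 3 <= r is needed where this is used: ucycle also admits
   sequences of length at most 2, which are not cycles of a simple graph. *)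
Definition has_cycle (G : sgraph) (r : nat) : Prop :=
  exists c : seq G, ucycle (@adj G) c /\ size c = r.

Definition potentially_3C (l : nat) (s : seq nat) : Prop :=
  exists G : sgraph,
    realization G s /\ (forall r, 3 <= r <= l -> has_cycle G r).

(* Main.v *)
Require Import Defs.
From mathcomp Require Import fingroup perm.
From mathcomp Require Import all_boot zify.

(** Write [ndeg m] for the number of vertices of degree at least [m]; the hypothesis
    says that [ndeg m >= l + 2 - m] for [2 <= m <= k], where [k] is [l / 2] rounded up.
    Induction on [l], then on the number [n] of non-isolated vertices.

    If [n = l], Posa's theorem (proved by Ore's closure argument) makes every realization
    Hamiltonian; for odd [l] some Hamiltonian cycle has two consecutive vertices of degree
    at least [k], and Bondy's argument yields all lengths, while for even [l] the lengths
    below [l] come from the case [l - 1].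

    If [n > l], edge switchings let a vertex of minimum degree be joined to the few
    vertices of degree above [k] and to vertices of low degree; deleting it keeps the
    hypothesis, except when [n <= l + 2] and nearly all degrees are at most [k].  There one
    vertex [u] (for odd [l]) or two adjacent vertices [u], [w] (for even [l]) are deleted,
    and induction gives a cycle of length [l - 1] or [l - 2] in the rest.  More than half of
    its vertices have degree [k - 1], so two of them are consecutive; vertices of equal
    degree may be exchanged, so these can be taken to be neighbours of [u] and [w], which
    are then inserted between them.  When exactly half of the vertices have degree [k - 1],
    a parity argument on the one vertex missing from the cycle replaces this.  The
    sequences left over for [l = 5, 6, 8] are realized by explicit graphs. *)

(** Deleting [t] lowers the count at level [m] only through [t] itself and through its neighbours of
    degree exactly [m]. Neighbours of degree above [k] are thus free at all levels [m <= k]. If a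
    neighbour taken from the lowest vertices has degree [m], then the vertices that were not chosen
    all have degree at least [m], and the count there is close to [n]; with [p] vertices of degree
    above [k] this suffices once [n + p >= l + 3]. Since [n > l], what is left has [n <= l + 2] and
    [p <= 1], which is the source of the case distinctions. There the cycle of the remaining graph
    has length [2 * k - 2], so [k] of its vertices in one set force two consecutive ones, and degree
    [k - 1] is what a vertex of degree [k] has after losing one neighbour. These arguments ask for
    [k >= 4] when [l] is odd and [k >= 5] when [l] is even, hence the exceptional lengths 5, 6 and
    8. *)

Set Implicit Arguments.
Unset Strict Implicit.
Unset Printing Implicit Defensive.

(** * Switchings *)

Section Switching.
Variable V : finType.
Implicit Types (e : rel V) (x y z u v w t a b c d s : V) (Q : {set V}).

Definition graph e := symmetric e /\ irreflexive e.
Definition nb e x : {set V} := [set y | e x y].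
Definition dg e x := #|nb e x|.

Lemma in_nb e x y : (y \in nb e x) = e x y.
Proof. by rewrite inE. Qed.

Lemma graph_sym e x y : graph e -> e x y = e y x.
Proof. by case=> s _; apply: s. Qed.

Lemma graph_irr e x : graph e -> e x x = false.
Proof. by case. Qed.

Lemma graph_neq e x y : graph e -> e x y -> x != y.
Proof. by move=> G; apply: contraTneq => ->; rewrite graph_irr. Qed.

(** The classical 2-switch on degree sequences, trading the edges [ab], [cd] for [ac], [bd]. *)
Definition switch e a b c d : rel V := fun x y =>
  if [|| (x == a) && (y == b), (x == b) && (y == a),
         (x == c) && (y == d) | (x == d) && (y == c)] then false
  else if [|| (x == a) && (y == c), (x == c) && (y == a),
              (x == b) && (y == d) | (x == d) && (y == b)] then true
  else e x y.

Lemma switch_out e a b c d x y : x \notin [:: a; b; c; d] -> switch e a b c d x y = e x y.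
Proof.
by rewrite !inE !negb_or /switch => /and4P[/negbTE-> /negbTE-> /negbTE-> /negbTE->].
Qed.

Definition switchable e a b c d :=
  [&& e a b, e c d, ~~ e a c, ~~ e b d, a != c & b != d].

Lemma switchable_distinct e a b c d : graph e -> switchable e a b c d ->
  [/\ [/\ a != b, a != c & a != d], b != c, b != d & c != d].
Proof.
move=> G /and5P[ab cd nac nbd /andP[ac bd]]; split=> //.
- split=> //; first exact: graph_neq ab.
  by apply: contraNneq nac => ->; rewrite graph_sym.
- by apply: contraNneq nac => <-.
- exact: graph_neq cd.
Qed.

Lemma switch_graph e a b c d :
  graph e -> switchable e a b c d -> graph (switch e a b c d).
Proof.
move=> G S; have [[ab ac ad] bc bd cd] := switchable_distinct G S.
split=> [x y|x]; rewrite /switch.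
  rewrite (graph_sym _ _ G).
  by do 8![case: eqP => ? //=].
rewrite (graph_irr _ G).
case: (x =P a) => [->|_]; first by rewrite (negbTE ab) (negbTE ac) (negbTE ad).
case: (x =P b) => [->|_]; first by rewrite (negbTE bc) (negbTE bd).
by case: (x =P c) => [->|_]; [rewrite (negbTE cd) | rewrite !andbF].
Qed.

(** Together with [switchS] this moves any of the four corners to the first place, so degrees need
    checking at corner [a] only. *)
Lemma switchC e a b c d : graph e -> switchable e a b c d ->
  switchable e b a d c /\ switch e b a d c =2 switch e a b c d.
Proof.
move=> G /and5P[ab cd nac nbd /andP[ac bd]]; split.
  by apply/and5P; split; rewrite // 1?[e b a]graph_sym 1?[e d c]graph_sym // bd ac.
by move=> x y; rewrite /switch; do 8![case: eqP => ? //=].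
Qed.

Lemma switchS e a b c d : graph e -> switchable e a b c d ->
  switchable e c d a b /\ switch e c d a b =2 switch e a b c d.
Proof.
move=> G /and5P[ab cd nac nbd /andP[ac bd]]; split.
  apply/and5P; split=> //; first by rewrite graph_sym.
    by rewrite graph_sym.
  by rewrite eq_sym ac eq_sym bd.
by move=> x y; rewrite /switch; do 8![case: eqP => ? //=].
Qed.

Lemma switch_nb e a b c d : graph e -> switchable e a b c d ->
  nb (switch e a b c d) a = c |: nb e a :\ b.
Proof.
move=> G S; have [[ab ac ad] bc bd cd] := switchable_distinct G S.
apply/setP => y; rewrite !inE /switch eqxx (negbTE ab) (negbTE ac) (negbTE ad) /= !orbF.
case: (y =P b) => [->|_] /=; first by rewrite (negbTE bc).
by case: (y =P c).
Qed.

Lemma card_swap (S : {set V}) b c : b \in S -> c \notin S -> #|c |: S :\ b| = #|S|.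
Proof.
move=> bS cS; rewrite cardsU1 !inE (negbTE cS) andbF /=.
by rewrite [in RHS](cardsD1 b) bS.
Qed.

Lemma switch_dg e a b c d : graph e -> switchable e a b c d ->
  dg (switch e a b c d) =1 dg e.
Proof.
move=> G S.
have step a' b' c' d' : switchable e a' b' c' d' ->
    switch e a' b' c' d' =2 switch e a b c d ->
    dg (switch e a b c d) a' = dg e a'.
  move=> S' E; rewrite /dg; have /and5P[ab' _ nac' _ _] := S'.
  have -> : nb (switch e a b c d) a' = c' |: nb e a' :\ b'.
    by rewrite -(switch_nb G S'); apply/setP => y; rewrite !inE E.
  by rewrite card_swap ?in_nb.
move=> x.
have [Sb Eb] := switchC G S; have [Sc Ec] := switchS G S.
have [Sd Ed] := switchC G Sc.
case: (x =P a) => [->|xa]; first exact: step S _.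
case: (x =P b) => [->|xb]; first exact: step Sb Eb.
case: (x =P c) => [->|xc]; first exact: step Sc Ec.
case: (x =P d) => [->|xd]; first by apply: step Sd _ => u v; rewrite Ed Ec.
by congr #|pred_of_set _|; apply/setP => y; rewrite !inE /switch; do 4![case: eqP => //= _].
Qed.

(* The edge t x is replaced by t y, paid for by moving the edge y z to x z. *)
Lemma move_edge e t x y z : graph e -> e t x -> ~~ e t y -> t != y ->
    e y z -> ~~ e x z -> x != z ->
  exists e', [/\ graph e', dg e' =1 dg e & nb e' t = y |: nb e t :\ x].
Proof.
move=> G tx nty ty yz nxz xz.
have S : switchable e t x y z by apply/and5P; split; rewrite // ty xz.
by exists (switch e t x y z); split;
  [exact: switch_graph | exact: switch_dg | exact: switch_nb].
Qed.

(** Common neighbours and a possible edge [bc] count equally on both sides, so private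
    neighbourhoods compare as the degrees do. *)
Lemma nb_diff_card e b c : graph e -> b != c -> dg e c <= dg e b ->
  #|nb e c :\: (b |: nb e b)| <= #|nb e b :\: (c |: nb e c)|.
Proof.
move=> G bc le.
have I u v : u != v -> #|nb e u :&: (v |: nb e v)| = e u v + #|nb e u :&: nb e v|.
  move=> uv; rewrite setIUr cardsU.
  have -> : nb e u :&: [set v] :&: (nb e u :&: nb e v) = set0.
    by apply/setP => y; rewrite !inE; case: eqP => [->|]; rewrite ?graph_irr ?andbF.
  rewrite cards0 subn0; congr (_ + _).
  case E : (e u v); last first.
    by apply/eqP; rewrite cards_eq0 -subset0; apply/subsetP => y; rewrite !inE;
       case: eqP => [->|]; rewrite ?E ?andbF.
  by apply/eqP/cards1P; exists v; apply/setP => y; rewrite !inE;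
     case: eqP => [->|]; rewrite ?E ?andbF.
rewrite !cardsD I 1?eq_sym // I // -/(dg e b) -/(dg e c).
rewrite [nb e c :&: _]setIC (graph_sym b c G); lia.
Qed.

(** The Havel-Hakimi exchange: [u] is private to [x], so [y], of no smaller degree, has a private
    neighbour [z] too. *)
Lemma switch_up e u x y : graph e -> e u x -> ~~ e u y -> u != y -> dg e x <= dg e y ->
  exists e', [/\ graph e', dg e' =1 dg e & nb e' u = y |: nb e u :\ x].
Proof.
move=> G ux nuy uy le.
have yx : y != x by apply: contraNneq nuy => ->.
have := nb_diff_card G yx le.
have : u \in nb e x :\: (y |: nb e y).
  by rewrite !inE (negbTE uy) /= (graph_sym y) // (graph_sym x) // nuy.
rewrite (cardsD1 u) => -> /(leq_trans (ltn0Sn _)) /card_gt0P[z].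
rewrite !inE negb_or => /andP[/andP[zx nxz] yz].
by apply: (move_edge G ux nuy uy yz nxz); rewrite eq_sym.
Qed.

(** Here [y] may have smaller degree than [x]. If [x] dominates [y], a preliminary switch through
    the non-neighbour [b] of [x] provides a neighbour of [y] that is not adjacent to [x]. *)
Lemma switch_down k e t x y b : graph e -> e t x -> ~~ e t y -> t != y ->
    dg e x <= k -> #|[set v | k < dg e v]| < dg e y ->
    b != x -> ~~ e x b -> k <= dg e b ->
  exists e', [/\ graph e', dg e' =1 dg e & nb e' t = y |: nb e t :\ x].
Proof.
move=> G tx nty ty dx dy bx nxb db; set A := [set v | k < dg e v] in dy.
have yx : y != x by apply: contraNneq nty => ->.
case: (pickP [pred z | [&& e y z, ~~ e x z & x != z]]) => [z /and3P[yz nxz xz]|no].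
  exact: (move_edge G tx nty ty yz nxz xz).
have sub z : e y z -> z != x -> e x z.
  by move=> yz zx; have := no z; rewrite /= yz eq_sym zx andbT => /negbFE.
have nyb : ~~ e y b by apply: contra nxb => yb; apply: sub.
have nby : b != y.
  apply: contraTneq db => by_; rewrite -ltnNge; apply: leq_trans dx.
  rewrite by_; apply: proper_card; apply/properP; split.
    by apply/subsetP => z; rewrite !in_nb => yz; apply: sub => //;
       apply: contraTneq yz => ->; rewrite -by_ graph_sym.
  by exists t; rewrite !in_nb ?[e y t]graph_sym // graph_sym.
have tb : t != b by apply: contraNneq nxb => <-; rewrite graph_sym.
(* It is enough to free some z in N(y) from N[x] by a switch away from t. *)
have finish e1 z : graph e1 -> dg e1 =1 dg e -> nb e1 t = nb e t ->
    e1 y z -> ~~ e1 x z -> x != z ->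
  exists e', [/\ graph e', dg e' =1 dg e & nb e' t = y |: nb e t :\ x].
  move=> G1 D1 N1 yz nxz xz.
  have [|| e' [G' D' N']] := @move_edge e1 t x y z G1 _ _ ty yz nxz xz.
  - by rewrite -in_nb N1 in_nb.
  - by rewrite -in_nb N1 in_nb.
  by exists e'; split=> // [v|]; rewrite ?D' ?N' ?N1.
have same a' b' c' d' : t \notin [:: a'; b'; c'; d'] ->
    nb (switch e a' b' c' d') t = nb e t.
  by move=> tn; apply/setP => v; rewrite !inE switch_out.
(* For such a [c], both [x] and [y] are private to [c] against [b], so [b] has two private
   neighbours, one of them a vertex [s] other than [t]. Switching [cx], [sb] to [cs], [xb] detaches
   [c] from [x]. *)
case: (pickP [pred c | [&& e y c, c != x & dg e c <= k]]) => [c /and3P[yc cx dc]|noc].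
  have xc := sub _ yc cx.
  have cb : c != b by apply: contraTneq yc => ->.
  have bc : b != c by rewrite eq_sym.
  have ct : c != t by apply: contraNneq nty => <-; rewrite graph_sym.
  have two : 1 < #|nb e c :\: (b |: nb e b)|.
    have -> : 1 = #|[set x; y]|.-1 by rewrite cards2 eq_sym yx.
    rewrite prednK; last by rewrite cards2.
    apply: subset_leq_card; apply/subsetP => v; rewrite !inE => /orP[]/eqP->.
      by rewrite negb_or [x == b]eq_sym bx [e b x]graph_sym // nxb graph_sym.
    by rewrite negb_or [y == b]eq_sym nby [e b y]graph_sym // nyb graph_sym.
  have := leq_trans two (nb_diff_card G bc (leq_trans dc db)).
  rewrite (cardsD1 t) => two'.
  have /card_gt0P[s] : 0 < #|(nb e b :\: (c |: nb e c)) :\ t|.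
    by move: two'; case: (t \in _); rewrite ?add1n ?add0n // => /ltnW.
  rewrite !inE negb_or => /andP[st /andP[/andP[sc ncs] bs]].
  have sx : s != x by apply: contraNneq nxb => <-; rewrite graph_sym.
  have sy : s != y by apply: contraNneq nyb => <-; rewrite graph_sym.
  have sb : s != b by rewrite eq_sym; apply: graph_neq bs.
  have S : switchable e c x s b.
    apply/and5P; split=> //; [by rewrite graph_sym | by rewrite graph_sym |].
    by rewrite [c == s]eq_sym sc eq_sym bx.
  apply: (finish (switch e c x s b) c).
  - exact: switch_graph.
  - exact: switch_dg.
  - apply: same; rewrite !inE !negb_or.
    by rewrite [t == c]eq_sym ct (graph_neq G tx) [t == s]eq_sym st tb.
  - rewrite switch_out // !inE !negb_or (graph_neq G yc) yx.
    by rewrite [y == s]eq_sym sy eq_sym nby.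
  - by rewrite /switch !eqxx /= !orbT.
  - by rewrite eq_sym.
(* All neighbours of [y] but [x] lie in [A], which has fewer than [dg e y] elements, so equality
   holds. Switching [yx], [bs] to [yb], [xs] then makes [b] the required neighbour of [y]. *)
have NyA : nb e y = x |: A.
  apply/eqP; rewrite eqEcard; apply/andP; split.
    apply/subsetP => c; rewrite !inE => yc; case: (c =P x) => //= /eqP cx.
    by have := noc c; rewrite /= yc cx /= ltnNge => /negbT.
  rewrite -/(dg e y); apply: leq_trans dy.
  by rewrite cardsU1; case: (_ \notin _).
have yx' : e y x by rewrite -in_nb NyA !inE eqxx.
have /subsetPn[s] : ~~ (nb e b \subset nb e x).
  apply: contraL db => sub'; rewrite -ltnNge; apply: leq_trans dx.
  apply: proper_card; apply/properP; split=> //.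
  by exists y; rewrite in_nb graph_sym.
rewrite !in_nb => bs nxs.
have sx : s != x by apply: contraNneq nxb => <-; rewrite graph_sym.
have S : switchable e y x b s.
  by apply/and5P; split=> //; rewrite [y == b]eq_sym nby eq_sym sx.
have st : s != t by apply: contraNneq nxs => ->; rewrite graph_sym.
have sy : s != y by apply: contraNneq nxs => ->; rewrite graph_sym.
have sb : s != b by rewrite eq_sym; apply: graph_neq bs.
apply: (finish (switch e y x b s) b).
- exact: switch_graph.
- exact: switch_dg.
- apply: same; rewrite !inE !negb_or.
  by rewrite ty (graph_neq G tx) tb eq_sym st.
- rewrite /switch !eqxx (negbTE bx) [y == b]eq_sym (negbTE nby).
  by rewrite [y == s]eq_sym (negbTE sy) (negbTE yx).
- rewrite /switch [x == y]eq_sym (negbTE yx) [x == b]eq_sym (negbTE bx) [x == s]eq_sym (negbTE sx).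
  by rewrite /= eqxx /= (negbTE nby) [b == s]eq_sym (negbTE sb).
- by rewrite eq_sym.
Qed.

End Switching.

(** * Prescribed neighbourhoods *)

Section Neighbourhoods.
Variable V : finType.
Implicit Types (e : rel V) (x y z u v w t a b c d s : V) (Q K S : {set V}).

Definition degge e m : {set V} := [set x | m <= dg e x].
Definition ndeg e m := #|degge e m|.

Lemma in_degge e m x : (x \in degge e m) = (m <= dg e x).
Proof. by rewrite inE. Qed.

Lemma eq_ndeg e e' : dg e' =1 dg e -> ndeg e' =1 ndeg e.
Proof. by move=> D m; congr #|pred_of_set _|; apply/setP => x; rewrite !inE D. Qed.

Lemma ndeg_mono e m m' : m <= m' -> ndeg e m' <= ndeg e m.
Proof. by move=> le; apply/subset_leq_card/subsetP => x; rewrite !inE; apply: leq_trans. Qed.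

(** Each exchange brings [nb e t] one vertex closer to [Q], so a prescribed neighbourhood only needs
    an exchange of single vertices. *)
Lemma reach_nb e t Q : graph e -> #|Q| = dg e t ->
    (forall e1 x y, graph e1 -> dg e1 =1 dg e -> e1 t x -> x \notin Q ->
       y \in Q -> ~~ e1 t y ->
       exists e2, [/\ graph e2, dg e2 =1 dg e1 & nb e2 t = y |: nb e1 t :\ x]) ->
  exists e', [/\ graph e', dg e' =1 dg e & nb e' t = Q].
Proof.
move=> G cQ H.
have : exists e1, [/\ graph e1, dg e1 =1 dg e & #|Q :\: nb e1 t| <= #|Q :\: nb e t|].
  by exists e.
move: #|Q :\: nb e t| => m [e1 [G1 D1 le1]]; elim: m => [|m IH] in e1 G1 D1 le1 *.
  exists e1; split=> //; apply/eqP; rewrite eq_sym eqEcard.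
  by rewrite -setD_eq0 -cards_eq0 -leqn0 le1 cQ -(D1 t) /=.
have [/eqP E|/set0Pn[y]] := boolP (Q :\: nb e1 t == set0).
  by apply: (IH e1) => //; rewrite E cards0.
rewrite !inE => /andP[nty yQ].
have /subsetPn[x] : ~~ (nb e1 t \subset Q).
  apply: contra nty => sub; rewrite -in_nb.
  by have /eqP-> : nb e1 t == Q by rewrite eqEcard sub cQ -D1 /=.
rewrite in_nb => tx xQ.
have [e2 [G2 D2 N2]] := H e1 x y G1 D1 tx xQ yQ nty.
apply: (IH e2) => // [v|]; first by rewrite D2 D1.
rewrite -ltnS; apply: leq_trans le1; apply: proper_card; apply/properP; split.
  apply/subsetP => v; rewrite N2 !inE !negb_or => /andP[/andP[_ +] vQ].
  by rewrite vQ andbT negb_and negbK; case: eqP => [vx|//]; rewrite -vx vQ in xQ.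
by exists y; rewrite ?N2 !inE ?eqxx // nty.
Qed.

(** The Havel-Hakimi theorem, with ties between degrees left to the choice of [Q]. *)
Lemma top_nb e u Q : graph e -> #|Q| = dg e u -> u \notin Q ->
    (forall x y, y \in Q -> x \notin Q -> x != u -> dg e x <= dg e y) ->
  exists e', [/\ graph e', dg e' =1 dg e & nb e' u = Q].
Proof.
move=> G cQ uQ top; apply: reach_nb => // e1 x y G1 D1 ux xQ yQ nuy.
apply: switch_up => //; first by apply: contraNneq uQ => ->.
by rewrite !D1; apply: top => //; rewrite eq_sym (graph_neq G1 ux).
Qed.

(** Unlike in Havel-Hakimi, [Q] may contain low vertices. The last hypothesis yields the [b] of
    [switch_down]: a neighbour [x] outside [Q] has degree at most [k], so its closed neighbourhood
    cannot contain all vertices of degree at least [k]. *)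
Lemma any_nb k e t Q : graph e -> #|Q| = dg e t -> t \notin Q ->
    [set v | k < dg e v] \subset Q ->
    (forall y, y \in Q -> #|[set v | k < dg e v]| < dg e y) ->
    k + (k <= dg e t) < ndeg e k ->
  exists e', [/\ graph e', dg e' =1 dg e & nb e' t = Q].
Proof.
move=> G cQ tQ AQ low big; apply: reach_nb => // e1 x y G1 D1 tx xQ yQ nty.
have EA : [set v | k < dg e1 v] = [set v | k < dg e v].
  by apply/setP => v; rewrite !inE D1.
have dx : dg e1 x <= k.
  by rewrite leqNgt D1; apply: contra xQ => kx; apply: (subsetP AQ); rewrite inE.
have /subsetPn[b] : ~~ (degge e1 k \subset x |: nb e1 x).
  apply: contraL big => sub; rewrite -leqNgt -(eq_ndeg D1).
  (* The neighbour [t] of [x] is discounted when its degree is below [k]; hence the term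
     [(k <= dg e t)]. *)
  have sub' : degge e1 k \subset (if k <= dg e t then x |: nb e1 x else x |: nb e1 x :\ t).
    case: ifP => // kt; apply/subsetP => v vl; have := subsetP sub v vl; rewrite !inE.
    by case: (v =P t) vl => [->|//]; rewrite inE D1 kt.
  apply: leq_trans (subset_leq_card sub') _.
  case: ifP => _; first by rewrite cardsU1; case: (_ \notin _); rewrite ?add0n; move: dx; rewrite /dg; lia.
  have : t \in nb e1 x by rewrite in_nb graph_sym.
  move=> tn; have := cardsD1 t (nb e1 x); rewrite tn => E.
  rewrite cardsU1 addn0; move: dx; rewrite /dg E; case: (_ \notin _); lia.
rewrite !inE negb_or => kb /andP[bx nxb].
apply: (switch_down G1 tx nty _ dx _ bx nxb kb); first by apply: contraNneq tQ => ->.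
by rewrite EA D1; apply: low.
Qed.

Lemma lowest_subset (f : V -> nat) S g : g <= #|S| ->
  exists L : {set V}, [/\ L \subset S, #|L| = g &
    forall x y, x \in L -> y \in S -> y \notin L -> f x <= f y].
Proof.
elim: g S => [|g IH] S leg.
  by exists set0; split; rewrite ?sub0set ?cards0 // => x y; rewrite inE.
have /card_gt0P[a0 a0S] : 0 < #|S| by apply: leq_trans leg.
case: (@arg_minnP _ a0 (fun x => x \in S) f a0S) => a aS amin.
have [|L [LS cL lo]] := IH (S :\ a).
  by move: leg; rewrite (cardsD1 a) aS.
have aL : a \notin L by apply: contraTN isT => /(subsetP LS); rewrite !inE eqxx.
exists (a |: L); split.
- by rewrite subUset sub1set aS; apply: subset_trans LS (subsetDl _ _).
- by rewrite cardsU1 aL cL.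
move=> x y; rewrite !inE negb_or => /orP[/eqP-> yS _|xL yS /andP[ya yL]].
  exact: amin.
by apply: lo => //; rewrite !inE ya.
Qed.

(** One transposition per entry is enough. Fixing everything outside [K] will keep the deleted
    vertices in place. *)
Lemma perm_moving K (xs rs : seq V) : uniq xs -> uniq rs -> size xs = size rs ->
    {subset xs <= K} -> {subset rs <= K} ->
  exists s : {perm V}, (forall x, x \notin K -> s x = x) /\ map s xs = rs.
Proof.
elim: xs rs => [|x xs IH] [|r rs] //=.
  by move=> _ _ _ _ _; exists 1%g; split=> // v _; rewrite perm1.
move=> /andP[xxs uxs] /andP[rrs urs] [sz] subx subr.
have [||s [sK sxs]] := IH rs uxs urs sz.
- by move=> v vx; apply: subx; rewrite inE vx orbT.
- by move=> v vx; apply: subr; rewrite inE vx orbT.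
have sxK : s x \in K.
  apply: contraT => h; have := sK _ h => /perm_inj E.
  by move: h; rewrite E subx ?inE ?eqxx.
exists (s * tperm (s x) r)%g; split.
  move=> v vK; rewrite permM (sK v vK) tpermD //; apply: contraNneq vK => <- //.
  by rewrite subr ?inE ?eqxx.
rewrite permM tpermL; congr (_ :: _); rewrite -[RHS]sxs.
apply/eq_in_map => v vx; rewrite permM tpermD //.
  by apply: contraNneq xxs => /perm_inj->.
by apply: contraNneq rrs => ->; rewrite -sxs map_f.
Qed.

(* Deleted vertices are kept as isolated ones, so that all graphs live on [V]. *)
Definition isolate e v : rel V := fun x y => [&& x != v, y != v & e x y].
Definition addv e v Q : rel V :=
  fun x y => [|| e x y, (x == v) && (y \in Q) | (y == v) && (x \in Q)].

Lemma isolate_graph e v : graph e -> graph (isolate e v).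
Proof.
by case=> s i; split=> [x y|x]; rewrite /isolate ?i ?andbF // s andbCA.
Qed.

Lemma dg_isolate e v x : graph e -> dg e x = if x == v then dg e v else dg (isolate e v) x + e x v.
Proof.
move=> G; case: eqP => [->//|/eqP xv].
rewrite /dg (cardsD1 v) in_nb addnC; congr (_ + _).
by congr #|pred_of_set _|; apply/setP => y; rewrite !inE /isolate xv.
Qed.

Lemma dg_isolate0 e v : dg (isolate e v) v = 0.
Proof. by apply: eq_card0 => y; rewrite !inE /isolate eqxx. Qed.

Lemma dg_isolateB e v x : graph e -> x != v -> dg (isolate e v) x = dg e x - (v \in nb e x).
Proof. by move=> G xv; rewrite (dg_isolate v x G) (negbTE xv) in_nb addnK. Qed.

Lemma addv_graph e v Q : graph e -> v \notin Q -> graph (addv e v Q).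
Proof.
case=> s i vQ; split=> [x y|x]; rewrite /addv ?i /=.
  by rewrite s; congr (_ || _); rewrite orbC.
by case: eqP => [->|]; rewrite ?(negbTE vQ).
Qed.

Lemma dg0 e v x : dg e v = 0 -> e v x = false.
Proof. by move=> /eqP; rewrite cards_eq0 => /eqP E; rewrite -in_nb E inE. Qed.

Lemma dg_addv e v Q x : graph e -> v \notin Q -> dg e v = 0 ->
  dg (addv e v Q) x = if x == v then #|Q| else dg e x + (x \in Q).
Proof.
move=> G vQ z; case: eqP => [->|/eqP xv].
  by congr #|pred_of_set _|; apply/setP => y; rewrite !inE /addv eqxx (negbTE vQ) (dg0 _ z) andbF orbF.
rewrite /dg (cardsD1 v) inE /addv eqxx (negbTE xv) /= (graph_sym x v) // (dg0 _ z) /= addnC.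
congr (_ + _); congr #|pred_of_set _|; apply/setP => y; rewrite !inE.
by rewrite (negbTE xv) /=; case: eqP => [->|]; rewrite ?orbF ?andbF //= (graph_sym x v) // (dg0 _ z).
Qed.

(** Any realization of the remaining degrees takes [v] back with its old neighbours; this returns
    cycles found by induction to a realization of the whole sequence. *)
Lemma dg_readd e e' v : graph e -> graph e' -> dg e' =1 dg (isolate e v) ->
  [/\ graph (addv e' v (nb e v)), dg (addv e' v (nb e v)) =1 dg e
    & forall x y, e' x y -> addv e' v (nb e v) x y].
Proof.
move=> G G' D.
have vn : v \notin nb e v by rewrite in_nb graph_irr.
have z : dg e' v = 0 by rewrite D dg_isolate0.
split; [exact: addv_graph | | by move=> x y h; rewrite /addv h].
move=> x; rewrite dg_addv // [RHS](dg_isolate v) //; case: eqP => // _.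
by rewrite D in_nb graph_sym.
Qed.

Definition relabel e (s : {perm V}) : rel V := fun x y => e (s x) (s y).

Lemma relabel_graph e (s : {perm V}) : graph e -> graph (relabel e s).
Proof. by case=> sy i; split=> [x y|x]; rewrite /relabel // sy. Qed.

Lemma dg_relabel e (s : {perm V}) x : dg (relabel e s) x = dg e (s x).
Proof.
rewrite /dg -(card_imset _ (@perm_inj _ s)); congr #|pred_of_set _|; apply/setP => y.
apply/imsetP/idP => [[z zn ->]|yn]; first by move: zn; rewrite !inE.
by exists ((s^-1)%g y); rewrite ?permKV // inE /relabel permKV -in_nb.
Qed.

End Neighbourhoods.

(** * Cycles and insertion of vertices *)

Section Cycles.
Variable V : finType.
Implicit Types (e : rel V) (x y z u v w t a b : V) (Q K S X : {set V}) (c : seq V).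

Definition has_cyc e r := exists c, [/\ cycle e c, uniq c & size c = r].

Definition potentially l e := exists e', [/\ graph e', dg e' =1 dg e &
  forall r, 3 <= r <= l -> has_cyc e' r].

(** The bound [m.*2 <= l.+1] is the range [i < l / 2] for [m = i + 1]; the sum avoids truncated
    subtraction. *)
Definition degcond l e := forall m, 2 <= m -> m.*2 <= l.+1 -> l.+2 <= ndeg e m + m.

Lemma sub_has_cyc e e' r : subrel e e' -> has_cyc e r -> has_cyc e' r.
Proof. by move=> s [c [cy un sz]]; exists c; split=> //; apply: sub_cycle cy. Qed.

Lemma eq_potentially l e e' : dg e =1 dg e' -> potentially l e -> potentially l e'.
Proof. by move=> D [e1 [G1 D1 H]]; exists e1; split=> // x; rewrite D1 D. Qed.

Lemma degcond_pred l e : degcond l.+1 e -> degcond l e.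
Proof. by move=> C m m2 ml; have := C m m2 (leqW ml); lia. Qed.

Lemma potentially_isolate l e t : graph e -> potentially l (isolate e t) -> potentially l e.
Proof.
move=> G [e1 [G1 D1 H]]; have [Ga Da sa] := dg_readd G G1 D1.
by exists (addv e1 t (nb e t)); split=> // r /H; apply: sub_has_cyc.
Qed.

Lemma cycle_dg_gt0 e c x : cycle e c -> x \in c -> 0 < dg e x.
Proof.
move=> cy xc; rewrite card_gt0; apply/set0Pn; exists (next c x).
by rewrite in_nb (next_cycle cy).
Qed.

Lemma cycle_dg0 e c u : dg e u = 0 -> cycle e c -> u \notin c.
Proof.
move=> z cy; apply/negP => uc; have := next_cycle cy uc.
by rewrite (dg0 _ z).
Qed.

Lemma next_split c a : uniq c -> 1 < size c -> a \in c ->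
  exists i s, rot i c = [:: a, next c a & s].
Proof.
move=> un sz ac; have [i p E] := rot_to ac.
have: next (rot i c) a = next c a by rewrite next_rot.
have : size (rot i c) = size c by rewrite size_rot.
rewrite E; case: p E => [|b s] E /=; first by move=> h; rewrite -h in sz.
by rewrite eqxx => _ <-; exists i, s.
Qed.

Lemma insert_path e c a m : uniq c -> 1 < size c -> cycle e c -> a \in c ->
    uniq m -> {in m, forall z, z \notin c} -> path e a (rcons m (next c a)) ->
  has_cyc e (size c + size m).
Proof.
move=> un sz cy ac um dis pa; have [i [s E]] := next_split un sz ac.
have un' : uniq [:: a, next c a & s] by rewrite -E rot_uniq.
have cy' : cycle e [:: a, next c a & s] by rewrite -E rot_cycle.
have sz' : size [:: a, next c a & s] = size c by rewrite -E size_rot.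
exists (a :: m ++ next c a :: s); split.
- move: pa; rewrite rcons_path => /andP[pm la].
  rewrite /= rcons_cat cat_path pm rcons_cons /= la /=.
  by move: cy' => /= /andP[].
- have dis' : {in m, forall z, z \notin [:: a, next c a & s]}.
    by move=> z zm; rewrite -E mem_rot dis.
  rewrite (perm_uniq (_ : perm_eq _ (m ++ [:: a, next c a & s]))); last first.
    by rewrite -cat1s perm_catCA.
  rewrite cat_uniq um un' andbT andTb; apply/hasPn => z zs.
  by apply/negP => /dis'; rewrite zs.
by rewrite /= size_cat -sz' /=; lia.
Qed.

Definition cset c : {set V} := [set x in c].

Lemma card_cset c : uniq c -> #|cset c| = size c.
Proof. by move=> un; rewrite cardsE; apply/card_uniqP. Qed.

(** The cycle misses [#|S| - size c] vertices of [S], hence no more than that of [K]. *)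
Lemma on_cycle c K S : uniq c -> cset c \subset S -> K \subset S ->
  #|K| + size c <= #|K :&: cset c| + #|S|.
Proof.
move=> un cS KS.
have : #|K :\: cset c| <= #|S :\: cset c| by apply/subset_leq_card/setSD.
have := cardsID (cset c) K; have := cardsID (cset c) S.
rewrite (setIidPr cS) (card_cset un); lia.
Qed.

Lemma card_next c K : uniq c -> #|[set a in c | next c a \in K]| = #|K :&: cset c|.
Proof.
move=> un; rewrite -(card_in_imset (f := next c)); last first.
  move=> x y; rewrite !inE => /andP[xc _] /andP[yc _] E.
  by rewrite -(prev_next un x) E prev_next.
congr #|pred_of_set _|; apply/setP => y; apply/imsetP/idP => [[x]|].
  by rewrite !inE => /andP[xc xK] ->; rewrite xK mem_next.
rewrite !inE => /andP[yK yc]; exists (prev c y); last by rewrite next_prev.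
by rewrite !inE mem_prev yc next_prev.
Qed.

Definition pairs c K K' := [set a in c | (a \in K) && (next c a \in K')].

(** Inclusion-exclusion for the members of [K] and the predecessors of members of [K']. With
    [K = K'] covering more than half of [c] it gives two consecutive members. *)
Lemma card_pairs c K K' : uniq c ->
  #|K :&: cset c| + #|K' :&: cset c| <= size c + #|pairs c K K'|.
Proof.
move=> un; rewrite -(card_next K' un) -(card_cset un).
set P := [set a in c | _].
have <- : (K :&: cset c) :&: P = pairs c K K'.
  by apply/setP => x; rewrite !inE; case: (x \in c); rewrite ?andbF ?andbT.
rewrite -[X in X <= _]cardsUI leq_add2r; apply: subset_leq_card.
by apply/subsetP => x; rewrite !inE => /orP[]/andP[].
Qed.

Lemma has_cyc_relabel e (s : {perm V}) r : has_cyc e r -> has_cyc (relabel e s) r.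
Proof.
case=> c [cy un sz]; exists (map (s^-1)%g c); split.
- by rewrite cycle_map; apply: sub_cycle cy => x y; rewrite /= /relabel !permKV.
- by rewrite map_inj_uniq //; apply: perm_inj.
- by rewrite size_map.
Qed.

Lemma insert_relabel e (s : {perm V}) e' c x y m : uniq c -> 1 < size c ->
    cycle e c -> s x \in c -> next c (s x) = s y ->
    (forall x y, e (s x) (s y) -> e' x y) ->
    uniq m -> {in m, forall z, s z \notin c} -> path e' x (rcons m y) ->
  has_cyc e' (size c + size m).
Proof.
move=> un sz cy xc nx sub um dis pa.
pose c' := map (s^-1)%g c.
have inj : injective (s^-1)%g by apply: perm_inj.
have mem z : (z \in c') = (s z \in c).
  by rewrite -[z in LHS](permK s) (mem_map inj).
rewrite -(size_map (s^-1)%g c); apply: (@insert_path e' c' x m) => //.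
- by rewrite map_inj_uniq.
- by rewrite size_map.
- rewrite cycle_map; apply: sub_cycle cy => a b /= ab.
  by apply: sub; rewrite !permKV.
- by rewrite mem.
- by move=> z /dis; rewrite mem.
- have -> // : next c' x = y.
  have xE : x = (s^-1)%g (s x) by rewrite permK.
  by rewrite /c' [in LHS]xE (next_map inj) // nx permK.
Qed.

(** The interface for putting the deleted vertices [X] back: induction may return a realization
    unlike [e1], yet the edges of [e] at [X] are restored. *)
Definition extends X e1 e := forall e', graph e' -> dg e' =1 dg e1 ->
  exists e'', [/\ graph e'', dg e'' =1 dg e, subrel e' e'' &
    forall x y, e x y -> x \in X -> e'' x y].

Lemma extends1 e u : graph e -> extends [set u] (isolate e u) e.
Proof.
move=> G e' G' D'; have [Ga Da sa] := dg_readd G G' D'.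
exists (addv e' u (nb e u)); split=> // x y xy /set1P E; move: xy.
by rewrite E /addv eqxx in_nb => ->; rewrite orbT.
Qed.

Lemma extends2 e u w : graph e ->
  extends [set u; w] (isolate (isolate e u) w) e.
Proof.
move=> G e' G' D'.
have [Ga Da sa] := dg_readd (isolate_graph u G) G' D'.
have [Gb Db sb] := dg_readd G Ga Da.
eexists; split; [exact: Gb | exact: Db | by move=> x y /sa /sb |].
move=> x y xy; rewrite !inE; case: (x =P u) => [E _|/eqP xu /= /eqP E].
  by rewrite /addv -E eqxx (in_nb e) xy !orbT.
have [yu|yu] := eqVneq y u.
  by rewrite /addv yu eqxx (negbTE xu) /= (in_nb e) (graph_sym u x) // -yu xy !orbT.
by apply: sb; rewrite /addv -E eqxx in_nb /isolate xu yu xy !orbT.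
Qed.

(** Made for a [K] of vertices of equal degree: [s] carries chosen neighbours [xs] of the deleted
    vertices to chosen places [rs] on a cycle of [e2], and then the deleted vertices are put
    back. *)
Definition lifts X K M e e2 := forall xs rs, uniq xs -> uniq rs -> size xs = size rs ->
    {subset xs <= K} -> {subset rs <= K} ->
  exists (s : {perm V}) e3, [/\ graph e3, dg e3 =1 dg e,
    [/\ forall x y, e2 (s x) (s y) -> e3 x y,
        forall x y, e x y -> x \in X -> e3 x y & map s xs = rs],
    forall r, 3 <= r <= M -> has_cyc e3 r & forall x, (x \in X) || (x \notin K) -> s x = x].

(** The degree conditions make [X] and [K] disjoint, so [s] fixes [X], and they keep [relabel e2 s]
    a realization of the degrees of [e1]. *)
Lemma lift_step X K d M e e1 : extends X e1 e -> potentially M e1 ->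
    (forall x, x \in X -> dg e1 x = 0) -> (forall x, x \in K -> dg e1 x = d) -> 0 < d ->
  exists e2, [/\ graph e2, dg e2 =1 dg e1, forall r, 3 <= r <= M -> has_cyc e2 r &
    lifts X K M e e2].
Proof.
move=> ext [e2 [G2 D2 H2]] dX dK d0.
exists e2; split=> // xs rs ux ur szxr sx sr.
have [s [sK sE]] := perm_moving ux ur szxr sx sr.
have KsK x : x \in K -> s x \in K.
  move=> xK; apply: contraT => h; have /perm_inj E := sK _ h.
  by rewrite E xK in h.
have [||e3 [G3 D3 s3 x3]] := ext (relabel e2 s).
- exact: relabel_graph.
- move=> x; rewrite dg_relabel D2; have [xK|xK] := boolP (x \in K).
    by rewrite (dK _ xK) dK ?KsK.
  by rewrite sK.
exists s, e3; split=> //.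
- by move=> r rM; apply: (sub_has_cyc s3); apply/has_cyc_relabel/H2.
move=> x xX; rewrite sK //; move: xX => /orP[xX|//].
by apply: contraTN d0 => /dK; rewrite dX // => <-.
Qed.

Lemma next_neq c a : uniq c -> 1 < size c -> a \in c -> next c a != a.
Proof.
move=> un sz ac; have [i [s E]] := next_split un sz ac.
have : uniq (rot i c) by rewrite rot_uniq.
by rewrite E /= inE negb_or eq_sym -andbA => /andP[].
Qed.

Lemma insert_vertex X K M e e1 e2 u c a : graph e2 -> dg e2 =1 dg e1 ->
    (forall x, x \in X -> dg e1 x = 0) -> lifts X K M e e2 -> u \in X ->
    2 <= #|K :&: nb e u| -> cycle e2 c -> uniq c -> size c = M -> 2 <= M ->
    a \in pairs c K K ->
  potentially M.+1 e.
Proof.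
move=> G2 D2 dX lf uX /card_gt1P[x [y [/setIP[xK ux] /setIP[yK uy] xy]]] cy un sz M2.
rewrite inE => /and3P[ac aK nK].
have ab : next c a != a by rewrite next_neq ?sz.
have [||||| s [e3 [G3 D3 [s3 x3 [sx sy]] H3 sX]]] := lf [:: x; y] [:: a; next c a]; rewrite /= ?inE ?xy // ?andbT.
- by rewrite eq_sym.
- by move=> z; rewrite !inE => /orP[]/eqP->.
- by move=> z; rewrite !inE => /orP[]/eqP->.
exists e3; split=> // r /andP[r3]; rewrite leq_eqVlt => /orP[/eqP->|rM]; last first.
  by apply: H3; rewrite r3.
rewrite -sz -addn1; apply: (@insert_relabel e2 s e3 c x y [:: u]) => //.
- by rewrite sz.
- by rewrite sx.
- by rewrite sx sy.
- move=> z; rewrite inE => /eqP->; rewrite sX ?uX //; apply: cycle_dg0 cy.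
  by rewrite D2 dX.
move: ux uy; rewrite !in_nb /= andbT => ux uy.
by rewrite (graph_sym x) // !x3.
Qed.

End Cycles.

(** * Spanning cycles *)

Section Hamiltonian.
Variable V : finType.
Implicit Types (e : rel V) (x y z u v w t a b : V) (Q K S X : {set V}) (c s : seq V).

(** No step goes from [Q] to [P], so each step contributes to at most one of the two counts. *)
Lemma path_count (P Q : pred V) x s : path (fun a b => ~~ (Q a && P b)) x s ->
  count P s + count Q (belast x s) <= size s.
Proof.
elim: s x => //= y s IH x /andP[n /IH]; move: n.
by case: (Q x); case: (P y) => //= _; rewrite ?add0n ?add1n ?addSn ?addnS // => /leqW.
Qed.

Lemma path_break (R : rel V) x s : ~~ path R x s ->
  exists s1 y s2, s = s1 ++ y :: s2 /\ ~~ R (last x s1) y.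
Proof.
elim: s x => //= y s IH x; rewrite negb_and => /orP[h|/IH[s1 [z [s2 [-> h]]]]].
  by exists [::], y, s.
by exists (y :: s1), z, s2.
Qed.

Lemma nth_meet (P Q : pred V) x0 s1 s2 : size s1 = size s2 ->
    size s1 < count P s1 + count Q s2 ->
  exists2 i, i < size s1 & P (nth x0 s1 i) && Q (nth x0 s2 i).
Proof.
elim: s1 s2 => [|x s1 IH] [|y s2] //= [sz].
have [/andP[Px Qy] _|n h] := boolP (P x && Q y); first by exists 0; rewrite /= ?Px.
have [|i il h'] := IH s2 sz; last by exists i.+1.
by move: n h; case: (P x); case: (Q y) => //= _; rewrite ?add0n ?add1n ?addSn ?addnS //= => /ltnW.
Qed.

Lemma count_nb e s x : uniq s -> nb e x \subset cset s -> count (e x) s = dg e x.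
Proof.
move=> un sub; rewrite -size_filter /dg -(card_uniqP (filter_uniq _ un)).
apply: eq_card => y; rewrite mem_filter in_nb.
by case E : (e x y) => //=; have := subsetP sub y; rewrite !inE => ->.
Qed.

(** * Ore's closure step and Posa's theorem *)

Definition adde e u v : rel V := fun x y =>
  [|| e x y, (x == u) && (y == v) | (x == v) && (y == u)].

Lemma adde_graph e u v : graph e -> u != v -> graph (adde e u v).
Proof.
move=> G uv; split=> [x y|x]; rewrite /adde; first by rewrite (graph_sym x) // [_ && _ || _]orbC ![(x == _) && _]andbC.
by rewrite graph_irr //=; case: eqP => [->|]; rewrite ?(negbTE uv) ?andbF.
Qed.

Lemma addeC e u v : adde e u v =2 adde e v u.
Proof. by move=> x y; rewrite /adde [X in _ || X]orbC. Qed.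

Lemma dg_adde e u v x : dg e x <= dg (adde e u v) x.
Proof. by apply/subset_leq_card/subsetP => y; rewrite !inE /adde => ->. Qed.

(** Crossing chords: by [path_count] some step from [x] to [y] of the path has [v] adjacent to [x]
    and [u] adjacent to [y]; reversing the part from [y] on closes the cycle. *)
Lemma ore_path e u v s : graph e -> path e u (rcons s v) -> uniq (u :: rcons s v) ->
    nb e u \subset cset (u :: rcons s v) -> nb e v \subset cset (u :: rcons s v) ->
    size s + 2 <= dg e u + dg e v ->
  has_cyc e (size s + 2).
Proof.
move=> G pa un su sv le.
set R := fun a b => ~~ (e v a && e u b).
have : ~~ path R u (rcons s v).
  apply: contraL le => /path_count; rewrite belast_rcons size_rcons.
  have -> : count (e u) (rcons s v) = dg e u.
    by rewrite -(count_nb un su) /= graph_irr.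
  have -> : count (e v) (u :: s) = dg e v.
    have un' : uniq (rcons (u :: s) v) by [].
    have sv' : nb e v \subset cset (rcons (u :: s) v) by [].
    by rewrite -(count_nb un' sv') -cats1 count_cat /= (graph_irr _ G) !addn0.
  by rewrite -ltnNge addn2 ltnS.
case/path_break=> q1 [y [q2 [E]]]; rewrite negbK => /andP[vx uy].
have la : last y q2 = v by have := congr1 (last u) E; rewrite last_rcons last_cat /= => <-.
move: pa un; rewrite E cat_path /= => /and3P[p1 _ p2] un.
exists (u :: q1 ++ rev (y :: q2)); split.
- rewrite /= rcons_cat cat_path p1 /=.
  have rE : rev (y :: q2) = v :: rev (belast y q2) by rewrite lastI la rev_rcons.
  have := rev_path e u (y :: q2); rewrite /= la rev_cons rE /= => ->.
  rewrite (graph_sym _ v) // vx /= (graph_sym _ u) // uy /=.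
  by apply: sub_path p2 => a b; rewrite (graph_sym a).
- rewrite (perm_uniq (_ : perm_eq _ (u :: q1 ++ y :: q2))) //.
  by rewrite perm_cons perm_cat2l perm_rev.
by move: (congr1 size E); rewrite size_rcons /= !size_cat size_rev /=; lia.
Qed.

Lemma ore e u v c : graph e -> u != v -> cycle (adde e u v) c -> uniq c -> 2 < size c ->
    nb e u \subset cset c -> nb e v \subset cset c -> size c <= dg e u + dg e v ->
  has_cyc e (size c).
Proof.
(* Unless [c] is already a cycle of [e], it uses the new edge in one of two directions; rotating
   puts this edge first. *)
move=> G; wlog cut : u v c / exists s, c = v :: u :: s.
  move=> wl uv cy un sz su sv le.
  have [cye|] := boolP (cycle e c); first by exists c.
  case: c cy un sz su sv le => [|x c] // cy un sz su sv le.
  have ex2 : all (fun a => e a (next (x :: c) a)) (x :: c) -> cycle e (x :: c).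
    move=> /allP al; apply: (@cycle_from_next _ _ _ un) => a ac; exact: al.
  move=> /(contra ex2); rewrite -has_predC => /hasP[a ac /= nab].
  have [i [s E]] := next_split un (ltnW sz) ac.
  have ab := next_cycle cy ac.
  have sz' : size (x :: c) = size (rot i (x :: c)) by rewrite size_rot.
  have cs : cset (rot i (x :: c)) = cset (x :: c).
    by apply/setP => z; rewrite !inE mem_rot inE.
  move: ab; rewrite /adde (negbTE nab) orFb => /orP[]/andP[/eqP au /eqP bv].
    rewrite -[(size c).+1]/(size (x :: c)) sz'; apply: (wl v u (rot i (x :: c))); rewrite ?cs ?rot_uniq ?size_rot ?(eq_sym v) ?(addnC (dg e v)) //.
      by exists s; rewrite E bv au.
    by rewrite rot_cycle; apply: sub_cycle cy => p q; rewrite addeC.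
  rewrite -[(size c).+1]/(size (x :: c)) sz'; apply: (wl u v (rot i (x :: c))); rewrite ?cs ?rot_uniq ?size_rot //.
    by exists s; rewrite E bv au.
  by rewrite rot_cycle.
case: cut => s -> uv /= /andP[_ pa] un sz su sv le.
have cs : cset (u :: rcons s v) = cset (v :: u :: s).
  by apply/setP => z; rewrite !inE mem_rcons inE orbCA.
have un' : uniq (u :: rcons s v).
  by move: un; rewrite /= !inE mem_rcons inE rcons_uniq !negb_or eq_sym => /and3P[/andP[-> ->] -> ->].
have -> : (size s).+2 = size s + 2 by rewrite addn2.
apply: (@ore_path _ u v); rewrite ?cs ?addn2 //.
case: s sz {un su sv le cs} un' pa => // y s _ un' /= /andP[uy pa].
have [yu yv] : y != u /\ y != v.
  move: un'; rewrite /= !inE !mem_rcons !inE !negb_or => /and3P[/and3P[uy' _ _] /andP[yv _] _].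
  by split; rewrite // eq_sym.
move: uy; rewrite /adde (negbTE yu) (negbTE yv) !andbF !orbF => ->.
apply: (sub_in_path (P := predC1 u)) pa.
  move=> p q; rewrite !inE => pu qu; rewrite /adde (negbTE pu) (negbTE qu) andbF.
  by rewrite !orbF.
apply/allP => z zs /=; apply: contraTneq zs => ->.
by move: un' => /= /andP[].
Qed.

(** Posa's condition on [N] vertices. With [m = h + 1] the first part says that fewer than [h] of
    them have degree at most [h], for [1 <= h < (N - 1) / 2]; for odd [N] the second says that at
    most [(N - 1) / 2] have degree at most [(N - 1) / 2]. *)
Definition posa N e :=
  (forall m, 2 <= m -> m.*2 <= N -> N + 2 <= ndeg e m + m) /\ uphalf N <= ndeg e (uphalf N).

Lemma nb_degge e x : graph e -> nb e x \subset degge e 1.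
Proof.
move=> G; apply/subsetP => y; rewrite !inE => xy; rewrite card_gt0; apply/set0Pn; exists x.
by rewrite in_nb graph_sym.
Qed.

(** The [N - 1 - dg e v] non-isolated vertices that are not adjacent to [v] have degree at most
    [h = dg e u]. A degree sum below [N] would make them at least [h] in number, too many for
    [posa]. *)
Lemma posa_pair N e u v : graph e -> ndeg e 1 = N -> posa N e ->
    u \in degge e 1 -> v \in degge e 1 -> u != v -> ~~ e u v -> dg e u <= dg e v ->
    (forall x, x \in degge e 1 -> x != v -> ~~ e x v -> dg e x <= dg e u) ->
  N <= dg e u + dg e v.
Proof.
move=> G cN [P1 P2] uS vS uv nuv le mx; rewrite leqNgt; apply/negP => lt.
set h := dg e u in le mx lt.
have h1 : 0 < h by move: uS; rewrite inE.
have low : #|degge e 1 :\: (v |: nb e v)| + ndeg e h.+1 + (dg e v <= h) <= N.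
  rewrite -cN /ndeg -addnA addnC.
  have -> : #|degge e h.+1| + (dg e v <= h) = #|if dg e v <= h then v |: degge e h.+1 else degge e h.+1|.
    by case: ifP => E; rewrite ?addn0 // cardsU1 inE ltnNge E addnC.
  set A := (if _ then _ else _).
  have dis : A :&: (degge e 1 :\: (v |: nb e v)) = set0.
    apply/setP => x; rewrite !inE; apply/negP => /andP[xA /andP[]].
    rewrite negb_or => /andP[xv nvx] x1.
    have := mx x _ xv _; rewrite inE x1 graph_sym // nvx => /(_ isT isT) xh.
    by move: xA; rewrite /A; case: ifP; rewrite !inE ?(negbTE xv) /= ltnNge xh.
  rewrite -[X in X <= _](cardsUI A) dis cards0 addn0; apply: subset_leq_card.
  rewrite subUset subsetDl andbT /A; apply/subsetP => x.
  have sub : x \in degge e h.+1 -> x \in degge e 1 by rewrite !in_degge; apply: leq_trans.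
  by case: ifP => _ //; rewrite in_setU1 => /orP[/eqP->|].
have nv : #|degge e 1 :\: (v |: nb e v)| + (dg e v).+1 = N.
  rewrite -cN /ndeg -[RHS](cardsID (v |: nb e v)) addnC; congr (_ + _).
  rewrite (setIidPr _); first by rewrite cardsU1 in_nb graph_irr.
  by rewrite subUset sub1set vS nb_degge.
have [hs|hs] := leqP (h.+1).*2 N.
  by have := P1 h.+1 h1 hs; move: low nv; clear -lt; lia.
(* The boundary case [N = 2 * h + 1]: now [v] itself counts as a low vertex, which contradicts the
   second part of [posa]. *)
have [E1 E2] : uphalf N = h.+1 /\ dg e v = h.
  have := odd_double_half N; rewrite uphalf_half.
  by move: lt le hs; clear; case: (odd N); lia.
by move: P2 low; rewrite E1 E2 leqnn; move: nv; rewrite E2; clear; lia.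
Qed.

(** Induction on the number of non-adjacent pairs: a new edge preserves [posa] and the non-isolated
    vertices, and [ore] removes it from the cycle. *)
Lemma posa_hamiltonian N e : 2 < N -> graph e -> ndeg e 1 = N -> posa N e -> has_cyc e N.
Proof.
move=> N3; have [m] := ubnP #|[set p : V * V | ~~ e p.1 p.2]|.
elim: m e => // m IH e lm G cN P.
pose T := [pred p : V * V | [&& p.1 \in degge e 1, p.2 \in degge e 1, p.1 != p.2,
   ~~ e p.1 p.2 & dg e p.1 <= dg e p.2]].
have [p0 Tp0|noT] := pickP T; last first.
  exists (enum (degge e 1)); split; rewrite ?enum_uniq // -?cardE //.
  have full x y : x \in degge e 1 -> y \in degge e 1 -> x != y -> e x y.
    move=> xS yS xy; apply: contraT => nxy.
    case: (leqP (dg e x) (dg e y)) => [le|/ltnW le].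
      by have := noT (x, y); rewrite /T /= xS yS xy nxy le.
    by have := noT (y, x); rewrite /T /= xS yS eq_sym xy (graph_sym y) // nxy le.
  have un := enum_uniq (degge e 1).
  apply: (@cycle_from_next _ _ _ un) => x xE; apply: full.
  - by move: xE; rewrite mem_enum.
  - by move: xE; rewrite -(mem_next _ x) mem_enum.
  have szE : 1 < size (enum (degge e 1)) by rewrite -cardE -/(ndeg e 1) cN ltnW.
  have [i [s E]] := next_split un szE xE.
  have : uniq (rot i (enum (degge e 1))) by rewrite rot_uniq.
  by rewrite E /= inE negb_or -andbA => /andP[].
(* A non-adjacent pair of largest degree sum has the maximality that [posa_pair] asks for. *)
case: (@arg_maxnP _ p0 T (fun p => dg e p.1 + dg e p.2) Tp0) => -[u v] /and5P[/= uS vS uv nuv le] mx.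
have sumN : N <= dg e u + dg e v.
  apply: (posa_pair G) => // x xS xv nxv.
  have [lxv|/ltnW lvx] := leqP (dg e x) (dg e v).
    by have := mx (x, v); rewrite /T /= xS vS xv nxv lxv leq_add2r => /(_ isT).
  have := mx (v, x); rewrite /T /= xS vS eq_sym xv (graph_sym v) // nxv lvx => /(_ isT).
  by rewrite addnC leq_add2r.
have Ga := adde_graph G uv.
have lev1 : degge (adde e u v) 1 = degge e 1.
  apply/setP => x; apply/idP/idP; rewrite !inE; last by move/leq_trans; apply; apply: dg_adde.
  rewrite card_gt0 => /set0Pn[y]; rewrite in_nb /adde.
  case/or3P => [xy|/andP[/eqP-> _]|/andP[/eqP-> _]]; rewrite -?in_degge //.
  by apply: (subsetP (nb_degge y G)); rewrite in_nb graph_sym.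
have ccle k : ndeg e k <= ndeg (adde e u v) k.
  by apply/subset_leq_card/subsetP => x; rewrite !inE => /leq_trans; apply; apply: dg_adde.
have [|||c [cy un sz]] := IH (adde e u v) _ Ga.
- rewrite -ltnS; apply: leq_trans lm; rewrite ltnS; apply: proper_card; apply/properP; split.
    by apply/subsetP => p; rewrite !inE; apply: contra; rewrite /adde => ->.
  by exists (u, v); rewrite !inE // /adde /= !eqxx orbT.
- by rewrite /ndeg lev1.
- case: P => [P1 P2]; split=> [k k2 kN|]; last exact: leq_trans P2 (ccle _).
  by apply: leq_trans (P1 k k2 kN) _; rewrite leq_add2r.
have cS : cset c = degge e 1.
  apply/eqP; rewrite eqEcard card_cset // sz -cN leqnn andbT -lev1.
  apply/subsetP => x; rewrite !inE => xc; exact: cycle_dg_gt0 cy xc.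
by rewrite -sz; apply: (ore G uv cy un); rewrite ?sz ?cS ?nb_degge.
Qed.

(** Write the cycle as [a], [b], [s]. For length [d + 3] the degree sum and the pigeonhole principle
    give an [i] with [b] adjacent to entry [i] of [s] and [a] adjacent to entry [i + d], read
    cyclically. *)
Lemma bondy e c a : graph e -> cycle e c -> uniq c -> a \in c -> 2 < size c ->
    nb e a \subset cset c -> nb e (next c a) \subset cset c ->
    size c < dg e a + dg e (next c a) ->
  forall r, 3 <= r <= size c -> has_cyc e r.
Proof.
move=> G cy un ac sz sa sb le r /andP[r3 rN].
have [i0 [s E]] := next_split un (ltnW sz) ac.
move: (next c a) E sb le => b E sb le.
have {cy} cy : cycle e [:: a, b & s] by rewrite -E rot_cycle.
have {un} un : uniq [:: a, b & s] by rewrite -E rot_uniq.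
have cE : cset c = cset [:: a, b & s] by rewrite -E; apply/setP => z; rewrite !inE mem_rot.
have szE : size c = (size s).+2 by rewrite -(size_rot i0) E.
rewrite {}cE in sa sb; rewrite {c ac E}szE in le rN sz *.
move: cy => /= /andP[ab pa].
have [d rE] : exists d, r = d + 3 by exists (r - 3); rewrite subnK.
have dM : d < size s by move: rN; rewrite rE addn3.
have cb : count (e b) s + 1 = dg e b.
  by rewrite -(count_nb un sb) /= (graph_irr b G) (graph_sym b a) // ab add0n addnC.
have ca : count (e a) (rot d s) + 1 = dg e a.
  have /permP-> : perm_eq (rot d s) s by rewrite perm_rot.
  by rewrite -(count_nb un sa) /= (graph_irr a G) ab add0n addnC.
have [||i iM /andP[bi ai]] := @nth_meet (e b) (e a) a s (rot d s).
- by rewrite size_rot.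
- by move: cb ca le; rewrite !addn1 => <- <-; rewrite addSn addnS !ltnS addnC.
have us : uniq s by move: un => /= /and3P[].
have [aS bS abn] : [/\ a \notin s, b \notin s & a != b].
  by move: un; rewrite /= inE negb_or => /and3P[/andP[-> ->] ->].
(* Without wrap-around, the segment of [s] from [i] to [i + d] is closed by [a] and [b]. *)
case: (ltnP (i + d) (size s)) => id.
  have ai' : e a (nth a s (i + d)).
    move: ai; rewrite /rot nth_cat size_drop nth_drop addnC.
    by rewrite (_ : i < size s - d) // ltn_subRL addnC.
  pose m := take d.+1 (drop i s).
  have szm : size m = d.+1 by rewrite size_takel // size_drop ltn_subRL.
  have [x [m' mE]] : exists x m', m = x :: m' by case: m szm => // x m' _; exists x, m'.
  have sE : s = take i s ++ m ++ drop d.+1 (drop i s) by rewrite !cat_take_drop.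
  have xi : x = nth a s i.
    by have := congr1 (fun q => nth a q 0) mE; rewrite /m nth_take // nth_drop addn0 => /= <-.
  have lm : last x m' = nth a s (i + d).
    have -> : last x m' = last a m by rewrite mE.
    by rewrite -nth_last szm nth_take // nth_drop.
  exists (b :: rcons m a); split.
  - move: pa; rewrite sE mE rcons_path !cat_path /= => /andP[/andP[_ /andP[/andP[_ pm] _]] _].
    by rewrite !rcons_path last_rcons pm lm (graph_sym _ a) // ai' ab [in e b x]xi bi.
  - have ms : {subset m <= s} by move=> z; rewrite [s]sE !mem_cat orbCA => ->.
    rewrite /= mem_rcons inE rcons_uniq negb_or eq_sym abn (contra (ms _) bS) (contra (ms _) aS) /=.
    by move: us; rewrite {1}sE cat_uniq => /and3P[_ _]; rewrite cat_uniq => /andP[].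
  - by rewrite /= size_rcons szm rE addn3.
(* With wrap-around, go from [b] along [s] to entry [i'], then to [a], and back from the end of [s]
   to entry [i]. *)
pose i' := i + d - size s.
have i'i : i' < i by rewrite /i'; move: dM id; clear; lia.
have ai' : e a (nth a s i').
  move: ai; rewrite /rot nth_cat size_drop ltnNge (_ : size s - d <= i) /=; last first.
    by rewrite leq_subLR addnC.
  have -> : i - (size s - d) = i' by rewrite /i'; move: id dM; clear; lia.
  by rewrite nth_take // /i' ltn_subLR // ltn_add2r.
have i's : i'.+1 <= size s by apply: leq_trans i'i (ltnW iM).
have dE : drop i s = nth a s i :: drop i.+1 s by apply: drop_nth.
have lp : last b (take i'.+1 s) = nth a s i'.
  by rewrite (take_nth a) // last_rcons.
move: pa; rewrite rcons_path => /andP[ps la].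
have sE : s = take i'.+1 s ++ drop i'.+1 (take i s) ++ drop i s.
  by rewrite catA -{1}(take_takel s i'i) cat_take_drop cat_take_drop.
have pe : path e b (take i'.+1 s) by move: ps; rewrite {1}sE cat_path => /andP[].
have pd : path e (nth a s i) (drop i.+1 s).
  by move: ps; rewrite -{1}(cat_take_drop i s) dE cat_path /= => /and3P[].
have ld : last (nth a s i) (drop i.+1 s) = last b s.
  by rewrite -[in RHS](cat_take_drop i s) dE last_cat.
exists (b :: take i'.+1 s ++ a :: rev (drop i s)); split.
- rewrite /= rcons_cat cat_path pe /= lp (graph_sym _ a) // ai' /=.
  have := rev_path e b (rcons (drop i s) a).
  rewrite last_rcons belast_rcons rev_cons => ->; rewrite dE /= (graph_sym _ b) // bi.
  rewrite rcons_path ld (graph_sym a) // la andbT.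
  by apply: sub_path pd => p q; rewrite (graph_sym p).
- have U : uniq (take i'.+1 s ++ drop i s).
    apply: subseq_uniq us; rewrite [X in subseq _ X]sE.
    by rewrite cat_subseq ?suffix_subseq.
  rewrite (perm_uniq (_ : perm_eq _ [:: a, b & take i'.+1 s ++ drop i s])); last first.
    rewrite perm_sym -cat1s -[b :: _ ++ a :: _]cat1s -(cat1s a (rev _)).
    by rewrite -(cat1s b) perm_catCA perm_cat2l perm_catCA !perm_cat2l perm_sym perm_rev.
  have sub : {subset take i'.+1 s ++ drop i s <= s}.
    by move=> z; rewrite mem_cat => /orP[/mem_take|/mem_drop].
  by rewrite /= inE negb_or abn (contra (sub _) aS) (contra (sub _) bS).
rewrite /= size_cat /= size_rev size_drop size_takel // /i' rE.
suff H n : i < n -> n <= i + d -> ((i + d - n).+1 + (n - i).+1).+1 = d + 3 by exact: H.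
by clear; lia.
Qed.

Lemma posa_odd_all N e : 2 < N -> odd N -> graph e -> ndeg e 1 = N -> posa N e ->
  forall r, 3 <= r <= N -> has_cyc e r.
Proof.
move=> N3 oN G cN P; have [c [cy un sz]] := posa_hamiltonian N3 G cN P.
have cS : cset c = degge e 1.
  apply/eqP; rewrite eqEcard card_cset // sz -cN leqnn andbT.
  apply/subsetP => x; rewrite !inE => xc; exact: cycle_dg_gt0 cy xc.
have hE : (uphalf N).*2 = N.+1.
  by have := odd_double_half N; rewrite uphalf_half oN; lia.
set K := degge e (uphalf N).
have Kc : K :&: cset c = K.
  apply/setIidPl; rewrite cS; apply/subsetP => x; rewrite !inE; apply: leq_trans.
  by move: hE; clear; lia.
have := card_pairs K K un; rewrite Kc sz => le.
have /card_gt0P[a] : 0 < #|pairs c K K|.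
  by case: P => _; rewrite /ndeg -/K; move: le hE; clear; lia.
rewrite !inE => /and3P[ac aK bK] r; rewrite -sz; apply: (bondy G cy un ac); rewrite ?cS ?nb_degge ?sz //.
by move: aK bK hE; clear; lia.
Qed.

End Hamiltonian.

(** * Deleting a vertex of minimum degree *)

Section Reduction.
Variable V : finType.
Implicit Types (e : rel V) (x y z u v w t a b : V) (A E L Q K S X : {set V}) (c s : seq V).

Definition degeq e m : {set V} := [set x | dg e x == m].
Definition deggt e m : {set V} := [set x | m < dg e x].

Lemma eq_degeq e e' : dg e' =1 dg e -> forall m, degeq e' m = degeq e m.
Proof. by move=> D m; apply/setP => x; rewrite !inE D. Qed.

Lemma ndeg_split e m : ndeg e m = #|degeq e m| + ndeg e m.+1.
Proof.
rewrite -cardsUI [X in _ = _ + X](_ : _ = 0) ?addn0.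
  by congr #|pred_of_set _|; apply/setP => x; rewrite !inE leq_eqVlt eq_sym.
by apply: eq_card0 => x; rewrite !inE; case: eqP => // ->; rewrite ltnn.
Qed.

Lemma deggt_ndeg e m : #|deggt e m| = ndeg e m.+1.
Proof. by []. Qed.

Lemma dg_lt_ndeg e x : graph e -> 0 < dg e x -> dg e x < ndeg e 1.
Proof.
move=> G x1; rewrite /ndeg (cardsD1 x) in_degge x1 add1n ltnS.
apply: subset_leq_card; apply/subsetP => y yx; rewrite !inE -in_degge (subsetP (nb_degge x G)) // andbT.
by apply: contraTneq yx => ->; rewrite in_nb graph_irr.
Qed.

Lemma ndeg_isolate e t m : graph e -> 0 < m ->
  ndeg (isolate e t) m + (m <= dg e t) + #|nb e t :&: degeq e m| = ndeg e m.
Proof.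
move=> G m0; rewrite /ndeg (cardsD1 t (degge e m)) in_degge [RHS]addnC addnAC; congr (_ + _).
rewrite -cardsUI [X in _ + X = _](_ : _ = 0) ?addn0.
  congr #|pred_of_set _|; apply/setP => x; rewrite !inE.
  case: (x =P t) => [->|/eqP xt] /=; first by rewrite dg_isolate0 leqNgt m0 graph_irr.
  rewrite (dg_isolate t x G) (negbTE xt) (graph_sym t) //; case: (e x t) => /=; last by rewrite addn0 orbF.
  by rewrite addn1 [in RHS]leq_eqVlt ltnS orbC eq_sym.
apply: eq_card0 => x; rewrite !inE; apply/negP => /and3P[le tx /eqP E].
have xt : x != t by apply: contraTneq tx => ->; rewrite graph_irr.
by move: le E; rewrite (dg_isolate t x G) (negbTE xt) (graph_sym x) // tx addn1 => + E; rewrite -E ltnn.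
Qed.

Lemma min_vertex e : 0 < ndeg e 1 ->
  exists t, 0 < dg e t /\ forall x, 0 < dg e x -> dg e t <= dg e x.
Proof.
case/card_gt0P=> x0; rewrite in_degge => x0P.
case: (@arg_minnP _ x0 (fun x => 0 < dg e x) (dg e) x0P) => t tP tmin.
by exists t.
Qed.

(** The new neighbours of [t] are [deggt e k], the prescribed [E], and a set [L] of lowest vertices.
    If [L] has no vertex of degree [m], level [m] loses only [t] and part of [E]. If it has one,
    every non-isolated vertex outside [L] and [t], except those of [E] of degree at most [m], stays
    at level [m]. *)
Lemma delete_min_counts k e t E : graph e -> 0 < dg e t ->
    (forall x, 0 < dg e x -> dg e t <= dg e x) ->
    E \subset degge e 1 -> [disjoint E & deggt e k] -> t \notin E ->
    #|deggt e k| < dg e t -> #|deggt e k| + #|E| <= dg e t -> dg e t <= k ->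
    k + (k <= dg e t) < ndeg e k ->
  exists e', [/\ graph e', dg e' =1 dg e & forall m, 0 < m <= k ->
    ndeg e m <= ndeg (isolate e' t) m + (m <= dg e t) + #|E :&: degeq e m| \/
    dg e t <= m /\ ndeg e 1 <= ndeg (isolate e' t) m + 1 + (dg e t - #|deggt e k| - #|E|)
                               + #|[set x in E | dg e x <= m]|].
Proof.
move=> G t0 tmin E1 Edis tE pj pEj jk big; set A := deggt e k.
have tA : t \notin A by rewrite inE -leqNgt.
set S := ((degge e 1 :\: A) :\: E) :\ t.
have A1 : A \subset degge e 1 by apply/subsetP => x; rewrite !inE; apply: leq_trans.
have EA : E \subset degge e 1 :\: A.
  by apply/subsetP => x xE; rewrite inE (subsetP E1) // andbT (disjointFr Edis).
have cS : #|S| + 1 + #|E| + #|A| = ndeg e 1.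
  have := cardsD1 t ((degge e 1 :\: A) :\: E); rewrite -/S !inE tE t0 -leqNgt jk /= => h1.
  have := cardsID E (degge e 1 :\: A); rewrite (setIidPr EA) h1 => h2.
  have := cardsID A (degge e 1); rewrite (setIidPr A1) -/(ndeg e 1); move: h2; clear; lia.
have [|L [LS cL lo]] := @lowest_subset V (dg e) S (dg e t - #|A| - #|E|).
  by have := dg_lt_ndeg G t0; move: cS pEj; rewrite -/A; clear; lia.
set Q := A :|: E :|: L.
have LE x : x \in L -> [/\ x \notin A, x \notin E, x != t & 0 < dg e x].
  by move/(subsetP LS); rewrite in_setD1 in_setD in_setD in_degge => /and4P[-> -> -> ->].
have cQ : #|Q| = dg e t.
  have d1 : A :&: E = set0 by apply/eqP; rewrite setI_eq0 disjoint_sym.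
  have d2 : (A :|: E) :&: L = set0.
    apply/setP => x; rewrite in_setI in_setU in_set0; apply/negP => /andP[+ /LE[xA xE _ _]].
    by rewrite (negbTE xA) (negbTE xE).
  by rewrite /Q cardsU d2 cards0 cardsU d1 cards0 cL !subn0; move: pEj; rewrite -/A; clear; lia.
have tQ : t \notin Q.
  rewrite !in_setU (negbTE tA) (negbTE tE) /=; apply/negP => /LE[_ _].
  by rewrite eqxx.
have [|y yQ||e' [G' D' N']] := @any_nb V k e t Q G cQ tQ.
- by apply/subsetP => x xA; rewrite !in_setU xA.
- apply: (leq_trans pj); apply: tmin; move: yQ; rewrite !in_setU -orbA => /or3P[yA|yE|/LE[]//].
    by move: (subsetP A1 _ yA); rewrite in_degge.
  by move: (subsetP E1 _ yE); rewrite in_degge.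
- by [].
exists e'; split=> // m /andP[m0 mk].
have := ndeg_isolate t G' m0; rewrite N' (eq_degeq D') (eq_ndeg D') D' => ciso.
have [L0|/set0Pn[x /setIP[xL]]] := eqVneq (L :&: degeq e m) set0.
  left; rewrite -ciso leq_add2l; apply: subset_leq_card; apply/subsetP => x.
  rewrite !in_setI !in_setU => /andP[/orP[/orP[xA|->//]|xL] xm].
    by move: xA xm; rewrite !inE => h /eqP h'; move: h h' mk; clear; lia.
  by have : x \in L :&: degeq e m; [rewrite inE xL | rewrite L0 inE].
rewrite inE => /eqP xm; right; split; first by rewrite -xm tmin // xm.
have sub : degge e 1 :\: (t |: (L :|: [set x in E | dg e x <= m])) \subset degge (isolate e' t) m.
  apply/subsetP => y; rewrite in_setD !in_setU in_set1 !inE !negb_or.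
  move=> /andP[/and3P[yt yL yE] y1].
  rewrite dg_isolateB // D' in_nb graph_sym // -in_nb N' !in_setU (negbTE yL) orbF.
  have [yE'|yE'] := boolP (y \in E).
    by move: yE; rewrite yE' orbT -ltnNge => h; move: h; clear; lia.
  have [yA|yA] := boolP (y \in A).
    by move: yA; rewrite inE => yA; move: yA mk; clear; lia.
  rewrite subn0 -xm; apply: lo => //.
  by rewrite in_setD1 in_setD in_setD in_degge yt yA yE' y1.
have := subset_leq_card sub.
have := cardsID (t |: (L :|: [set x in E | dg e x <= m])) (degge e 1).
have : #|degge e 1 :&: (t |: (L :|: [set x in E | dg e x <= m]))| <= 1 + (#|L| + #|[set x in E | dg e x <= m]|).
  apply: leq_trans (subset_leq_card (subsetIr _ _)) _.
  rewrite cardsU1; apply: leq_add; first by case: (_ \notin _).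
  by rewrite cardsU leq_subr.
rewrite cL /ndeg; move: (dg e t - _ - _) => g; clear; lia.
Qed.

(** The vertices of degree above [k] fill the neighbourhood of [t], so no level [m <= k] loses a
    neighbour. *)
Lemma delete_min_top k e t : graph e -> 0 < dg e t ->
    (forall x, 0 < dg e x -> dg e t <= dg e x) -> dg e t <= #|deggt e k| ->
  exists e', [/\ graph e', dg e' =1 dg e & forall m, 0 < m <= k ->
    ndeg e m <= ndeg (isolate e' t) m + (m <= dg e t)].
Proof.
move=> G t0 tmin jp.
(* Subtracting from [#|V|] reverses the order, so [L] consists of vertices of largest degree. *)
have [|L [LS cL lo]] := @lowest_subset V (fun x => #|V| - dg e x) (degge e 1 :\ t) (dg e t).
  have := dg_lt_ndeg G t0; rewrite /ndeg (cardsD1 t) in_degge t0; clear; lia.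
have tL : t \notin L by apply/negP => /(subsetP LS); rewrite !inE eqxx.
have hi x y : x \in L -> y \in degge e 1 -> y != t -> y \notin L -> dg e y <= dg e x.
  move=> xL y1 yt yL; have := lo x y xL; rewrite in_setD1 yt y1 yL => /(_ isT isT).
  have := max_card (nb e x); have := max_card (nb e y); rewrite -/(dg e x) -/(dg e y); clear; lia.
have [x y yL xL xt|e' [G' D' N']] := top_nb G cL tL.
  have [x1|] := boolP (x \in degge e 1); first exact: hi.
  by rewrite in_degge -leqNgt leqn0 => /eqP->.
exists e'; split=> // m /andP[m0 mk].
have := ndeg_isolate t G' m0; rewrite N' (eq_degeq D') (eq_ndeg D') D' => <-.
rewrite [X in _ + X](_ : _ = 0) ?addn0 //; apply: eq_card0 => x; rewrite in_setI inE.
apply/negP => /andP[xL /eqP xm].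
have : deggt e k \subset L :\ x.
  apply/subsetP => y; rewrite !inE => yk; have yx : y != x.
    by apply: contraTneq yk => ->; rewrite xm -leqNgt.
  rewrite yx /=; apply: contraT => yL.
  have [yt|yt] := eqVneq y t.
    have : 0 < dg e x by rewrite xm.
    by move=> /tmin; rewrite -yt xm; move: yk mk; clear; lia.
  have := hi x y xL _ yt yL; rewrite in_degge xm (leq_trans _ yk) // => /(_ isT).
  by move: yk mk; clear; lia.
move/subset_leq_card; have := cardsD1 x L; rewrite xL cL; move: jp; clear; lia.
Qed.

Definition reducible l e := exists e' t, [/\ graph e', dg e' =1 dg e, 0 < dg e t &
  degcond l (isolate e' t)].

Lemma reducible_potentially l e : reducible l e ->
    (forall e', graph e' -> degcond l e' -> ndeg e' 1 < ndeg e 1 -> potentially l e') -> potentially l e.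
Proof.
case=> e' [t [G' D' t0 C]] IH; apply: (eq_potentially D'); apply: (@potentially_isolate _ _ _ t G').
apply: IH => //; first exact: isolate_graph.
rewrite -(eq_ndeg D') -(ndeg_isolate t G' (ltn0Sn 0)) D' t0; clear; lia.
Qed.

Lemma ndeg_min e t m : (forall x, 0 < dg e x -> dg e t <= dg e x) -> 0 < m -> m <= dg e t -> ndeg e m = ndeg e 1.
Proof.
move=> tmin m0 mt; congr #|pred_of_set _|; apply/setP => x; rewrite !inE.
by apply/idP/idP => [|/tmin]; [apply: leq_trans | apply: leq_trans].
Qed.

Lemma uphalfP l : l <= (uphalf l).*2 <= l.+1.
Proof. by rewrite uphalf_half; have := odd_double_half l; case: (odd l); lia. Qed.

(** Apart from the case of [delete_min_top], only levels holding a lowest neighbour are in danger.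
    There the new count plus [m] is at least [ndeg e 1 + #|deggt e k| - 1], and at least [ndeg e 1]
    if [dg e t = 1]. *)
Lemma reduce_plain l e t : 5 <= l -> graph e -> degcond l e -> l < ndeg e 1 -> 0 < dg e t ->
    (forall x, 0 < dg e x -> dg e t <= dg e x) ->
    [|| dg e t <= #|deggt e (uphalf l)|, l + 3 <= ndeg e 1 + #|deggt e (uphalf l)|
      | (dg e t == 1) && (l + 2 <= ndeg e 1)] ->
  reducible l e.
Proof.
set k := uphalf l => l5 G C ln t0 tmin.
have /andP[kl1 kl2] := uphalfP l; rewrite -/k in kl1 kl2.
have loss m : 2 <= m -> m <= k -> l.+2 + (m <= dg e t) <= ndeg e m + m.
  move=> m2 mk; case: (leqP m (dg e t)) => [mt|_]; last by have := C m m2; move: mk kl2; clear; lia.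
  by rewrite (ndeg_min tmin _ mt) ?(ltnW m2) //; move: m2 ln; clear; lia.
have [jp _|pj] /= := leqP (dg e t) #|deggt e k|.
  have [e' [G' D' H]] := delete_min_top G t0 tmin jp; exists e', t; split=> // m m2 ml.
  have mk : m <= k by move: ml kl1; clear; lia.
  by have := H m; rewrite (ltnW m2) mk => /(_ isT); have := loss m m2 mk; clear; lia.
move=> big; have jk : dg e t <= k.
  rewrite leqNgt; apply/negP => kt; have := dg_lt_ndeg G t0.
  have : degge e 1 \subset deggt e k by apply/subsetP => x; rewrite !inE => /tmin; apply: leq_trans.
  by move/subset_leq_card; rewrite -/(ndeg e 1); move: pj; clear; lia.
have [|||||||e' [G' D' H]] := @delete_min_counts k e t set0 G t0 tmin; rewrite ?sub0set ?cards0 ?addn0 ?inE ?(ltnW pj) //.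
- by rewrite -setI_eq0 set0I.
- have [kt|kt] := leqP k (dg e t).
    rewrite (ndeg_min tmin) //; move: ln l5 kl1 kl2; clear; lia.
  have k2 : 2 <= k by move: l5 kl1; clear; lia.
  by have := C k k2 kl2; move: kl2; clear; lia.
exists e', t; split=> // m m2 ml.
have mk : m <= k by move: ml kl1; clear; lia.
have := H m; rewrite (ltnW m2) mk => /(_ isT); have := loss m m2 mk.
rewrite set0I cards0; have -> : #|[set x in set0 | dg e x <= m]| = 0.
  by apply: eq_card0 => x; rewrite !inE.
by move=> + [|[]]; move: big pj m2; clear; lia.
Qed.

Lemma sub_degeq e k E m : E \subset degeq e k -> m < k ->
  #|E :&: degeq e m| = 0 /\ #|[set x in E | dg e x <= m]| = 0.
Proof.
move=> EB mk; split; apply: eq_card0 => x; rewrite !inE; apply/negP => /andP[/(subsetP EB)];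
  rewrite inE => /eqP->; move: mk; clear; lia.
Qed.

Lemma subset_card (T : {set V}) g : g <= #|T| -> exists L, L \subset T /\ #|L| = g.
Proof. by move/(lowest_subset (fun=> 0)) => [L [LT cL _]]; exists L. Qed.

(** Giving [t] some [g] neighbours of degree exactly [k] costs at most [g] at level [k] and saves
    [g] low neighbours, which helps the levels below. *)
Lemma reduce_max_degree_counts l k e t g : 5 <= l -> graph e -> degcond l e -> l <= k.*2 <= l.+1 ->
    0 < dg e t -> (forall x, 0 < dg e x -> dg e t <= dg e x) ->
    #|deggt e k| < dg e t -> dg e t < k -> #|deggt e k| + g <= dg e t -> g <= #|degeq e k| ->
  exists e', [/\ graph e', dg e' =1 dg e & forall m, 0 < m <= k ->
    ndeg e m <= ndeg (isolate e' t) m + (m <= dg e t) + (m == k) * g \/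
    dg e t <= m /\ ndeg e 1 + #|deggt e k| <= ndeg (isolate e' t) m + 1 + (dg e t - g) + (m == k) * g].
Proof.
move=> l5 G C /andP[kl1 kl2] t0 tmin pj jk pg gB.
have [E [EB cE]] := subset_card gB.
have [|||||||e' [G' D' H]] := @delete_min_counts k e t E G t0 tmin; rewrite ?cE ?(ltnW jk) //.
- by apply/subsetP => x /(subsetP EB); rewrite !inE => /eqP->; move: jk; clear; lia.
- rewrite -setI_eq0 -subset0; apply/subsetP => x; rewrite in_setI => /andP[/(subsetP EB)].
  by rewrite !inE => /eqP->; rewrite ltnn.
- by apply/negP => /(subsetP EB); rewrite inE => /eqP h; move: jk; rewrite h ltnn.
- rewrite (leqNgt k) jk addn0.
  have k2 : 2 <= k by move: l5 kl1; clear; lia.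
  by have := C k k2 kl2; move: kl2; clear; lia.
exists e'; split=> // m mk; have := H m mk; rewrite cE.
have [mE|mE] := eqVneq m k.
  have b1 : #|E :&: degeq e k| <= g by rewrite -cE; apply/subset_leq_card/subsetIl.
  have b2 : #|[set x in E | dg e x <= k]| <= g.
    by rewrite -cE; apply/subset_leq_card/subsetP => x; rewrite inE => /andP[].
  rewrite mE mul1n; case=> [h|[h1 h]]; [left | right; split=> //]; move: h b1 b2 pg pj; clear; lia.
have mk' : m < k by rewrite ltn_neqAle mE; case/andP: mk.
have [-> ->] := sub_degeq EB mk'.
by rewrite mul0n !addn0; case=> [h|[h1 h]]; [left | right; split=> //]; move: h pg pj; clear; lia.
Qed.

Lemma reduce_max_degree l k e t g : 5 <= l -> graph e -> degcond l e -> l < ndeg e 1 -> l <= k.*2 <= l.+1 ->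
    0 < dg e t -> (forall x, 0 < dg e x -> dg e t <= dg e x) ->
    #|deggt e k| < dg e t -> dg e t < k -> #|deggt e k| + g <= dg e t -> g <= #|degeq e k| ->
    (l + 3 <= ndeg e 1 + #|deggt e k| + g) || (dg e t <= #|deggt e k| + g) ->
    l + 2 + g <= ndeg e k + k -> l + 3 + dg e t <= ndeg e 1 + #|deggt e k| + k ->
  reducible l e.
Proof.
move=> l5 G C ln kl t0 tmin pj jk pg gB opt hq hn.
have [e' [G' D' H]] := reduce_max_degree_counts l5 G C kl t0 tmin pj jk pg gB.
exists e', t; split=> // m m2 ml.
case/andP: kl => kl1 kl2.
have mk : 0 < m <= k by move: m2 ml kl1; clear; lia.
have C' := C m m2 ml; have := H m mk; have [mE|mE] := eqVneq m k.
  rewrite mE mul1n => -[|[_]]; move: hq hn jk pg; rewrite ?(leqNgt k) => h1 h2 h3 h4; rewrite ?h3; move: h1 h2 h3 h4; clear; lia.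
rewrite mul0n !addn0; have [mt|mt] := leqP m (dg e t).
  rewrite (ndeg_min tmin _ mt) ?(ltnW m2) // => -[|[]]; move: opt ln m2 pg mt; clear; lia.
by case=> [|[]]; move: C' opt ln m2 pg mt; clear; lia.
Qed.

Lemma potentially_posa l e e' t : 5 <= l -> odd l -> graph e' -> dg e' =1 dg e ->
  ndeg (isolate e' t) 1 = l -> posa l (isolate e' t) -> potentially l e.
Proof.
move=> l5 ol G' D' c1 P; apply: (eq_potentially D'); apply: (@potentially_isolate _ _ _ t G').
exists (isolate e' t); split=> //; first exact: isolate_graph.
by apply: posa_odd_all => //; [apply: leq_trans l5 | apply: isolate_graph].
Qed.

(** With only [l] vertices left, [posa] is enough; at level [k] it asks for [k] vertices, one fewer
    than [degcond]. *)
Lemma odd_delete_min l k e t g : 5 <= l -> graph e -> degcond l e -> ndeg e 1 = l.+1 -> l.+1 = k.*2 ->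
    0 < dg e t -> (forall x, 0 < dg e x -> dg e t <= dg e x) ->
    #|deggt e k| < dg e t -> dg e t < k -> #|deggt e k| + g <= dg e t -> g <= #|degeq e k| ->
    (2 <= #|deggt e k| + g) || (dg e t <= #|deggt e k| + g) -> k + g <= ndeg e k ->
  potentially l e.
Proof.
move=> l5 G C cl lk t0 tmin pj jk pg gB opt hq.
have kl : l <= k.*2 <= l.+1 by rewrite -lk leqnn leqnSn.
have [e' [G' D' H]] := reduce_max_degree_counts l5 G C kl t0 tmin pj jk pg gB.
have up : uphalf l = k by have := uphalfP l; move: lk; clear; lia.
have k3 : 3 <= k by move: lk l5; clear; lia.
apply: (@potentially_posa l e e' t) => //.
- by have := odd_double k; rewrite -lk /= => /negbFE.
- have h : 0 < 1 <= k by move: k3; clear; lia.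
  have k1 : (1 == k) = false by apply/eqP; move: k3; clear; lia.
  have := H 1 h; rewrite k1 mul0n !addn0.
  have := ndeg_isolate t G' (ltn0Sn 0); rewrite D' t0 (eq_ndeg D') cl => E [|[j1]]; first by move: E; clear; lia.
  by move: E j1 opt pg pj; clear; lia.
split=> [m m2 ml|].
  have mk : 0 < m <= k by move: m2 ml lk; clear; lia.
  have mk' : m != k by apply/eqP; move: ml lk; clear; lia.
  have ml' : m.*2 <= l.+1 by apply: leqW.
  have C' := C m m2 ml'; have := H m mk; rewrite (negbTE mk') mul0n !addn0.
  have [mt|mt] := leqP m (dg e t).
    by rewrite (ndeg_min tmin _ mt) ?(ltnW m2) // cl => -[|[]]; move: opt m2 pg mt; clear; lia.
  by rewrite cl; case=> [|[]]; move: C' opt m2 pg mt; clear; lia.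
rewrite up; have h : 0 < k <= k by move: k3; clear; lia.
have := H k h; rewrite eqxx mul1n cl.
by case=> [|[_]]; move: hq lk pg jk; clear; lia.
Qed.

End Reduction.

(** * Odd length *)

Section Odd.
Variable V : finType.
Implicit Types (e : rel V) (x y z u v w t a b : V) (A E L Q K S X : {set V}) (c s : seq V).

Definition residual_dg e u w (Qw Qu : {set V}) x :=
  if (x == u) || (x == w) then 0 else dg e x - (x \in Qw) - (x \in Qu).

(** The neighbourhood of [w] is fixed first and [w] deleted; Havel-Hakimi then serves [u], so [Qu]
    must have largest degrees only in what remains. *)
Lemma two_removed e u w (Qw Qu : {set V}) : graph e -> u != w -> u \in Qw -> w \notin Qu -> u \notin Qu ->
    (exists e', [/\ graph e', dg e' =1 dg e & nb e' w = Qw]) ->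
    #|Qu|.+1 = dg e u ->
    (forall x y, y \in Qu -> x \notin Qu -> x != u -> x != w ->
       dg e x - (x \in Qw) <= dg e y - (y \in Qw)) ->
  exists e', [/\ graph e', dg e' =1 dg e, nb e' w = Qw, nb e' u = w |: Qu &
    dg (isolate (isolate e' u) w) =1 residual_dg e u w Qw Qu].
Proof.
move=> G uw uQw wQu uQu [e' [G' D' N']] cQu top.
have dw x : dg (isolate e' w) x = if x == w then 0 else dg e x - (x \in Qw).
  case: eqP => [->|/eqP xw]; first exact: dg_isolate0.
  by rewrite dg_isolateB // D' in_nb graph_sym // -in_nb N'.
have [|||e2 [G2 D2 N2]] := @top_nb _ (isolate e' w) u Qu (isolate_graph w G').
- by rewrite dw (negbTE uw) uQw -cQu subn1.
- by [].
- move=> x y yQ xQ xu; rewrite !dw; have [//|xw] := eqVneq x w.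
  have [yw|yw] := eqVneq y w; first by rewrite yw (negbTE wQu) in yQ.
  exact: top.
have [Ga Da sa] := dg_readd G' G2 D2; rewrite N' in Ga Da sa.
set e3 := addv e2 w Qw in Ga Da sa.
have z2 : dg e2 w = 0 by rewrite D2 dw eqxx.
have wQw : w \notin Qw by rewrite -N' in_nb graph_irr.
have N3 : nb e3 w = Qw.
  by apply/setP => y; rewrite in_nb /e3 /addv eqxx (dg0 _ z2) (negbTE wQw) andbF orbF.
have N3u : nb e3 u = w |: Qu.
  by apply/setP => y; rewrite in_nb /e3 /addv (negbTE uw) uQw andbT -(in_nb e2) N2 !inE orbC.
have Da' : dg e3 =1 dg e by move=> x; rewrite Da D'.
exists e3; split=> // x; rewrite /residual_dg.
have [->|xu] := eqVneq x u.
  by rewrite dg_isolateB ?dg_isolate0 ?sub0n //; apply: isolate_graph.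
have [->|xw] := eqVneq x w; first exact: dg_isolate0.
rewrite dg_isolateB ?dg_isolateB //; last exact: isolate_graph.
rewrite Da' !in_nb /isolate (eq_sym w u) uw xu /=.
rewrite (graph_sym x u) // (graph_sym x w) // -!in_nb N3 N3u !inE (negbTE xw) /=.
by rewrite -!subnDA addnC.
Qed.

(** The members of [K] on [c] and their predecessors are disjoint and each make up half of the
    cycle. *)
Lemma pairs_alt c K a : uniq c -> pairs c K K = set0 -> size c = #|K :&: cset c|.*2 ->
  a \in c -> (next c a \in K) = (a \notin K).
Proof.
move=> un p0 sz ac.
set P := [set a in c | next c a \in K].
have dis : (K :&: cset c) :&: P = set0.
  by rewrite -p0; apply/setP => x; rewrite !inE; case: (x \in c); rewrite ?andbF ?andbT.
have : (K :&: cset c) :|: P = cset c.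
  apply/eqP; rewrite eqEcard cardsU dis cards0 subn0 /P card_next // card_cset // sz -addnn leqnn andbT.
  by apply/subsetP => x; rewrite !inE => /orP[]/andP[].
move/setP/(_ a); rewrite !inE ac !andbT /= => h.
move/setP/(_ a): dis; rewrite !inE ac !andbT /=; move: h.
by case: (a \in K); case: (next c a \in K).
Qed.

(** The vertices [last x s1] and [last y s2] precede [y] and [x]: the chord joins two ends of the
    arcs and [v] joins the other two. *)
Lemma chord_cycle e x y v s1 s2 : graph e -> s1 != [::] -> s2 != [::] ->
    cycle e (x :: s1 ++ y :: s2) -> uniq (x :: s1 ++ y :: s2) ->
    v \notin x :: s1 ++ y :: s2 -> e x y -> e v (last x s1) -> e v (last y s2) ->
  has_cyc e (size (x :: s1 ++ y :: s2)).+1.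
Proof.
move=> G n1 n2 cy un vn xy v1 v2.
exists (x :: y :: s2 ++ v :: rev s1); split.
- move: cy; rewrite /= rcons_cat cat_path /= rcons_path => /and4P[p1 _ p2 _].
  rewrite xy /= rcons_cat cat_path p2 /= (graph_sym _ v) // v2 /=.
  case: s1 n1 v1 p1 {un vn} => // z s1 _ v1 /= /andP[xz p1].
  have := rev_path e x (z :: s1).
  rewrite /= rev_cons [z :: s1]lastI rev_rcons /= (graph_sym v) // (graph_sym (last z s1)) //.
  move=> ->; rewrite -[in e v _]/(last x (z :: s1)) in v1 *; rewrite v1 /= (graph_sym z) // xz.
  by apply: sub_path p1 => p q; rewrite (graph_sym p).
- rewrite (perm_uniq (_ : perm_eq _ (v :: x :: s1 ++ y :: s2))); first by rewrite cons_uniq vn un.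
  apply/permP => P; rewrite /= !count_cat /= count_rev; move: (P _ : nat) (P _ : nat) (P _ : nat) (count _ _) (count _ _).
  by clear; lia.
by rewrite /= !size_cat /= size_rev !addnS addnC.
Qed.

(* [K] and the neighbourhood of the missing vertex [v] both alternate on [c]. *)
Lemma parity_cycle k e c v : graph e -> cycle e c -> uniq c -> 3 <= k -> size c = k.-1.*2 ->
    v \notin c -> degge e 1 \subset v |: cset c -> dg e v = k.-1 ->
    #|degeq e k.-1 :&: cset c| = k.-1 -> ndeg e k < k.-1 ->
  has_cyc e (size c).+1 \/ exists c1 a,
    [/\ cycle e c1, uniq c1, size c1 = size c & a \in pairs c1 (degeq e k.-1) (degeq e k.-1)].
Proof.
move=> G cy un k3 sz vc sub dv cK hi; set K := degeq e k.-1.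
have sz2 : 1 < size c by rewrite sz; move: k3; clear; lia.
have [/set0Pn[a aP]|/negbNE/eqP pK] := boolP (pairs c K K != set0).
  by right; exists c, a.
have [/set0Pn[a]|/negbNE/eqP pN] := boolP (pairs c (nb e v) (nb e v) != set0).
  rewrite inE !in_nb => /and3P[ac va vb]; left; rewrite -addn1.
  apply: (@insert_path V e c a [:: v]) => //; first by move=> z; rewrite inE => /eqP->.
  by rewrite /= (graph_sym a) // va vb.
have NC : nb e v :&: cset c = nb e v.
  apply/setIidPl/subsetP => x xn; have := subsetP sub x (subsetP (nb_degge v G) x xn).
  by rewrite in_setU1 => /orP[/eqP xv|//]; move: xn; rewrite xv in_nb graph_irr.
have altK a : a \in c -> (next c a \in K) = (a \notin K).
  by apply: pairs_alt => //; rewrite cK.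
have altN a : a \in c -> e v (next c a) = ~~ e v a.
  by move=> ac; rewrite -!in_nb; apply: pairs_alt => //; rewrite NC -/(dg e v) dv.
have nc a : a \in c -> next c a \in c by rewrite mem_next.
have same a : a \in c -> ((next c a \in K) == e v (next c a)) = ((a \in K) == e v a).
  by move=> ac; rewrite altK // altN //; case: (a \in K); case: (e v a).
(* If the two alternations agree, replace the successor of [a0] by [v], which has degree [k.-1]
   itself; then [v] and [d] are consecutive members of [K]. *)
have [a0 /andP[a0c /andP[a0K a0v]]|noa] := pickP (fun a => (a \in c) && ((a \in K) && e v a)).
  right; have [i [s E]] := next_split un sz2 a0c.
  set b := next c a0 in E.
  have b_c : b \in c by rewrite nc.
  have bK : b \notin K by rewrite /b altK // negbK.
  have bv : ~~ e v b by rewrite /b altN // negbK.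
  case: s E => [|d s] E.
    by have := congr1 size E; rewrite size_rot sz /= => h; move: h k3; clear; lia.
  have dE : d = next c b.
    rewrite -(next_rot i un) E /=.
    have : uniq (rot i c) by rewrite rot_uniq.
    by rewrite E /= !inE !negb_or eq_sym eqxx => /andP[/andP[/negbTE-> _] _].
  have d_c : d \in c by rewrite dE nc.
  have dK : d \in K by rewrite dE altK.
  have dv' : e v d by rewrite dE altN.
  have un' : uniq [:: a0, b, d & s] by rewrite -E rot_uniq.
  have cy' : cycle e [:: a0, b, d & s] by rewrite -E rot_cycle.
  have vK : v \in K by rewrite inE dv.
  have vs : v \notin [:: a0, b, d & s] by rewrite -E mem_rot.
  exists [:: a0, v, d & s], v; split.
  - by move: cy'; rewrite /= (graph_sym a0 v) // a0v dv' => /and3P[].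
  - move: un' vs; rewrite /= !inE !negb_or => /and4P[/and3P[_ h1 h2] _ h3 h4] /and4P[h5 _ h6 h7].
    by rewrite h1 h2 h3 h4 h6 h7 eq_sym h5.
  - by rewrite -(size_rot i c) E.
  rewrite in_set vK !inE eqxx orbT /=.
  have va0 : (v == a0) = false by apply/negbTE; move: vs; rewrite inE negb_or => /andP[].
  by rewrite va0 eqxx; move: dK; rewrite inE.
have KN a : a \in c -> e v a = (a \notin K).
  move=> ac; have := noa a; have := noa (next c a); rewrite ac nc // altK // altN //=.
  by case: (a \in K); case: (e v a).
have cY : #|cset c :\: K| = k.-1.
  have := cardsID K (cset c); rewrite card_cset // sz setIC cK; move: (k.-1) (#|_|); clear; lia.
(* An edge inside [K] serves as the chord. Without one, each vertex of [K] on [c] has neighbourhood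
   [cset c :\: K], so those [k.-1] vertices, also adjacent to [v], have degree at least [k], against
   the bound on [ndeg e k]. *)
have [[x y] /= /and5P[xc yc xK yK xy]|noe] := pickP (fun p : V * V =>
    [&& p.1 \in c, p.2 \in c, p.1 \in K, p.2 \in K & e p.1 p.2]); last first.
  have /subsetPn[y yY] : ~~ (cset c :\: K \subset degge e k).
    by apply: contraL hi => /subset_leq_card; rewrite cY -leqNgt.
  rewrite in_degge => /negP[]; apply: leq_trans (subset_leq_card (_ : v |: (K :&: cset c) \subset nb e y)).
    rewrite cardsU1 cK !inE (negbTE vc) andbF; move: k3; clear; lia.
  apply/subsetP => x; rewrite in_nb graph_sym // in_setU1 => /orP[/eqP->|].
    by move: yY; rewrite !inE => /andP[yK yc]; rewrite KN // inE.
  rewrite in_setI => /andP[xK]; rewrite inE => xc.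
  rewrite -in_nb; have -> : nb e x = cset c :\: K; last by [].
  apply/eqP; rewrite eqEcard cY; move: (xK); rewrite inE -/(dg e x) => /eqP->; rewrite leqnn andbT.
  apply/subsetP => z xz; have := subsetP sub z (subsetP (nb_degge x G) z xz).
  rewrite in_nb in xz; rewrite in_setU1 in_setD => /orP[/eqP zv|zc].
    by move: xz; rewrite zv graph_sym // KN // xK.
  rewrite zc andbT; apply/negP => zK; move: zc; rewrite inE => zc.
  by have := noe (x, z); rewrite /= xc zc xK zK xz.
left; have [i s E] := rot_to xc.
have xny : x != y by apply: graph_neq xy.
have ys : y \in s.
  have : y \in rot i c by rewrite mem_rot.
  by rewrite E inE eq_sym (negbTE xny).
have un' : uniq (x :: s) by rewrite -E rot_uniq.
have cy' : cycle e (x :: s) by rewrite -E rot_cycle.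
have mc z : (z \in x :: s) = (z \in c) by rewrite -E mem_rot.
have vs : v \notin x :: s by rewrite mc.
have : cycle (fun a b => (b \in K) == (a \notin K)) (x :: s).
  by rewrite -E rot_cycle; apply: (cycle_from_next un) => a ac; rewrite altK.
rewrite -(size_rot i c) E.
case/splitPr: ys un' cy' vs mc E => s1 s2 un' cy' vs mc E.
rewrite /= rcons_cat cat_path /= rcons_path => /and4P[_ /eqP h1 _ /eqP h2].
rewrite yK in h1; rewrite xK in h2.
have l1 : last x s1 \in c.
  rewrite -mc -cat_cons mem_cat; have := mem_last x s1; rewrite inE => /orP[/eqP->|->]; rewrite ?inE ?eqxx ?orbT //.
have l2 : last y s2 \in c.
  by rewrite -mc -cat_cons mem_cat mem_last orbT.
apply: (@chord_cycle e x y v s1 s2) => //.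
- by case: s1 h1 {un' cy' vs mc E l1} => //=; rewrite xK.
- by case: s2 h2 {un' cy' vs mc E l2} => //=; rewrite yK.
- by rewrite KN // -h1.
- by rewrite KN // -h2.
Qed.

End Odd.

(** * Odd length: the regular cases and the insertion of one vertex *)

Section OddCase.
Variable V : finType.
Implicit Types (e : rel V) (x y z u v w t a b : V) (A E L Q K S X : {set V}) (c s : seq V).

Lemma deggt0 e k x : #|deggt e k| = 0 -> dg e x <= k.
Proof.
move/eqP; rewrite cards_eq0 => /eqP/setP/(_ x); rewrite !inE => /negbT.
by rewrite -leqNgt.
Qed.

Lemma degge_deggt0 e k : #|deggt e k| = 0 -> degge e k = degeq e k.
Proof.
move=> p0; apply/setP => x; rewrite !inE; have := deggt0 x p0.
by rewrite eqn_leq => ->.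
Qed.

Lemma cset_degge e c : cycle e c -> cset c \subset degge e 1.
Proof. by move=> cy; apply/subsetP => x; rewrite !inE => xc; apply: cycle_dg_gt0 cy xc. Qed.

Lemma odd_delete_min_regular l k e t : 5 <= l -> graph e -> ndeg e 1 = l.+1 -> l.+1 = k.*2 ->
    0 < dg e t -> (forall x, 0 < dg e x -> dg e t <= dg e x) ->
    #|deggt e k| = 1 -> dg e t = k ->
  potentially l e.
Proof.
move=> l5 G cl lk t0 tmin p1 jk.
have ck : ndeg e k = l.+1 by rewrite (ndeg_min tmin) ?jk // -jk.
have k3 : 3 <= k by move: lk l5; clear; lia.
have [|||||||e' [G' D' H]] := @delete_min_counts V k e t set0 G t0 tmin;
  rewrite ?sub0set ?cards0 ?p1 ?inE ?jk ?leqnn ?ck //.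
- by rewrite -setI_eq0 set0I.
- by move: k3; clear; lia.
- by move: k3; clear; lia.
- by move: lk k3; clear; lia.
have up : uphalf l = k by have := uphalfP l; move: lk; clear; lia.
have c0 m : #|[set x in set0 | dg e x <= m]| = 0 by apply: eq_card0 => x; rewrite !inE.
have low m : 0 < m < k -> l <= ndeg (isolate e' t) m.
  move=> mk; have := H m; rewrite jk set0I c0 cards0 !addn0 (@ndeg_min V e t m tmin) ?jk ?cl.
  - by case/andP: mk => m0 mk; rewrite m0 (ltnW mk); case=> // [|[h]]; move: mk => //; try move: h; clear; lia.
  - by case/andP: mk.
  - by case/andP: mk => _ /ltnW.
apply: (@potentially_posa V l e e' t) => //.
- by have := odd_double k; rewrite -lk /= => /negbFE.
- have := ndeg_isolate t G' (ltn0Sn 0); rewrite D' t0 (eq_ndeg D') cl.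
  have := low 1; move: k3; clear; lia.
split=> [m m2 ml|].
  by have := low m; move: m2 ml lk; clear; lia.
rewrite up; have := H k; rewrite jk leqnn set0I c0 cards0 p1 ck cl.
by move: k3 lk; clear; lia.
Qed.

(** Joining [u] to the other [k] vertices of degree [k] leaves no degree above [k - 1]. Level
    [k - 1] then has more than [k] vertices, and the cycle misses at most one of them. *)
Lemma odd_insert k M e : 4 <= k -> M.+2 = k.*2 -> graph e -> degcond M.+1 e ->
    ndeg e 1 = k.*2 -> #|deggt e k| = 0 -> ndeg e k = k.+1 ->
    (forall e', graph e' -> degcond M e' -> potentially M e') ->
  potentially M.+1 e.
Proof.
move=> k4 Mk G C n1 p0 q IH.
have lek x := deggt0 x p0.
have BE := degge_deggt0 p0.
have : 0 < ndeg e k by rewrite q.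
case/card_gt0P=> u uB; have uk : dg e u = k by move: uB; rewrite BE inE => /eqP.
pose Q := degge e k :\ u.
have cQ : #|Q| = k by have := cardsD1 u (degge e k); rewrite uB -/(ndeg e k) q -/Q; clear; lia.
have QK x : x \in Q -> dg e x = k by rewrite in_setD1 BE inE => /andP[_ /eqP].
have [|||e' [G' D' N']] := @top_nb V e u Q G; rewrite ?cQ ?uk //.
- by rewrite in_setD1 eqxx.
- by move=> x y /QK-> _ _.
have uu : dg (isolate e' u) u = 0 := dg_isolate0 e' u.
have ciso m : 0 < m < k -> ndeg (isolate e' u) m + 1 = ndeg e m.
  case/andP=> m0 mk; have := ndeg_isolate u G' m0; rewrite N' D' uk (eq_degeq D') (eq_ndeg D') (ltnW mk).
  have -> : #|Q :&: degeq e m| = 0; last by rewrite addn0.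
  apply: eq_card0 => x; rewrite in_setI; apply/negP => /andP[/QK xk]; rewrite inE => /eqP h.
  by move: mk; rewrite -h xk ltnn.
have g1 : potentially M (isolate e' u).
  apply: IH; first exact: isolate_graph.
  move=> m m2 ml; have mk : 0 < m < k by move: m2 ml Mk; clear; lia.
  by have := ciso m mk; have := C m m2 (leqW ml); clear; lia.
pose K := degeq (isolate e' u) k.-1.
have QKs : Q \subset K.
  apply/subsetP => x xQ; have := xQ; rewrite in_setD1 => /andP[xu _].
  by rewrite inE dg_isolateB // D' QK // in_nb graph_sym // -in_nb N' xQ subn1.
have cK : k < #|K|.
  have ck1 := ciso k.-1; have := C k.-1; rewrite -ltnS.
  have : ndeg (isolate e' u) k.-1 <= #|K| + (ndeg (isolate e' u) k).
    by rewrite ndeg_split -/K prednK // ?leq_add2l //; apply: leq_trans k4.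
  have : ndeg (isolate e' u) k = 0.
    have := ndeg_isolate u G' (_ : 0 < k); rewrite N' D' uk (eq_degeq D') (eq_ndeg D') leqnn q.
    have -> : Q :&: degeq e k = Q by apply/setIidPl/subsetP => x /QK h; rewrite inE h.
    by rewrite cQ; move: k4; clear; lia.
  by move: ck1 k4 Mk; clear; lia.
have dK x : x \in K -> dg (isolate e' u) x = k.-1 by rewrite inE => /eqP.
have k10 : 0 < k.-1 by move: k4; clear; lia.
have dX x : x \in [set u] -> dg (isolate e' u) x = 0 by move=> /set1P->.
have [e2 [G2 D2 H2 lf]] := lift_step (extends1 G') g1 dX dK k10.
have [|c [cy un sz]] := H2 M; first by move: k4 Mk; clear; lia.
have cS : cset c \subset degge (isolate e' u) 1.
  by apply: subset_trans (cset_degge cy) _; apply/subsetP => x; rewrite !inE D2.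
have KS : K \subset degge (isolate e' u) 1.
  by apply/subsetP => x /dK h; rewrite in_degge h.
have oc := on_cycle un cS KS.
have /card_gt0P[a aP] : 0 < #|pairs c K K|.
  have := card_pairs K K un; have := ciso 1; rewrite n1 -/(ndeg (isolate e' u) 1); move: oc cK k4 Mk.
  rewrite /ndeg sz; clear; lia.
apply: (eq_potentially D').
apply: (@insert_vertex V [set u] K M e' (isolate e' u) e2 u c a) => //.
- by rewrite set11.
- rewrite N'; apply: leq_trans (subset_leq_card (_ : Q \subset _)); first by rewrite cQ; move: k4; clear; lia.
  by rewrite subsetI QKs subxx.
- by move: k4 Mk; clear; lia.
Qed.

(** Adjacent [u] and [w] get disjoint further neighbourhoods of [k - 1] vertices, all dropping to
    degree [k - 1]; only [u] joins the cycle. *)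
Lemma odd_regular k M e : 4 <= k -> M.+2 = k.*2 -> graph e ->
    k.*2 <= ndeg e 1 <= k.*2.+1 -> #|deggt e k| = 0 -> ndeg e k = ndeg e 1 ->
    (forall e', graph e' -> degcond M e' -> potentially M e') ->
  potentially M.+1 e.
Proof.
move=> k4 Mk G /andP[n1 n2] p0 q IH.
have lek x := deggt0 x p0.
have lE : degge e k = degge e 1.
  apply/eqP; rewrite eqEcard -/(ndeg e k) -/(ndeg e 1) q leqnn andbT.
  by apply/subsetP => x; rewrite !inE; apply: leq_trans; apply: leq_trans k4.
have dk x : x \in degge e 1 -> dg e x = k by rewrite -lE degge_deggt0 // inE => /eqP.
have : 0 < ndeg e 1 by move: n1 k4; clear; lia.
case/card_gt0P=> w w1.
have cT : #|degge e 1 :\ w| + 1 = ndeg e 1 by rewrite /ndeg (cardsD1 w (degge e 1)) w1 addnC.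
have [|Qw [QwT cQw]] := @subset_card V (degge e 1 :\ w) k; first by move: cT n1 k4; clear; lia.
have : 0 < #|Qw| by rewrite cQw; apply: leq_trans k4.
case/card_gt0P=> u uQw.
have [|Qu [QuT cQu]] := @subset_card V ((degge e 1 :\ w) :\: Qw) k.-1.
  have := cardsID Qw (degge e 1 :\ w); rewrite (setIidPr QwT) cQw; move: cT n1 k4; clear; lia.
have Qw1 x : x \in Qw -> dg e x = k /\ x != w.
  by move/(subsetP QwT); rewrite in_setD1 => /andP[-> /dk].
have Qu1 x : x \in Qu -> [/\ dg e x = k, x != w & x \notin Qw].
  by move/(subsetP QuT); rewrite in_setD in_setD1 => /and3P[-> -> /dk].
have [uk uw] := Qw1 u uQw.
have wQu : w \notin Qu by apply/negP => /Qu1[_]; rewrite eqxx.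
have uQu : u \notin Qu by apply/negP => /Qu1[_ _]; rewrite uQw.
have [|||e' [G' D' Nw Nu DR]] := two_removed G uw uQw wQu uQu.
- apply: (@any_nb V k) => //; rewrite -?/(deggt e k).
  + by rewrite cQw (dk w w1).
  + by apply/negP => /Qw1[_]; rewrite eqxx.
  + by move/eqP: p0; rewrite cards_eq0 => /eqP->; apply: sub0set.
  + by move=> y /Qw1[-> _]; rewrite p0; apply: leq_trans k4.
  + by rewrite (dk w w1) leqnn q; move: n1 k4; clear; lia.
- by rewrite cQu uk prednK //; apply: leq_trans k4.
- move=> x y /Qu1[-> _ /negbTE->] _ _ _; rewrite subn0; exact: leq_trans (leq_subr _ _) (lek x).
set e1 := isolate (isolate e' u) w in DR.
have G1 : graph e1 by do 2 apply: isolate_graph.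
have low x : x \in degge e 1 -> x != u -> x != w -> k.-1 <= dg e1 x.
  move=> x1 xu xw; rewrite DR /residual_dg (negbTE xu) (negbTE xw) /= (dk x x1).
  have [/Qu1[_ _ /negbTE->]|_] := boolP (x \in Qu); first by rewrite subn0 subn1.
  by rewrite subn0; case: (x \in Qw); rewrite ?subn0 ?subn1 ?leq_pred.
have cc1 m : 0 < m < k -> ndeg e 1 <= ndeg e1 m + 2.
  case/andP=> m0 mk; have : degge e 1 :\: [set u; w] \subset degge e1 m.
    apply/subsetP => x; rewrite in_setD in_set2 negb_or => /andP[/andP[xu xw] x1].
    by rewrite in_degge; apply: leq_trans (low x x1 xu xw); move: mk; clear; lia.
  move/subset_leq_card; have := cardsID [set u; w] (degge e 1).
  have : #|degge e 1 :&: [set u; w]| <= 2.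
    by apply: leq_trans (subset_leq_card (subsetIr _ _)) _; rewrite cards2; case: (_ != _).
  rewrite /ndeg; clear; lia.
have c11 : ndeg e1 1 + 2 <= ndeg e 1.
  have sub : degge e1 1 \subset degge e 1 :\: [set u; w].
    apply/subsetP => x; rewrite in_degge DR /residual_dg in_setD in_set2 in_degge.
    case: ((x == u) || (x == w)) => //=; clear; lia.
  have := subset_leq_card sub; have := cardsID [set u; w] (degge e 1).
  rewrite (setIidPr _) ?cards2 ?uw; first by rewrite /ndeg; clear; lia.
  by apply/subsetP => x; rewrite in_set2 in_degge => /orP[]/eqP->; rewrite ?uk ?(dk w w1); apply: leq_trans k4.
have g1 : potentially M e1.
  apply: IH => // m m2 ml; have mk : 0 < m < k by move: m2 ml Mk; clear; lia.
  by have := cc1 m mk; move: n1 m2 Mk; clear; lia.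
pose K := degeq e1 k.-1.
have QuK : Qu \subset K.
  apply/subsetP => x xQ; have [xk xw xn] := Qu1 x xQ.
  have xu : x != u by apply: contraNneq uQu => <-.
  by rewrite inE DR /residual_dg (negbTE xu) (negbTE xw) /= xk (negbTE xn) xQ subn0 subn1.
have QwK : Qw :\ u \subset K.
  apply/subsetP => x; rewrite in_setD1 => /andP[xu xQ]; have [xk xw] := Qw1 x xQ.
  have xn : x \notin Qu by apply/negP => /Qu1[_ _]; rewrite xQ.
  by rewrite inE DR /residual_dg (negbTE xu) (negbTE xw) /= xk xQ (negbTE xn) subn0 subn1.
have cK : k.-1.*2 <= #|K|.
  apply: leq_trans (subset_leq_card (_ : Qu :|: Qw :\ u \subset K)); last by rewrite subUset QuK.
  rewrite cardsU (_ : Qu :&: (Qw :\ u) = set0).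
    by have := cardsD1 u Qw; rewrite uQw cQw cQu cards0; move: k4; clear; lia.
  by apply/setP => x; rewrite in_setI in_setD1 in_set0; apply/negP => /and3P[/Qu1[_ _ /negbTE->]].
have dK x : x \in K -> dg e1 x = k.-1 by rewrite inE => /eqP.
have k10 : 0 < k.-1 by move: k4; clear; lia.
have dX x : x \in [set u; w] -> dg e1 x = 0 by rewrite in_set2 DR /residual_dg => ->.
have [e2 [G2 D2 H2 lf]] := lift_step (extends2 (u := u) (w := w) G') g1 dX dK k10.
have [|c [cy un sz]] := H2 M; first by move: k4 Mk; clear; lia.
have cS : cset c \subset degge e1 1.
  by apply: subset_trans (cset_degge cy) _; apply/subsetP => x; rewrite !inE D2.
have KS : K \subset degge e1 1 by apply/subsetP => x /dK h; rewrite in_degge h.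
have oc := on_cycle un cS KS.
have /card_gt0P[a aP] : 0 < #|pairs c K K|.
  have := card_pairs K K un; move: oc cK k4 Mk n2 c11; rewrite -/(ndeg e1 1) sz; clear; lia.
apply: (eq_potentially D').
apply: (@insert_vertex V [set u; w] K M e' e1 e2 u c a) => //.
- by rewrite in_set2 eqxx.
- rewrite Nu; apply: leq_trans (subset_leq_card (_ : Qu \subset _)).
    by rewrite cQu; move: k4; clear; lia.
  by rewrite subsetI QuK subsetUr.
- by move: k4 Mk; clear; lia.
Qed.

End OddCase.

(** * Odd length: the parity case and the case analysis *)

Section OddMain.
Variable V : finType.
Implicit Types (e : rel V) (x y z u v w t a b : V) (A E L Q K S X : {set V}) (c s : seq V).

(** A vertex [u] of degree [k] and the minimum vertex [t] are deleted. Keeping [d0] away from both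
    gives, with [Qu], [k] vertices of degree [k - 1]; the cycle misses one vertex, so possibly just
    half of it is in [K]. *)
Lemma odd_parity k M e t : 4 <= k -> M.+2 = k.*2 -> graph e -> degcond M.+1 e ->
    ndeg e 1 = k.*2.+1 -> #|deggt e k| = 0 -> ndeg e k = k.+1 ->
    0 < dg e t < k -> (forall x, 0 < dg e x -> dg e t <= dg e x) ->
    (forall e', graph e' -> degcond M e' -> potentially M e') ->
  potentially M.+1 e.
Proof.
move=> k4 Mk G C n1 p0 q /andP[t0 tk] tmin IH.
have lek x := deggt0 x p0.
have BE := degge_deggt0 p0.
have B1 : degge e k \subset degge e 1.
  by apply/subsetP => x; rewrite !in_degge; apply: leq_trans; apply: leq_trans k4.
have k10 : 0 < k.-1 by move: k4; clear; lia.
have [d0 [d0k d0t]] : exists d0, dg e d0 = k.-1 /\ d0 != t.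
  have : 0 < #|degeq e k.-1 :\ t|.
    have := cardsD1 t (degeq e k.-1); have := ndeg_split e k.-1; rewrite prednK ?q ?inE; last exact: leq_trans k4.
    have [jk|jk] := eqVneq (dg e t) k.-1.
      rewrite (@ndeg_min V e t k.-1 tmin) ?jk // n1; move: k4; clear; lia.
    have := C k.-1; move: k4 Mk; clear; lia.
  case/card_gt0P=> d0; rewrite in_setD1 inE => /andP[h1 /eqP h2].
  by exists d0.
have : 0 < ndeg e k by rewrite q.
case/card_gt0P=> u uB; have uk : dg e u = k by move: uB; rewrite BE inE => /eqP.
have d0B : d0 \notin degge e k by rewrite in_degge d0k; move: k4; clear; lia.
have d01 : d0 \in degge e 1 by rewrite in_degge d0k.
have tB : t \notin degge e k by rewrite in_degge -ltnNge.
have t1 : t \in degge e 1 by rewrite in_degge.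
set S := ((degge e 1 :\: degge e k) :\ t) :\ d0.
have cS : #|S| = k - 2.
  have := cardsD1 d0 ((degge e 1 :\: degge e k) :\ t); rewrite -/S in_setD1 in_setD d0t d0B d01.
  have := cardsD1 t (degge e 1 :\: degge e k); rewrite in_setD tB t1.
  have := cardsID (degge e k) (degge e 1); rewrite (setIidPr B1) -/(ndeg e 1) -/(ndeg e k) n1 q; move: k4; clear; lia.
have [|L [LS cL lo]] := @lowest_subset V (dg e) S (dg e t).-1; first by rewrite cS; move: tk; clear; lia.
have LE x : x \in L -> [/\ x != d0, x != t, x \notin degge e k & 0 < dg e x].
  by move/(subsetP LS); rewrite !in_setD1 in_setD [x \in degge e 1]in_degge => /and4P[-> -> -> ->].
have uL : u \notin L by apply/negP => /LE[_ _]; rewrite uB.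
have tL : t \notin L by apply/negP => /LE[_]; rewrite eqxx.
have ut : u != t by apply: contraNneq tB => <-.
pose Qt := u |: L.
have cB : #|degge e k :\ u| = k by have := cardsD1 u (degge e k); rewrite uB -/(ndeg e k) q; clear; lia.
have [|Qu [QuB cQu]] := @subset_card V (degge e k :\ u) k.-1; first by rewrite cB; clear; lia.
have QuE x : x \in Qu -> [/\ dg e x = k, x != u, x \notin L & x != t].
  move/(subsetP QuB); rewrite in_setD1 => /andP[xu xB]; split=> //.
  - by move: xB; rewrite BE inE => /eqP.
  - by apply/negP => /LE[_ _]; rewrite xB.
  - by apply: contraNneq tB => <-.
have QuT x : x \in Qu -> x \in Qt = false.
  by move=> /QuE[_ xu xL _]; rewrite in_setU1 (negbTE xu) (negbTE xL).
have [||||||e' [G' D' Nt Nu DR]] := @two_removed V e u t Qt Qu G ut.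
- by rewrite in_setU1 eqxx.
- by apply/negP => /QuE[_ _ _]; rewrite eqxx.
- by apply/negP => /QuE[_]; rewrite eqxx.
- apply: (@any_nb V k) => //; rewrite -?/(deggt e k).
  + by rewrite cardsU1 uL cL; move: t0; clear; lia.
  + by rewrite in_setU1 negb_or eq_sym ut.
  + by move/eqP: p0; rewrite cards_eq0 => /eqP->; apply: sub0set.
  + by move=> y; rewrite p0 in_setU1 => /orP[/eqP->|/LE[]//]; rewrite uk; apply: leq_trans k4.
  + by rewrite (leqNgt k) tk q addn0.
- by rewrite cQu uk prednK //; apply: leq_trans k4.
- move=> x y yQ _ _ _; rewrite (QuT y yQ) subn0; have [-> _ _ _] := QuE y yQ.
  exact: leq_trans (leq_subr _ _) (lek x).
set e1 := isolate (isolate e' u) t in DR.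
have G1 : graph e1 by do 2 apply: isolate_graph.
have DR' x : x != u -> x != t -> dg e1 x = dg e x - (x \in L) - (x \in Qu).
  by move=> xu xt; rewrite DR /residual_dg (negbTE xu) (negbTE xt) /= in_setU1 (negbTE xu).
have DQ x : x \in Qu -> dg e1 x = k.-1.
  by move=> xQ; have [xk xu xL xt] := QuE x xQ; rewrite DR' // xk (negbTE xL) xQ subn0 subn1.
have DL x : x \in L -> dg e1 x = (dg e x).-1.
  move=> xL; have [_ xt xB _] := LE x xL; have xu : x != u by apply: contraNneq xB => ->.
  have xQ : x \notin Qu by apply/negP => /QuE[_ _]; rewrite xL.
  by rewrite DR' // xL (negbTE xQ) subn0 subn1.
have DO x : x != u -> x != t -> x \notin L -> x \notin Qu -> dg e1 x = dg e x.
  by move=> xu xt /negbTE xL /negbTE xQ; rewrite DR' // xL xQ !subn0.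
have cQut : #|degge e 1 :\: [set u; t]| + 2 = ndeg e 1.
  have := cardsID [set u; t] (degge e 1); rewrite (setIidPr _) ?cards2 ?ut; first by rewrite /ndeg; clear; lia.
  by apply/subsetP => x; rewrite in_set2 => /orP[]/eqP-> //; apply: (subsetP B1).
have c11 : ndeg e1 1 + 2 <= ndeg e 1.
  rewrite -cQut leq_add2r; apply: subset_leq_card; apply/subsetP => x.
  rewrite in_degge DR /residual_dg in_setD in_set2 in_degge.
  by case: ((x == u) || (x == t)) => //=; clear; lia.
have g1 : potentially M e1.
  apply: IH => // m m2 ml; have mk : m < k by move: m2 ml Mk; clear; lia.
  (* For [m < dg e t] only [u] and [t] are lost. For larger [m] with no vertex of degree [m] in [L],
     only [u] is lost. Otherwise all non-isolated vertices outside [u], [t] and [L] remain at level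
     [m]. *)
  have [mj|jm] := ltnP m (dg e t).
    have sub : degge e 1 :\: [set u; t] \subset degge e1 m.
      apply/subsetP => x; rewrite in_setD in_set2 negb_or !in_degge => /andP[/andP[xu xt] /tmin x1].
      have [xQ|xQ] := boolP (x \in Qu); first by rewrite DQ //; move: mk; clear; lia.
      have [xL|xL] := boolP (x \in L); first by rewrite DL //; move: mj x1; clear; lia.
      by rewrite DO //; move: mj x1; clear; lia.
    by have := subset_leq_card sub; rewrite -/(ndeg e1 m); move: cQut n1 m2 Mk; clear; lia.
  have [/andP[mj /eqP Lm]|nLm] := boolP ((dg e t < m) && (L :&: degeq e m == set0)).
    have sub : degge e m :\ u \subset degge e1 m.
      apply/subsetP => x; rewrite in_setD1 !in_degge => /andP[xu xm].
      have xt : x != t by apply: contraTneq xm => ->; rewrite -ltnNge.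
      have [xQ|xQ] := boolP (x \in Qu); first by rewrite DQ //; move: mk; clear; lia.
      have [xL|xL] := boolP (x \in L); last by rewrite DO.
      rewrite DL //; have xm' : dg e x != m.
        by apply/eqP => E; have : x \in L :&: degeq e m; [rewrite in_setI xL inE E eqxx | rewrite Lm in_set0].
      by move: xm xm'; clear; lia.
    have := subset_leq_card sub; have := cardsD1 u (degge e m); rewrite in_degge uk (ltnW mk) -/(ndeg e m) -/(ndeg e1 m).
    by have := C m m2 (leqW ml); clear; lia.
  have lowm y : y \in S -> y \notin L -> m <= dg e y.
    move=> yS yL; have y0 : 0 < dg e y.
      by move: yS; rewrite !in_setD1 in_setD [y \in degge e 1]in_degge => /and4P[_ _ _].
    move: nLm; rewrite negb_and -leqNgt => /orP[mt|/set0Pn[x /setIP[xL]]].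
      exact: leq_trans mt (tmin y y0).
    by rewrite inE => /eqP <-; apply: lo.
  have sub : (degge e 1 :\: [set u; t]) :\: L \subset degge e1 m.
    apply/subsetP => x; rewrite !in_setD in_set2 negb_or => /and3P[xL /andP[xu xt] x1].
    have [xQ|xQ] := boolP (x \in Qu); first by rewrite in_degge DQ //; move: mk; clear; lia.
    rewrite in_degge DO //; have [xB|xB] := boolP (x \in degge e k).
      by move: xB; rewrite in_degge; move: mk; clear; lia.
    have [->|xd] := eqVneq x d0; first by rewrite d0k; move: mk; clear; lia.
    by apply: lowm => //; rewrite !in_setD1 in_setD xd xt xB x1.
  have := subset_leq_card sub; have := cardsID L (degge e 1 :\: [set u; t]); rewrite -/(ndeg e1 m).
  have := subset_leq_card (subsetIr (degge e 1 :\: [set u; t]) L); rewrite cL.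
  by move: cQut n1 jm Mk t0; clear; lia.
pose K := degeq e1 k.-1.
have QuK : Qu \subset K by apply/subsetP => x xQ; rewrite inE DQ.
have d0u : d0 != u by apply: contraNneq d0B => ->.
have d0Q : d0 \notin Qu by apply/negP => /QuE[h _ _ _]; move: d0k; rewrite h; move: k4; clear; lia.
have d0L : d0 \notin L by apply/negP => /LE[]; rewrite eqxx.
have d0K : d0 \in K by rewrite inE DO // d0k.
have cK : k <= #|K|.
  apply: leq_trans (subset_leq_card (_ : d0 |: Qu \subset K)); last by rewrite subUset sub1set d0K.
  by rewrite cardsU1 d0Q cQu; clear; lia.
have dK x : x \in K -> dg e1 x = k.-1 by rewrite inE => /eqP.
have dX x : x \in [set u; t] -> dg e1 x = 0 by rewrite in_set2 DR /residual_dg => ->.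
have [e2 [G2 D2 H2 lf]] := lift_step (extends2 (u := u) (w := t) G') g1 dX dK k10.
have [|c [cy un sz]] := H2 M; first by move: k4 Mk; clear; lia.
have cS1 : cset c \subset degge e1 1.
  by apply: subset_trans (cset_degge cy) _; apply/subsetP => x; rewrite !inE D2.
have KS : K \subset degge e1 1 by apply/subsetP => x /dK h; rewrite in_degge h.
have oc := on_cycle un cS1 KS.
apply: (eq_potentially D').
have uX : u \in [set u; t] by rewrite in_set2 eqxx.
have cKu : 2 <= #|K :&: nb e' u|.
  rewrite Nu; apply: leq_trans (subset_leq_card (_ : Qu \subset _)).
    by rewrite cQu; move: k4; clear; lia.
  by rewrite subsetI QuK subsetUr.
have M2 : 2 <= M by move: k4 Mk; clear; lia.
have [/set0Pn[a aP]|/negbNE/eqP pK] := boolP (pairs c K K != set0).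
  exact: (@insert_vertex V [set u; t] K M e' e1 e2 u c a).
(* Without consecutive members exactly [k - 1] vertices of [K] are on the cycle, so the one vertex
   off it belongs to [K]. *)
have := card_pairs K K un; rewrite pK cards0 addn0 sz => cp.
have cE : #|K :&: cset c| = k.-1 by move: oc cp cK c11 n1 Mk; rewrite sz /ndeg; clear; lia.
have /subsetPn[v vK vc] : ~~ (K \subset cset c).
  by apply/negP => /setIidPl E; move: cE cK; rewrite E; move: k4; clear; lia.
rewrite inE in vc.
have lE : degge e2 1 \subset v |: cset c.
  have -> : degge e2 1 = degge e1 1 by apply/setP => x; rewrite !inE D2.
  have -> : v |: cset c = degge e1 1; last by [].
  apply/eqP; rewrite eqEcard subUset sub1set (subsetP KS) // cS1 /= cardsU1 inE vc card_cset // sz.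
  by move: c11 n1 Mk; rewrite /ndeg; clear; lia.
have [|||||||hc1|[c1 [a [cy1 un1 sz1 aP]]]] := @parity_cycle V k e2 c v G2 cy un; rewrite ?(eq_degeq D2) //.
- exact: leq_trans k4.
- by rewrite sz; move: Mk; clear; lia.
- by rewrite D2 dK.
- rewrite (eq_ndeg D2).
  have sub : degge e1 k \subset (degge e k :\ u) :\: Qu.
    apply/subsetP => x; rewrite in_degge => xk.
    have xX : x \notin [set u; t] by apply: contraTN xk => /dX->; rewrite -ltnNge; apply: leq_trans k4.
    move: xX; rewrite in_set2 negb_or => /andP[xu xt].
    have xQ : x \notin Qu by apply: contraTN xk => /DQ->; rewrite -ltnNge; move: k4; clear; lia.
    rewrite in_setD in_setD1 xQ xu in_degge; move: xk; rewrite DR' //; clear; lia.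
  apply: leq_ltn_trans (subset_leq_card sub) _; have := cardsID Qu (degge e k :\ u).
  by rewrite (setIidPr QuB) cQu cB; move: k4; clear; lia.
(* Empty lists: no vertex has to be moved, the deleted ones are just put back. *)
- have [|||||s [e3 [G3 D3 [s3 x3 _] H3 sX]]] := lf [::] [::]; rewrite //.
  exists e3; split=> // r /andP[r3]; rewrite leq_eqVlt => /orP[/eqP->|rM]; last by apply: H3; rewrite r3.
  by rewrite -sz; apply: (@sub_has_cyc V (relabel e2 s)); [move=> x y; apply: s3 | apply: has_cyc_relabel].
rewrite !(eq_degeq D2) in aP; have sz1' : size c1 = M by rewrite sz1.
exact: (@insert_vertex V [set u; t] K M e' e1 e2 u c1 a).
Qed.

Lemma odd_case l e : 7 <= l -> odd l -> graph e -> degcond l e ->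
    (forall e', graph e' -> degcond l.-1 e' -> potentially l.-1 e') ->
    (forall e', graph e' -> degcond l e' -> ndeg e' 1 < ndeg e 1 -> potentially l e') ->
  potentially l e.
Proof.
move=> l7 ol G C IHl IHn.
have l5 : 5 <= l by apply: leq_trans l7.
have nl : l <= ndeg e 1.
  apply: leq_trans (ndeg_mono e (_ : 1 <= 2)) => //.
  by have := C 2; move: l7; clear; lia.
set k := uphalf l; have kl : k.*2 = l.+1.
  by have := odd_double_half l; rewrite /k uphalf_half ol; clear; lia.
have k4 : 4 <= k by move: l7 kl; clear; lia.
have ck : k < ndeg e k by have := C k; move: kl k4; clear; lia.
move: nl; rewrite leq_eqVlt => /orP[/eqP nl|nl].
  exists e; split=> //; apply: posa_odd_all => //; first exact: leq_trans l7.
  split=> [m m2 ml|]; last by rewrite -/k ltnW.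
  by rewrite addn2; apply: C => //; apply: leqW.
have [|t [t0 tmin]] := @min_vertex V e; first exact: leq_trans nl.
have [red|] := boolP ((dg e t <= #|deggt e k|) || (l + 3 <= ndeg e 1 + #|deggt e k|)).
  by apply: reducible_potentially IHn; apply: (reduce_plain l5 G C nl t0 tmin); rewrite orbA red.
rewrite negb_or -!ltnNge => /andP[pj np].
have jk : dg e t <= k.
  rewrite leqNgt; apply/negP => kt; have := dg_lt_ndeg G t0.
  have : degge e 1 \subset deggt e k by apply/subsetP => x; rewrite !inE => /tmin; apply: leq_trans.
  by move/subset_leq_card; rewrite -/(ndeg e 1); move: pj; clear; lia.
have [M lM] : exists M, l = M.+1 by exists l.-1; rewrite prednK //; apply: leq_trans l7.
have Mk : M.+2 = k.*2 by rewrite kl lM.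
have IHM e' : graph e' -> degcond M e' -> potentially M e' by have := IHl e'; rewrite lM.
have kl2 : l <= k.*2 <= l.+1 by rewrite kl leqnn leqnSn.
have B1 : ndeg e k = #|degeq e k| + #|deggt e k| by rewrite ndeg_split.
move: jk; rewrite leq_eqVlt => /orP[/eqP jk|jk].
  have ccE : ndeg e k = ndeg e 1 by rewrite (ndeg_min tmin) ?jk //; apply: leq_trans k4.
  have [p0|p1] := posnP #|deggt e k|.
    rewrite lM; apply: (odd_regular k4 Mk) => //.
    by rewrite kl; move: np nl p0; clear; lia.
  by apply: (@odd_delete_min_regular V l k e t) => //; move: np nl p1; clear; lia.
have [p0|p1] := posnP #|deggt e k|; last first.
  (* Here [np] and [nl] force [ndeg e 1 = l.+1] and a single vertex of degree above [k]. *)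
  by apply: (@odd_delete_min V l k e t 1) => //; move: np nl p1 pj ck k4 B1; clear; lia.
have [q|q] := leqP (ndeg e k) k.+1.
  have qE : ndeg e k = k.+1 by apply/eqP; rewrite eqn_leq q.
  have [n1|n1] := eqVneq (ndeg e 1) l.+1.
    by rewrite lM; apply: (odd_insert k4 Mk) => //; rewrite -?lM // kl.
  rewrite lM; apply: (@odd_parity k M e t) => //; rewrite -?lM ?t0 // kl.
  by move: np nl n1 p0; clear; lia.
have [n1|n1] := eqVneq (ndeg e 1) l.+1.
  (* Two neighbours of degree [k] give enough slack; if [dg e t = 1], one of them is already the
     whole neighbourhood. *)
  by apply: (@odd_delete_min V l k e t (minn 2 (dg e t))) => //; move: np nl p0 pj q k4 B1 t0; clear; lia.
apply: reducible_potentially IHn; apply: (@reduce_max_degree V l k e t 1) => //;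
  by move: np nl n1 p0 pj q k4 B1 t0 jk kl; clear; lia.
Qed.

End OddMain.

(** * Even length *)

Section EvenInsertion.
Variable V : finType.
Implicit Types (e : rel V) (x y z u v w t a b h : V) (A E L Q K S X : {set V}) (c s : seq V).

Lemma next_next c a : uniq c -> 2 < size c -> a \in c -> next c (next c a) != a.
Proof.
move=> un sz ac; have [i [s E]] := next_split un (ltnW sz) ac.
have un' : uniq (rot i c) by rewrite rot_uniq.
have sz' : 2 < size (rot i c) by rewrite size_rot.
rewrite -(next_rot i un) E; move: un' sz'; rewrite E.
case: s {E} => // d s /=; rewrite !inE !negb_or => /andP[/and3P[ab ad _] _] _.
by rewrite (eq_sym (next c a) a) (negbTE ab) eqxx eq_sym.
Qed.

Lemma potentially_add2 M e e3 : graph e3 -> dg e3 =1 dg e -> (forall r, 3 <= r <= M -> has_cyc e3 r) ->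
  has_cyc e3 M.+1 -> has_cyc e3 M.+2 -> potentially M.+2 e.
Proof.
move=> G3 D3 H3 h1 h2; exists e3; split=> // r /andP[r3].
rewrite leq_eqVlt => /orP[/eqP->//|]; rewrite ltnS leq_eqVlt => /orP[/eqP->//|rM].
by apply: H3; rewrite r3.
Qed.

(** The vertex [h] is adjacent to [u] and [w] and stays in place; beside it either [u] or the path
    [w], [u] fits, the other end being a neighbour of [u] in [K]. *)
Lemma insert_hub X K M e e1 e2 u w h c a : graph e -> graph e2 -> dg e2 =1 dg e1 ->
    (forall x, x \in X -> dg e1 x = 0) -> lifts X K M e e2 -> u \in X -> w \in X -> e u w ->
    0 < #|K :&: nb e u| -> e u h -> e w h -> h \notin K ->
    cycle e2 c -> uniq c -> size c = M -> 2 <= M ->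
    a \in pairs c (h |: K) (h |: K) -> (a == h) || (next c a == h) ->
  potentially M.+2 e.
Proof.
move=> G G2 D2 dX lf uX wX uw /card_gt0P[y /setIP[yK uy]] uh wh hK cy un sz M2.
rewrite in_set => /and3P[ac aK bK] ha; rewrite in_nb in uy.
have ab : next c a != a by rewrite next_neq ?sz.
pose b := if a == h then next c a else a.
have bK' : b \in K.
  move: aK bK; rewrite !in_setU1 /b; have [ah|ah] := eqVneq a h; last by [].
  by rewrite -ah (negbTE ab).
have [|||||s [e3 [G3 D3 [s3 x3 [sy]] H3 sX]]] := lf [:: y] [:: b]; rewrite //.
- by move=> z; rewrite inE => /eqP->.
- by move=> z; rewrite inE => /eqP->.
have sh : s h = h by rewrite sX // hK orbT.
have sm m : {subset m <= X} -> {in m, forall z, s z \notin c}.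
  move=> mX z /mX zX; rewrite sX ?zX //; apply: cycle_dg0 cy.
  by rewrite D2 dX.
have um : u != w by apply: graph_neq uw.
have e3u z : e u z -> e3 u z by move=> uz; apply: x3.
have e3w z : e w z -> e3 w z by move=> uz; apply: x3.
have [x [x' [sx sx' ends]]] : exists x x', [/\ s x = a, s x' = next c a &
   (x = h /\ x' = y) \/ (x = y /\ x' = h)].
  move: sy ha; rewrite /b; have [ah|ah] := eqVneq a h => sy /=.
    by move=> _; exists h, y; split; [rewrite sh ah | exact: sy | left].
  by move/eqP=> nh; exists y, h; split; [exact: sy | rewrite sh nh | right].
have S1 : {subset [:: u] <= X} by move=> z; rewrite inE => /eqP->.
have S2 : {subset [:: u; w] <= X} by move=> z; rewrite !inE => /orP[]/eqP->.
have S3 : {subset [:: w; u] <= X} by move=> z; rewrite !inE => /orP[]/eqP->.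
apply: (potentially_add2 G3 D3 H3).
  rewrite -sz -addn1; apply: (@insert_relabel V e2 s e3 c x x' [:: u]) => //; rewrite ?sz ?sx ?sx' //.
  - exact: sm.
  by rewrite /= andbT (graph_sym x) //; case: ends => -[-> ->]; rewrite !e3u.
rewrite -sz -addn2; case: ends => -[Ex Ex'].
  apply: (@insert_relabel V e2 s e3 c x x' [:: w; u]) => //; rewrite ?sz ?sx ?sx' //.
  - by rewrite /= inE eq_sym um.
  - exact: sm.
  by rewrite Ex Ex' /= andbT (graph_sym h) // e3w // (graph_sym w) // !e3u.
apply: (@insert_relabel V e2 s e3 c x x' [:: u; w]) => //; rewrite ?sz ?sx ?sx' //.
- by rewrite /= inE um.
- exact: sm.
by rewrite Ex Ex' /= andbT (graph_sym y) // e3w // !e3u.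
Qed.

(** Both lengths must occur in one graph, so one relabelling serves two pairs: [u] goes between the
    second pair, and [w], [u] between the first, which starts at the place of [z0]. *)
Lemma insert_pair X K M e e1 e2 u w z0 c : graph e -> graph e2 -> dg e2 =1 dg e1 ->
    (forall x, x \in X -> dg e1 x = 0) -> lifts X K M e e2 -> u \in X -> w \in X -> e u w ->
    3 <= #|K :&: nb e u| -> z0 \in K -> e w z0 -> ~~ e u z0 ->
    cycle e2 c -> uniq c -> size c = M -> 3 <= M -> 2 <= #|pairs c K K| ->
  potentially M.+2 e.
Proof.
move=> G G2 D2 dX lf uX wX uw cu z0K wz uz cy un sz M3 /card_gt1P[a [a' [aP aP' aa']]].
(* The place [a1] of [z0] must differ from the places [b1], [a2], [b2] of neighbours of [u]; the
   case [b1 = a2] remains possible, hence the [undup]. *)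
have {a a' aP aP' aa'} [a1 [a2 [P1 P2 a12 a1n]]] : exists a1 a2,
    [/\ a1 \in pairs c K K, a2 \in pairs c K K, a1 != a2 & a1 != next c a2].
  have [E|ne] := eqVneq a (next c a'); last by exists a, a'.
  exists a', a; split=> //; first by rewrite eq_sym.
  by rewrite E eq_sym next_next ?sz //; move: aP'; rewrite inE => /and3P[].
move: P1 P2; rewrite !in_set => /and3P[a1c a1K b1K] /and3P[a2c a2K b2K].
set b1 := next c a1 in b1K; set b2 := next c a2 in b2K a1n.
have ab1 : a1 != b1 by rewrite eq_sym next_neq // sz ltnW.
pose rs' := undup [:: b1; a2; b2].
have rsm z : (z \in rs') = [|| z == b1, z == a2 | z == b2] by rewrite mem_undup !inE.
have szr : size rs' <= 3 := size_undup [:: b1; a2; b2].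
pose xs' := take (size rs') (enum (K :&: nb e u)).
have xsE x : x \in xs' -> x \in K /\ e u x.
  by move/mem_take; rewrite mem_enum in_setI in_nb => /andP[].
have szx : size xs' = size rs'.
  by rewrite size_takel // -cardE; apply: leq_trans szr cu.
have [|||||s [e3 [G3 D3 [s3 x3 [sz0 sxs]] H3 sX]]] := lf (z0 :: xs') (a1 :: rs').
- rewrite /= take_uniq ?enum_uniq // andbT; apply/negP => /xsE[_].
  by rewrite (negbTE uz).
- by rewrite /= undup_uniq andbT rsm !negb_or ab1 a12 a1n.
- by rewrite /= szx.
- by move=> z; rewrite inE => /orP[/eqP->|/xsE[]].
- by move=> z; rewrite inE rsm => /or4P[]/eqP->.
have pre r : r \in rs' -> exists2 x, s x = r & e u x.
  by rewrite -sxs => /mapP[x /xsE[_ ux] ->]; exists x.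
have [|y1 sy1 uy1] := pre b1; first by rewrite rsm eqxx.
have [|x2 sx2 ux2] := pre a2; first by rewrite rsm eqxx orbT.
have [|y2 sy2 uy2] := pre b2; first by rewrite rsm eqxx !orbT.
have sm m : {subset m <= X} -> {in m, forall z, s z \notin c}.
  move=> mX z /mX zX; rewrite sX ?zX //; apply: cycle_dg0 cy.
  by rewrite D2 dX.
have um : u != w by apply: graph_neq uw.
have e3u z : e u z -> e3 u z by move=> h; apply: x3.
have e3w z : e w z -> e3 w z by move=> h; apply: x3.
apply: (potentially_add2 G3 D3 H3).
  rewrite -sz -addn1; apply: (@insert_relabel V e2 s e3 c x2 y2 [:: u]) => //; rewrite ?sz ?sx2 ?sy2 // ?(ltnW M3) //.
  - by apply: sm => z; rewrite inE => /eqP->.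
  by rewrite /= andbT (graph_sym x2) // !e3u.
rewrite -sz -addn2; apply: (@insert_relabel V e2 s e3 c z0 y1 [:: w; u]) => //; rewrite ?sz ?sz0 ?sy1 // ?(ltnW M3) //.
- by rewrite /= inE eq_sym um.
- by apply: sm => z; rewrite !inE => /orP[]/eqP->.
by rewrite /= andbT (graph_sym z0) // e3w // (graph_sym w) // !e3u.
Qed.

End EvenInsertion.

(** * Even length: deletion of two adjacent vertices *)

Section EvenStep.
Variable V : finType.
Implicit Types (e : rel V) (x y z u v w t a b h : V) (A E L Q K R S X Z : {set V}) (c s : seq V).

(** The cycle length is [M.+2]; [l] counts low neighbours of [w]. Both [u] and [w] are joined to
    [A]; [u] takes a set [X] of vertices of degree [k], and [w] a disjoint such set [Z] of size [b]
    and the lowest vertices [L], sparing [R]. All of [X], [Z], [R] end at degree [k - 1]. *)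
Lemma even_step k M e p w R (b l : nat) : 5 <= k -> M.+2 = k.*2 -> graph e -> degcond M.+2 e ->
    #|deggt e k| = p -> p <= 1 -> 3 + p <= dg e w <= k ->
    (forall x, 3 + p <= dg e x -> dg e w <= dg e x) ->
    R \subset degeq e k.-1 -> w \notin R ->
    l <= #|(degge e (3 + p) :\: degge e k) :\: (w |: R)| ->
    2 <= b -> 1 + p + b + l = dg e w -> k + b + (k <= dg e w) <= ndeg e k ->
    (if p == 0 then ndeg e 1 < k.*2 + b + #|R| else ndeg e 1 <= k.*2.+1) ->
    (forall e', graph e' -> degcond M e' -> potentially M e') ->
  potentially M.+2 e.
Proof.
move=> k5 Mk G C cA p1 /andP[w3 wk] wmin RD wR lS b2 sumw q nn IH.
set A := deggt e k in cA.
pose B := degeq e k :\ w.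
have cB : k + b <= #|B| + p.
  have := ndeg_split e k; rewrite -deggt_ndeg -/A cA.
  have := cardsD1 w (degeq e k); rewrite inE -/B; move: q wk; clear; lia.
have BE x : x \in B -> dg e x = k /\ x != w by rewrite in_setD1 inE => /andP[-> /eqP].
have : 0 < #|B| by move: cB b2 k5 p1; clear; lia.
case/card_gt0P=> u uB; have [uk uw] := BE u uB.
have cBu : #|B :\ u| + 1 = #|B| by rewrite (cardsD1 u B) uB addnC.
have [|Z [ZB cZ]] := @subset_card V (B :\ u) b; first by move: cBu cB k5 p1; clear; lia.
have [|X [XB cX]] := @subset_card V ((B :\ u) :\: Z) (k - 1 - p).
  by have := cardsID Z (B :\ u); rewrite (setIidPr ZB) cZ; move: cBu cB k5 p1; clear; lia.
have ZE x : x \in Z -> [/\ dg e x = k, x != w & x != u].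
  by move/(subsetP ZB); rewrite in_setD1 => /andP[xu /BE[]].
have XE x : x \in X -> [/\ dg e x = k, x != w, x != u & x \notin Z].
  by move/(subsetP XB); rewrite in_setD in_setD1 => /and3P[xZ xu /BE[]].
have [L [LS cL lo]] := lowest_subset (dg e) lS.
have LE x : x \in L -> [/\ 3 + p <= dg e x, dg e x < k, x != w & x \notin R].
  move/(subsetP LS); rewrite in_setD in_setU1 negb_or in_setD !in_degge -ltnNge.
  by move=> /andP[/andP[-> ->] /andP[-> ->]].
have AE x : x \in A -> k < dg e x by rewrite inE.
have RE x : x \in R -> dg e x = k.-1 by move/(subsetP RD); rewrite inE => /eqP.
have AZ x : x \in A -> x \notin Z by move/AE => h; apply/negP => /ZE[h']; move: h; rewrite h' ltnn.
have AX x : x \in A -> x \notin X by move/AE => h; apply/negP => /XE[h']; move: h; rewrite h' ltnn.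
have AL x : x \in A -> x \notin L by move/AE => h; apply/negP => /LE[_ h']; move: h h'; clear; lia.
have ZL x : x \in Z -> x \notin L by move/ZE => [h _ _]; apply/negP => /LE[_ h']; move: h h'; clear; lia.
have XL x : x \in X -> x \notin L by move/XE => [h _ _ _]; apply/negP => /LE[_ h']; move: h h'; clear; lia.
have uA : u \notin A by rewrite inE uk ltnn.
have uZ : u \notin Z by apply/negP => /ZE[_ _]; rewrite eqxx.
have uX : u \notin X by apply/negP => /XE[_ _]; rewrite eqxx.
have uL : u \notin L by apply/negP => /LE[_]; rewrite uk ltnn.
have wA : w \notin A by rewrite inE -leqNgt.
pose Qw := u |: (A :|: Z :|: L); pose Qu := A :|: X.
have cQu : #|Qu| = k - 1.
  rewrite cardsU cA cX (_ : A :&: X = set0) ?cards0; first by move: k5 p1; clear; lia.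
  by apply/setP => x; rewrite in_setI in_set0; apply/negP => /andP[/AX/negbTE->].
have QwE x : x != u -> (x \in Qw) = [|| x \in A, x \in Z | x \in L].
  by move=> xu; rewrite in_setU1 (negbTE xu) !in_setU /= orbA.
have QuE x : (x \in Qu) = (x \in A) || (x \in X) by rewrite in_setU.
have [||||||e' [G' D' Nw Nu DR]] := @two_removed V e u w Qw Qu G uw.
- by rewrite in_setU1 eqxx.
- by rewrite QuE (negbTE wA); apply/negP => /XE[_]; rewrite eqxx.
- by rewrite QuE (negbTE uA) (negbTE uX).
- apply: (@any_nb V k) => //; rewrite -?/(deggt e k) -/A.
  + rewrite cardsU1 !in_setU (negbTE uA) (negbTE uZ) (negbTE uL) /=.
    rewrite cardsU cardsU cA cZ cL (_ : A :&: Z = set0) ?cards0.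
      rewrite (_ : (A :|: Z) :&: L = set0) ?cards0; first by move: sumw; clear; lia.
      by apply/setP => x; rewrite in_setI in_setU in_set0; apply/negP => /andP[/orP[/AL|/ZL]/negbTE->].
    by apply/setP => x; rewrite in_setI in_set0; apply/negP => /andP[/AZ/negbTE->].
  + rewrite QwE 1?eq_sym // (negbTE wA) /=; apply/negP => /orP[/ZE[_]|/LE[_ _]]; by rewrite eqxx.
  + by apply/subsetP => x xA; rewrite in_setU1 !in_setU xA orbT.
  + move=> y; rewrite cA in_setU1 !in_setU -orbA => /or4P[/eqP->|/AE h|/ZE[-> _ _]|/LE[h _ _ _]].
    * by rewrite uk; move: p1 k5; clear; lia.
    * by move: h p1 k5; clear; lia.
    * by move: p1 k5; clear; lia.
    * by move: h; clear; lia.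
  + by move: q b2; clear; lia.
- by rewrite cQu uk; move: k5; clear; lia.
- move=> x y yQ xQ xu xw; have yk : k <= dg e y - (y \in Qw).
    move: yQ; rewrite QuE => /orP[yA|yX].
      by move/AE: yA; case: (_ \in _); clear; lia.
    have [yk yw yu yZ] := XE y yX; rewrite QwE // (negbTE yZ) (negbTE (XL _ yX)) orbF yk.
    by have -> : (y \in A) = false; [apply/negP => /AX; rewrite yX | rewrite subn0].
  apply: leq_trans yk; apply: leq_trans (leq_subr _ _) _.
  by move: xQ; rewrite QuE negb_or inE -leqNgt => /andP[].
set e1 := isolate (isolate e' u) w in DR.
have G1 : graph e1 by do 2 apply: isolate_graph.
have DR' x : x != u -> x != w -> dg e1 x =
    dg e x - [|| x \in A, x \in Z | x \in L] - ((x \in A) || (x \in X)).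
  by move=> xu xt; rewrite DR /residual_dg (negbTE xu) (negbTE xt) /= QwE // QuE.
have DA x : x \in A -> dg e1 x = dg e x - 2.
  move=> xA; rewrite DR' ?xA /= -?subnDA //; last by apply: contraTneq xA => ->.
  by apply: contraTneq xA => ->.
have DZ x : x \in Z -> dg e1 x = k.-1.
  move=> xZ; have [xk xw xu] := ZE x xZ.
  have xX : x \in X = false by apply/negP => /XE[_ _ _]; rewrite xZ.
  have xA : x \in A = false by apply/negP => /AZ; rewrite xZ.
  by rewrite DR' // xZ xX xA xk /= subn0 subn1.
have DX x : x \in X -> dg e1 x = k.-1.
  move=> xX; have [xk xw xu xZ] := XE x xX.
  have xA : x \in A = false by apply/negP => /AX; rewrite xX.
  by rewrite DR' // (negbTE xZ) xX xA (negbTE (XL _ xX)) xk /= subn0 subn1.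
have DL x : x \in L -> dg e1 x = (dg e x).-1.
  move=> xL; have [_ xk xw _] := LE x xL; have xu : x != u by apply: contraNneq uL => <-.
  have xA : x \in A = false by apply/negP => /AL; rewrite xL.
  have xX : x \in X = false by apply/negP => /XL; rewrite xL.
  by rewrite DR' // xL xX xA /= orbT subn0 subn1.
have DO x : x != u -> x != w -> x \notin A -> x \notin Z -> x \notin X -> x \notin L ->
    dg e1 x = dg e x.
  by move=> xu xw /negbTE xA /negbTE xZ /negbTE xX /negbTE xL; rewrite DR' // xA xZ xX xL !subn0.
have keep m x : m < k -> m <= dg e x -> x != u -> x != w -> x \notin L -> m <= dg e1 x.
  move=> mk mx xu xw xL.
  have [xA|xA] := boolP (x \in A); first by rewrite DA //; move/AE: xA; move: mk; clear; lia.
  have [xZ|xZ] := boolP (x \in Z); first by rewrite DZ //; move: mk; clear; lia.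
  have [xX|xX] := boolP (x \in X); first by rewrite DX //; move: mk; clear; lia.
  by rewrite DO.
have cuw m : #|degge e m :\: [set u; w]| + 2 >= ndeg e m.
  have := cardsID [set u; w] (degge e m).
  have := subset_leq_card (subsetIr (degge e m) [set u; w]); rewrite cards2 uw /ndeg; clear; lia.
have c11 : ndeg e1 1 + 2 <= ndeg e 1.
  have cuw1 : #|degge e 1 :\: [set u; w]| + 2 = ndeg e 1.
    have := cardsID [set u; w] (degge e 1); rewrite (setIidPr _) ?cards2 ?uw; first by rewrite /ndeg; clear; lia.
    apply/subsetP => x; rewrite in_set2 in_degge => /orP[]/eqP->; first by rewrite uk; apply: leq_trans k5.
    by apply: leq_trans w3.
  rewrite -cuw1 leq_add2r; apply: subset_leq_card; apply/subsetP => x.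
  rewrite in_degge DR /residual_dg in_setD in_set2 in_degge.
  by case: ((x == u) || (x == w)) => //=; clear; lia.
have g1 : potentially M e1.
  apply: IH => // m m2 ml; have mk : m < k by move: m2 ml Mk; clear; lia.
  have Cm := C m m2 (leqW (leqW ml)).
  (* Below [3 + p] only [u] and [w] are lost, since vertices of [L] have degree at least [3 + p]. *)
  have [m3|m3] := ltnP m (3 + p).
    have sub : degge e m :\: [set u; w] \subset degge e1 m.
      apply/subsetP => x; rewrite in_setD in_set2 negb_or !in_degge => /andP[/andP[xu xw] xm].
      have [xL|xL] := boolP (x \in L); last exact: keep.
      by rewrite DL //; have [h _ _ _] := LE x xL; move: h m3; clear; lia.
    by have := subset_leq_card sub; have := cuw m; rewrite -/(ndeg e1 m); move: Cm; clear; lia.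
  have C3 : M.+4 <= ndeg e (3 + p) + (3 + p).
    by apply: C => //; move: p1 k5 Mk; clear; lia.
  have [Lm|/set0Pn[x0 /setIP[x0L]]] := eqVneq (L :&: degeq e m) set0.
    have noL x : x \in L -> m <= dg e x -> m <= dg e1 x.
      move=> xL xm; have xm' : dg e x != m.
        by apply/eqP => E; have : x \in L :&: degeq e m; [rewrite in_setI xL inE E eqxx | rewrite Lm in_set0].
      by rewrite DL //; move: xm xm'; clear; lia.
    have [mw|mw] := ltnP (dg e w) m.
      have sub : degge e m :\ u \subset degge e1 m.
        apply/subsetP => x; rewrite in_setD1 !in_degge => /andP[xu xm].
        have xw : x != w by apply: contraTneq xm => ->; rewrite -ltnNge.
        have [xL|xL] := boolP (x \in L); [exact: noL | exact: keep].
      have := subset_leq_card sub; have := cardsD1 u (degge e m); rewrite in_degge uk (ltnW mk) -/(ndeg e m) -/(ndeg e1 m).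
      by move: Cm; clear; lia.
    have sub : degge e (3 + p) :\: [set u; w] \subset degge e1 m.
      apply/subsetP => x; rewrite in_setD in_set2 negb_or !in_degge => /andP[/andP[xu xw] /wmin xm].
      have [xL|xL] := boolP (x \in L); [apply: noL => // | apply: keep => //]; exact: leq_trans mw xm.
    by have := subset_leq_card sub; have := cuw (3 + p); rewrite -/(ndeg e1 m); move: C3 m3; clear; lia.
  (* With a vertex of [L] at level [m], only [u], [w] and [L] are lost from [degge e (3 + p)];
     [m >= dg e w], [sumw] and [2 <= b] make up for it. *)
  rewrite inE => /eqP x0m.
  have wm : dg e w <= m by rewrite -x0m; apply: wmin; have [] := LE x0 x0L.
  have sub : (degge e (3 + p) :\: [set u; w]) :\: L \subset degge e1 m.
    apply/subsetP => x; rewrite !in_setD in_set2 negb_or => /and3P[xL /andP[xu xw] x3].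
    rewrite in_degge; apply: keep => //.
    have [xk|xk] := boolP (x \in degge e k); first by apply: leq_trans (ltnW mk) _; rewrite -in_degge.
    have [xR|xR] := boolP (x \in R); first by rewrite (RE _ xR); move: mk; clear; lia.
    by rewrite -x0m; apply: lo => //; rewrite !in_setD in_setU1 negb_or xw xR xk x3.
  have := subset_leq_card sub; have := cardsID L (degge e (3 + p) :\: [set u; w]); rewrite -/(ndeg e1 m).
  have := subset_leq_card (subsetIr (degge e (3 + p) :\: [set u; w]) L); rewrite cL.
  by have := cuw (3 + p); move: C3 wm sumw b2; clear; lia.
(* A vertex of degree [k + 1] in [A] also drops to [k - 1], but as a common neighbour of [u] and [w]
   it must not be moved. *)
pose K := degeq e1 k.-1 :\: A.
have inK x : (x \in K) = (x \notin A) && (dg e1 x == k.-1) by rewrite in_setD [x \in degeq _ _]inE.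
have XK : X \subset K.
  by apply/subsetP => x xX; rewrite inK DX // eqxx andbT; apply: contraL xX => /AX.
have ZK : Z \subset K.
  by apply/subsetP => x xZ; rewrite inK DZ // eqxx andbT; apply: contraL xZ => /AZ.
have k10 : 0 < k.-1 by move: k5; clear; lia.
have Rk x : x \in R -> dg e x <> k by move/RE => -> ; move: k5; clear; lia.
have RK : R \subset K.
  apply/subsetP => x xR; have xk := RE x xR; have xk' := Rk x xR.
  have xA : x \notin A by rewrite inE xk; move: k5; clear; lia.
  rewrite inK xA DO ?xk ?eqxx //.
  - by apply/eqP => E; apply: xk'; rewrite E.
  - by apply: contraNneq wR => <-.
  - by apply/negP => /ZE[].
  - by apply/negP => /XE[].
  - by apply/negP => /LE[_ _ _]; rewrite xR.
have cK : k - 1 - p + b + #|R| <= #|K|.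
  apply: leq_trans (subset_leq_card (_ : X :|: Z :|: R \subset K)); last by rewrite !subUset XK ZK.
  rewrite cardsU cardsU cX cZ (_ : X :&: Z = set0) ?cards0.
    rewrite (_ : (X :|: Z) :&: R = set0) ?cards0 ?subn0 //.
    apply/setP => x; rewrite in_setI in_setU in_set0; apply/negP => /andP[+ /Rk xR].
    by case/orP => [/XE[]|/ZE[]].
  by apply/setP => x; rewrite in_setI in_set0; apply/negP => /andP[/XE[_ _ _ /negbTE->]].
have dK x : x \in K -> dg e1 x = k.-1 by rewrite inK => /andP[_ /eqP].
have dX x : x \in [set u; w] -> dg e1 x = 0 by rewrite in_set2 DR /residual_dg => ->.
have [e2 [G2 D2 H2 lf]] := lift_step (extends2 (u := u) (w := w) G') g1 dX dK k10.
have M3 : 3 <= M by move: k5 Mk; clear; lia.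
have [|c [cy un sz]] := H2 M; first by rewrite M3 leqnn.
have cS1 : cset c \subset degge e1 1.
  by apply: subset_trans (cset_degge cy) _; apply/subsetP => x; rewrite !inE D2.
have KS : K \subset degge e1 1 by apply/subsetP => x /dK h; rewrite in_degge h.
apply: (eq_potentially D').
have uXX : u \in [set u; w] by rewrite in_set2 eqxx.
have wXX : w \in [set u; w] by rewrite in_set2 eqxx orbT.
have cKu : 3 <= #|K :&: nb e' u|.
  rewrite Nu; apply: leq_trans (subset_leq_card (_ : X \subset _)).
    by rewrite cX; move: k5 p1; clear; lia.
  by rewrite subsetI XK; apply/subsetP => x xX; rewrite in_setU1 QuE xX !orbT.
have euw : e' u w by rewrite -in_nb Nu in_setU1 eqxx.
have : 0 < #|Z| by rewrite cZ; apply: leq_trans b2.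
case/card_gt0P=> z0 z0Z; have z0K := subsetP ZK z0 z0Z.
have wz0 : e' w z0 by rewrite -in_nb Nw in_setU1 !in_setU z0Z !orbT.
have uz0 : ~~ e' u z0.
  have [_ z0w _] := ZE z0 z0Z.
  rewrite -in_nb Nu in_setU1 QuE (negbTE z0w) /=; apply/negP => /orP[/AZ|/XE[_ _ _]]; by rewrite z0Z.
have two : 2 <= #|pairs c K K| -> potentially M.+2 e'.
  by apply: (@insert_pair V [set u; w] K M e' e1 e2 u w z0 c).
move: nn; have [p0|pn] := eqVneq p 0 => nn.
  apply: two; have := card_pairs K K un; have := on_cycle un cS1 KS.
  by rewrite sz -/(ndeg e1 1); move: cK c11 nn Mk k5; rewrite p0; clear; lia.
have p1' : p = 1 by move: p1 pn; clear; lia.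
have /cards1P[h Ah] : #|A| == 1 by rewrite cA p1'.
have hA : h \in A by rewrite Ah set11.
have hK : h \notin K by rewrite inK hA.
have KS' : h |: K \subset degge e1 1.
  by rewrite subUset KS andbT sub1set in_degge DA //; move/AE: hA; move: k5; clear; lia.
have pr : 2 <= #|pairs c (h |: K) (h |: K)|.
  have := card_pairs (h |: K) (h |: K) un; have := on_cycle un cS1 KS'.
  by rewrite sz cardsU1 hK -/(ndeg e1 1); move: cK c11 nn Mk k5 b2; rewrite p1'; clear; lia.
have [a /andP[aP ah]|noh] := pickP (fun a => (a \in pairs c (h |: K) (h |: K)) && ((a == h) || (next c a == h))).
  apply: (@insert_hub V [set u; w] K M e' e1 e2 u w h c a) => //.
  - exact: leq_trans cKu.
  - by rewrite -in_nb Nu in_setU1 QuE hA orbT.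
  - by rewrite -in_nb Nw in_setU1 !in_setU hA orbT.
  - exact: ltnW.
apply: two; apply: leq_trans pr _; apply: subset_leq_card; apply/subsetP => a aP.
have := noh a; rewrite aP /= => /negbT; rewrite negb_or => /andP[ah nh].
by move: aP; rewrite !in_set !in_set1 (negbTE ah) (negbTE nh).
Qed.

End EvenStep.

(** * Even length: the case analysis *)

Section EvenMain.
Variable V : finType.
Implicit Types (e : rel V) (x y z u v w t a b h : V) (A E L Q K R S X Z : {set V}) (c s : seq V).

(** Level [k] may be tight, so [t] is joined to a vertex of degree [k - 1] and a lowest one; two
    vertices of degree [k - 1] give level [k - 1] one to spare. *)
Lemma reduce_degree_two k e t : 5 <= k -> graph e -> degcond k.*2 e -> ndeg e 1 = k.*2.+2 ->
    dg e t = 2 -> (forall x, 0 < dg e x -> dg e t <= dg e x) ->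
    #|deggt e k| = 0 -> 2 <= #|degeq e k.-1| ->
  reducible k.*2 e.
Proof.
move=> k5 G C n1 t2 tmin p0 D2.
have t0 : 0 < dg e t by rewrite t2.
have ck : k.+2 <= ndeg e k by have := C k; move: k5; clear; lia.
have : 0 < #|degeq e k.-1| by apply: leq_trans D2.
case/card_gt0P=> d; rewrite inE => /eqP dk.
have [|||||||e' [G' D' H]] := @delete_min_counts V k e t [set d] G t0 tmin; rewrite ?p0 ?t2 ?cards1 //.
- by rewrite sub1set in_degge dk; move: k5; clear; lia.
- by rewrite disjoints1 inE dk; move: k5; clear; lia.
- by apply/negP => /set1P E; move: t2; rewrite E dk; move: k5; clear; lia.
- by apply: leq_trans k5.
- by move: ck k5; clear; lia.
exists e', t; split=> // m m2 ml.
have mk : 0 < m <= k by move: m2 ml; clear; lia.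
have Cm := C m m2 ml.
have e1 : #|[set d] :&: degeq e m| = (m == k.-1).
  have [mE|mE] := eqVneq m k.-1.
    by rewrite (setIidPl _) ?cards1 // sub1set inE dk mE.
  by apply/eqP; rewrite cards_eq0 setI_eq0 disjoints1 inE dk eq_sym.
have e2 : #|[set x in [set d] | dg e x <= m]| = (k.-1 <= m).
  have [mE|mE] := leqP k.-1 m.
    have -> : [set x in [set d] | dg e x <= m] = [set d]; last by rewrite cards1.
    by apply/setP => x; rewrite !inE; case: eqP => // ->; rewrite dk.
  by apply: eq_card0 => x; rewrite !inE; apply/negP => /andP[/eqP->]; rewrite dk leqNgt mE.
have c2 : m = 2 -> ndeg e m = k.*2.+2 by move=> ->; rewrite (ndeg_min tmin) ?t2.
have ck1 : m = k.-1 -> k.+4 <= ndeg e m.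
  by move=> ->; have := ndeg_split e k.-1; rewrite prednK; [move: ck D2; clear; lia | exact: leq_trans k5].
have := H m mk; rewrite e1 e2 t2 p0 cards1 n1.
case=> [|[_]]; last by move: m2 k5; clear; lia.
by move: Cm m2 k5 c2 ck1; clear; lia.
Qed.

Lemma even_spanning l e : 6 <= l -> ~~ odd l -> graph e -> degcond l e -> ndeg e 1 = l ->
  potentially l.-1 e -> potentially l e.
Proof.
move=> l6 ol G C n1 [e' [G' D' H]]; exists e'; split=> // r /andP[r3].
rewrite leq_eqVlt => /orP[/eqP->|rl]; last by apply: H; rewrite r3; move: rl; clear; lia.
apply: posa_hamiltonian => //; rewrite ?(eq_ndeg D') //; first exact: leq_trans l6.
have up : (uphalf l).*2 = l by have := odd_double_half l; rewrite uphalf_half (negbTE ol).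
split=> [m m2 ml|]; rewrite (eq_ndeg D'); first by rewrite addn2; apply: C => //; apply: leqW.
by have := C (uphalf l); move: up l6; clear; lia.
Qed.

Lemma even_case l e : 10 <= l -> ~~ odd l -> graph e -> degcond l e ->
    (forall e', graph e' -> degcond l.-1 e' -> potentially l.-1 e') ->
    (forall e', graph e' -> degcond l.-2 e' -> potentially l.-2 e') ->
    (forall e', graph e' -> degcond l e' -> ndeg e' 1 < ndeg e 1 -> potentially l e') ->
  potentially l e.
Proof.
move=> l10 ol G C IHl1 IHl2 IHn.
have l5 : 5 <= l by apply: leq_trans l10.
have nl : l <= ndeg e 1.
  apply: leq_trans (ndeg_mono e (_ : 1 <= 2)) => //.
  by have := C 2; move: l10; clear; lia.
set k := uphalf l; have kl : l = k.*2.
  by have := odd_double_half l; rewrite /k uphalf_half (negbTE ol); clear; lia.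
have k5 : 5 <= k by move: l10 kl; clear; lia.
have ck : k.+2 <= ndeg e k by have := C k; move: kl k5; clear; lia.
move: nl; rewrite leq_eqVlt => /orP[/eqP nl|nl].
  apply: even_spanning => //; first exact: leq_trans l10.
  apply: IHl1 => //; apply: degcond_pred; rewrite prednK //; exact: leq_trans l10.
have [|t [t0 tmin]] := @min_vertex V e; first exact: leq_trans nl.
have [red|] := boolP [|| dg e t <= #|deggt e k|, l + 3 <= ndeg e 1 + #|deggt e k|
      | (dg e t == 1) && (l + 2 <= ndeg e 1)].
  by apply: reducible_potentially IHn; apply: (reduce_plain l5 G C nl t0 tmin).
rewrite !negb_or negb_and -!ltnNge => /and3P[pj np j1].
have jk : dg e t <= k.
  rewrite leqNgt; apply/negP => kt; have := dg_lt_ndeg G t0.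
  have : degge e 1 \subset deggt e k by apply/subsetP => x; rewrite !inE => /tmin; apply: leq_trans.
  by move/subset_leq_card; rewrite -/(ndeg e 1); move: pj; clear; lia.
have [M lM] : exists M, l = M.+2 by exists l.-2; move: l10; clear; lia.
have Mk : M.+2 = k.*2 by rewrite -lM kl.
have IHM e' : graph e' -> degcond M e' -> potentially M e' by have := IHl2 e'; rewrite lM.
have kl2 : l <= k.*2 <= l.+1 by rewrite -kl leqnn leqnSn.
have C' : degcond M.+2 e by rewrite -lM.
set p := #|deggt e k| in pj np.
have B1 : ndeg e k = #|degeq e k| + p by rewrite ndeg_split.
have p1 : p <= 1 by move: np nl; clear; lia.
move: jk; rewrite leq_eqVlt => /orP[/eqP jk|jk].
  have ccE : ndeg e k = ndeg e 1 by rewrite (ndeg_min tmin) ?jk //; apply: leq_trans k5.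
  rewrite lM; apply: (@even_step V k M e p t set0 (k - 1 - p) 0) => //.
  - by rewrite jk leqnn andbT; move: k5 p1; clear; lia.
  - by move=> x h; apply: tmin; apply: leq_trans h.
  - exact: sub0set.
  - by rewrite in_set0.
  - by move: k5 p1; clear; lia.
  - by rewrite jk; move: k5 p1; clear; lia.
  - by rewrite jk leqnn ccE; move: k5 p1 nl kl; clear; lia.
  by rewrite cards0; case: eqP => p0; move: np nl kl k5 p1 p0; clear; lia.
set W := degge e (3 + p) :\: degge e k.
have cW : #|W| + ndeg e k = ndeg e (3 + p).
  have := cardsID (degge e k) (degge e (3 + p)); rewrite (setIidPr _) -/W; first by rewrite /ndeg; clear; lia.
  by apply/subsetP => x; rewrite !in_degge; apply: leq_trans; move: k5 p1; clear; lia.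
have c3 : l.+2 <= ndeg e (3 + p) + (3 + p).
  by apply: C => //; move: k5 kl p1; clear; lia.
have inW x : (x \in W) = (3 + p <= dg e x < k) by rewrite in_setD !in_degge -ltnNge andbC.
have [W0|/card_gt0P[w0 w0W]] := posnP #|W|.
  have jp : dg e t <= 2 + p.
    have : t \notin W by move/eqP: W0; rewrite cards_eq0 => /eqP->; rewrite in_set0.
    by rewrite inW; move: jk; clear; lia.
  (* This number is [2 - p] if [dg e t >= 2]; if [dg e t = 1], when [p = 0], it is 1. Level [k] can
     afford it because [W] is empty. *)
  apply: reducible_potentially IHn; apply: (@reduce_max_degree V l k e t (2 - p - (2 - dg e t))) => //; rewrite -/p;
    move: np nl j1 kl k5 p1 pj jk cW c3 W0 B1 t0 jp; clear; lia.
case: (@arg_minnP _ w0 (fun x => x \in W) (dg e) w0W) => w wW wmin'.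
have wmin x : 3 + p <= dg e x -> dg e w <= dg e x.
  move=> x3; have [xk|xk] := leqP k (dg e x); last by apply: wmin'; rewrite inW x3.
  by move: wW; rewrite inW => /andP[_ /ltnW wk]; apply: leq_trans wk xk.
have /andP[w3 wk] : 3 + p <= dg e w < k by rewrite -inW.
have wkn : (k <= dg e w) = false by rewrite leqNgt wk.
have [nE|nE] := eqVneq (ndeg e 1) l.+1.
  have cW1 : #|W :\: (w |: set0)| + 1 = #|W|.
    by rewrite setU0 (cardsD1 w W) wW addnC.
  (* As many low neighbours as [W] and [2 <= b] allow, so that few vertices of degree [k] are
     used. *)
  pose z := minn (dg e w - (3 + p)) (#|W| - 1).
  rewrite lM; apply: (@even_step V k M e p w set0 (dg e w - 1 - p - z) z) => //.
  - by rewrite w3 (ltnW wk).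
  - exact: sub0set.
  - by rewrite in_set0.
  - by rewrite -/W /z; move: cW1; clear; lia.
  - by rewrite /z; move: w3; clear; lia.
  - by rewrite /z; move: w3; clear; lia.
  - by rewrite wkn /z; move: w3 wk cW c3 kl k5 ck p1; clear; lia.
  by rewrite cards0 nE kl /z; case: eqP => p0; move: w3 p0; clear; lia.
have nE2 : ndeg e 1 = l.+2 by move: np nl nE; clear; lia.
have p0 : p = 0 by move: np nE2; clear; lia.
have j2 : 2 <= dg e t.
  by move: j1; rewrite nE2 addn2 ltnn orbF; move: t0; clear; lia.
have [q|q] := ltnP k.+2 (ndeg e k).
  apply: reducible_potentially IHn; apply: (@reduce_max_degree V l k e t 1) => //; rewrite -/p;
    move: nE2 p0 jk kl q B1 pj; clear; lia.
have qE : ndeg e k = k.+2 by apply/eqP; rewrite eqn_leq q.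
have [/andP[/eqP jE D2]|nj] := boolP ((dg e t == 2) && (2 <= #|degeq e k.-1|)).
  by apply: reducible_potentially IHn; rewrite kl; apply: (@reduce_degree_two k e t) => //; rewrite -?kl // nE2.
have cD := ndeg_split e k.-1; rewrite prednK in cD; last exact: leq_trans k5.
have ck1 : l.+2 <= ndeg e k.-1 + k.-1 by apply: C; move: kl k5; clear; lia.
have W2 : 2 <= #|W| by move: cW c3 qE p0 kl k5; clear; lia.
have WD : dg e w = k.-1 -> #|W| <= #|degeq e k.-1|.
  move=> wE; apply: subset_leq_card; apply/subsetP => x xW; rewrite inE.
  by have := wmin' x xW; move: xW; rewrite inW wE; clear; lia.
(* Sparing one vertex of degree [k - 1] compensates for the extra vertex in [ndeg e 1 = l.+2] when
   [b = 2]. *)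
have : 0 < #|degeq e k.-1 :\ w|.
  have := cardsD1 w (degeq e k.-1); rewrite [w \in _]inE.
  have [wE|wE] := eqVneq (dg e w) k.-1; last by move: cD ck1 qE kl k5; clear; lia.
  by have := WD wE; move: W2; clear; lia.
case/card_gt0P=> d0; rewrite in_setD1 inE => /andP[d0w /eqP d0k].
have d0W : d0 \in W by rewrite inW d0k; move: k5 p0; clear; lia.
have cW2 : #|W :\: (w |: [set d0])| + 2 = #|W|.
  have := cardsID (w |: [set d0]) W; rewrite (setIidPr _).
    by rewrite cards2 eq_sym d0w; clear; lia.
  by rewrite subUset !sub1set wW d0W.
have cc3 : 3 <= dg e t -> ndeg e (3 + p) = l.+2 by move=> t3; rewrite (ndeg_min tmin) // p0 addn0.
have wD : dg e t = 2 -> dg e w < k.-1.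
  move=> tE; have := WD; move: nj; rewrite tE eqxx /=; move: W2 wk; clear; lia.
rewrite lM; apply: (@even_step V k M e p w [set d0] 2 (dg e w - 3)) => //.
- by rewrite w3 (ltnW wk).
- by rewrite sub1set inE d0k.
- by rewrite in_set1 eq_sym.
- rewrite -/W; move: cW2 cW c3 cc3 wD j2 w3 wk qE p0 kl k5; clear; lia.
- by move: w3 p0; clear; lia.
- by rewrite wkn qE; clear; lia.
by rewrite p0 eqxx cards1 nE2 kl; clear; lia.
Qed.

End EvenMain.

(** * Lengths 5, 6 and 8 *)

(* A graph on 0, ..., 9 is coded by the list of the numbers 10 i + j for its edges ij. *)
Definition coded (E : seq nat) : rel nat :=
  fun i j => (10 * i + j \in E) || (10 * j + i \in E).

(* [if] rather than [has] and [&&], which [vm_compute] would evaluate eagerly. *)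
Fixpoint search (T : Type) (p : pred T) (s : seq T) : bool :=
  if s is i :: s' then (if p i then true else search p s') else false.

Fixpoint extend (a : rel nat) n m h (q : seq nat) : bool :=
  if m is m'.+1 then
    search (fun i => if a i h then (if i \in h :: q then false else extend a n m' i (h :: q))
                     else false) (iota 0 n)
  else a (last h q) h.

Definition cyclic a n r := search (fun i => extend a n r.-1 i [::]) (iota 0 n).

(** The test on the digits excludes loops, which [coded] would admit. *)
Definition fits l n (E s : seq nat) :=
  if [seq count (coded E i) (iota 0 n) | i <- iota 0 n] == s then
    all (fun c => c %/ 10 < c %% 10) E && all (cyclic (coded E) n) (iota 3 (l - 2))
  else false.

Fixpoint mono n hi : seq (seq nat) :=
  if n is n'.+1 then flatten [seq [seq h :: s | s <- mono n' h] | h <- iota 1 hi]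
  else [:: [::]].

(** What [reduce_plain] does not settle, thinned out by the parity of the degree sum. *)
Definition remaining l n (s : seq nat) :=
  let k := uphalf l in let p := count (leq k.+1) s in
  [&& ~~ odd (sumn s), all (fun m => l.+2 <= count (leq m) s + m) (iota 2 k.-1),
      p < last 0 s, n + p < l + 3 & ~~ ((last 0 s == 1) && (l + 2 <= n))].

Definition covered l n tab :=
  all (fun s => if remaining l n s then search (fun E => fits l n E s) tab else true)
    (mono n n.-1).

Definition graphs_5_6 : seq (seq nat) := [::
  [:: 1; 2; 3; 4; 5; 12; 13; 24; 35; 45];
  [:: 1; 2; 3; 4; 5; 12; 15; 23; 34];
  [:: 1; 2; 3; 4; 12; 13; 24; 35; 45];
  [:: 1; 2; 3; 13; 14; 24; 25; 35; 45];
  [:: 1; 2; 3; 12; 14; 24; 34; 35];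
  [:: 1; 2; 3; 13; 14; 23; 25; 45]].

Definition graphs_5_7 : seq (seq nat) := [::
  [:: 1; 2; 3; 14; 16; 23; 25; 35; 45; 46];
  [:: 3; 5; 6; 12; 13; 14; 23; 25; 46]].

Definition graphs_6_7 : seq (seq nat) := [::
  [:: 1; 2; 3; 4; 5; 6; 12; 15; 23; 36; 45; 46];
  [:: 1; 2; 3; 4; 5; 6; 13; 16; 23; 24; 45];
  [:: 1; 2; 3; 5; 6; 12; 14; 23; 35; 45; 46];
  [:: 3; 4; 5; 6; 12; 13; 14; 25; 26; 34; 56];
  [:: 1; 2; 3; 4; 12; 13; 26; 34; 45; 56];
  [:: 1; 2; 3; 14; 16; 23; 25; 35; 45; 46];
  [:: 2; 3; 5; 14; 15; 16; 23; 24; 34]].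

Definition graphs_6_8 : seq (seq nat) := [::
  [:: 1; 3; 5; 12; 13; 24; 27; 36; 46; 47; 56; 57];
  [:: 1; 4; 6; 15; 16; 23; 24; 25; 34; 37; 57]].

Definition graphs_8_9 : seq (seq nat) := [::
  [:: 1; 2; 3; 4; 5; 6; 7; 8; 12; 13; 14; 23; 24; 37; 46; 56; 57; 58; 68; 78];
  [:: 1; 2; 3; 4; 5; 6; 7; 8; 13; 16; 18; 23; 24; 25; 36; 45; 47; 57; 67];
  [:: 1; 2; 3; 4; 5; 6; 7; 8; 15; 17; 18; 23; 27; 28; 34; 36; 45; 46; 56];
  [:: 1; 2; 3; 4; 5; 6; 7; 8; 12; 13; 14; 24; 25; 36; 38; 46; 56; 57];
  [:: 1; 2; 3; 4; 5; 6; 7; 8; 14; 16; 17; 23; 24; 25; 35; 38; 45; 67];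
  [:: 1; 2; 3; 4; 5; 6; 7; 13; 14; 16; 23; 24; 27; 34; 56; 57; 58; 68; 78];
  [:: 1; 2; 3; 4; 5; 6; 7; 13; 17; 18; 25; 27; 28; 34; 36; 45; 46; 56];
  [:: 1; 2; 3; 4; 5; 7; 8; 12; 16; 18; 26; 28; 34; 35; 36; 45; 47; 57];
  [:: 1; 2; 3; 4; 5; 6; 8; 14; 16; 17; 23; 24; 25; 35; 38; 45; 67];
  [:: 3; 4; 5; 6; 7; 8; 12; 13; 14; 15; 26; 27; 28; 34; 35; 45; 67; 68; 78];
  [:: 2; 3; 4; 5; 6; 7; 14; 15; 16; 17; 23; 27; 28; 37; 38; 45; 46; 56];
  [:: 2; 3; 4; 5; 6; 8; 12; 13; 14; 16; 23; 24; 35; 48; 56; 57; 67; 78];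
  [:: 1; 2; 3; 4; 5; 6; 12; 17; 18; 23; 27; 34; 36; 45; 46; 56; 58];
  [:: 1; 3; 4; 5; 6; 7; 12; 15; 18; 24; 27; 28; 34; 35; 36; 45; 67];
  [:: 3; 4; 5; 6; 7; 12; 13; 14; 15; 26; 27; 28; 34; 35; 45; 67; 68; 78];
  [:: 2; 3; 4; 5; 6; 14; 15; 16; 17; 23; 27; 28; 37; 38; 45; 46; 56];
  [:: 1; 2; 3; 4; 5; 12; 14; 17; 23; 24; 34; 36; 56; 57; 58; 68; 78];
  [:: 1; 3; 4; 5; 6; 12; 14; 18; 23; 27; 28; 35; 37; 45; 46; 56];
  [:: 1; 2; 3; 4; 13; 15; 17; 23; 24; 26; 37; 46; 48; 56; 57; 58; 68; 78];
  [:: 1; 2; 3; 4; 12; 13; 14; 25; 26; 34; 37; 47; 56; 57; 58; 67; 68];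
  [:: 1; 2; 3; 4; 15; 17; 18; 23; 24; 26; 34; 36; 46; 56; 57; 58; 78];
  [:: 1; 3; 7; 8; 14; 15; 17; 23; 24; 25; 26; 36; 37; 45; 46; 56];
  [:: 1; 2; 7; 8; 13; 14; 15; 26; 27; 28; 34; 35; 36; 45; 46; 56];
  [:: 3; 4; 6; 7; 12; 15; 17; 18; 25; 27; 28; 34; 35; 36; 45; 46];
  [:: 2; 3; 4; 6; 14; 15; 16; 17; 23; 24; 25; 35; 38; 45; 67]].

Definition graphs_8_10 : seq (seq nat) := [::
  [:: 1; 2; 3; 4; 12; 13; 14; 24; 26; 34; 35; 57; 58; 59; 67; 68; 69; 78; 79; 89];
  [:: 1; 3; 7; 9; 13; 17; 19; 23; 24; 25; 26; 37; 45; 46; 48; 56; 58; 68; 78];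
  [:: 1; 2; 8; 9; 12; 13; 18; 28; 29; 35; 36; 37; 45; 46; 47; 49; 56; 57; 67];
  [:: 2; 4; 6; 8; 12; 13; 14; 15; 25; 26; 34; 35; 37; 47; 57; 67; 69; 89];
  [:: 1; 4; 7; 8; 15; 17; 18; 23; 24; 25; 26; 34; 35; 36; 46; 56; 79; 89];
  [:: 1; 2; 3; 4; 13; 14; 15; 26; 28; 29; 36; 39; 46; 47; 56; 57; 58];
  [:: 6; 7; 8; 9; 14; 15; 17; 18; 23; 24; 25; 26; 34; 35; 36; 45; 79; 89];
  [:: 3; 4; 6; 7; 12; 13; 14; 15; 25; 28; 29; 35; 39; 45; 47; 67; 68]].
Lemma covered_5_6 : covered 5 6 graphs_5_6. Proof. by vm_compute. Qed.
Lemma covered_5_7 : covered 5 7 graphs_5_7. Proof. by vm_compute. Qed.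
Lemma covered_6_7 : covered 6 7 graphs_6_7. Proof. by vm_compute. Qed.
Lemma covered_6_8 : covered 6 8 graphs_6_8. Proof. by vm_compute. Qed.
Lemma covered_8_9 : covered 8 9 graphs_8_9. Proof. by vm_compute. Qed.
Lemma covered_8_10 : covered 8 10 graphs_8_10. Proof. by vm_compute. Qed.

Lemma searchP (T : eqType) (p : pred T) s : search p s -> exists2 i, i \in s & p i.
Proof.
elim: s => //= i s IH; case E : (p i) => h.
  by exists i; rewrite ?inE ?eqxx.
have [j js pj] := IH h.
by exists j; rewrite // inE js orbT.
Qed.

Lemma extend_cycle a n m h q : path a h q -> uniq (h :: q) -> all (gtn n) (h :: q) ->
    extend a n m h q ->
  exists c, [/\ cycle a c, uniq c, all (gtn n) c & size c = m + (size q).+1].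
Proof.
elim: m h q => [|m IH] h q pq un lt /=.
  by move=> lq; exists (h :: q); split=> //=; rewrite rcons_path pq.
case/searchP=> i; rewrite mem_iota add0n => ltn.
case E : (a i h) => //; case M : (i \in h :: q) => // /IH[|||c [c1 c2 c3 c4]].
- by rewrite /= E.
- by rewrite cons_uniq M.
- by move: lt; rewrite /= -[i < n]/(0 <= i < n) ltn.
by exists c; split=> //; rewrite c4 /= addnS.
Qed.

Lemma cyclicP a n r : 0 < r -> cyclic a n r ->
  exists c, [/\ cycle a c, uniq c, all (gtn n) c & size c = r].
Proof.
move=> r0 /searchP[i]; rewrite mem_iota add0n => ltn ex.
have [|||c [c1 c2 c3 c4]] := extend_cycle _ _ _ ex; rewrite //= ?andbT //.
by exists c; split=> //; rewrite c4 addn1 prednK.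
Qed.

Lemma mem_mono n hi s : size s = n -> all (leq 1) s -> path geq hi s -> s \in mono n hi.
Proof.
elim: n hi s => [|n IH] hi [|h s] //= [sz] /andP[h1 al] /andP[hh ps].
apply/flattenP; exists [seq h :: s | s <- mono n h]; last by rewrite map_f // IH.
by apply/mapP; exists h => //; rewrite mem_iota h1 /= add1n ltnS.
Qed.

(** * From tables to realizations, and the induction *)

Section Tables.
Variable V : finType.
Implicit Types (e : rel V) (x y t : V) (vs : seq V).

Lemma fits_potentially l n e vs E : uniq vs -> size vs = n -> (forall x, (x \in vs) = (0 < dg e x)) ->
  fits l n E (map (dg e) vs) -> potentially l e.
Proof.
move=> un sz mem; rewrite /fits; case: eqP => // degs /andP[/allP val /allP cyc].
pose e' : rel V := fun x y => [&& x \in vs, y \in vs & coded E (index x vs) (index y vs)].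
have cs i j : coded E i j = coded E j i by rewrite /coded orbC.
have ci i : i < n -> coded E i i = false.
  move=> ltn; apply/negP; rewrite /coded orbb => /val; clear; lia.
have G' : graph e'.
  split=> [x y|x]; rewrite /e'; first by rewrite cs andbCA.
  by apply/negP => /and3P[xv _]; rewrite ci // -sz index_mem.
have D' x : dg e' x = dg e x.
  have [xv|xv] := boolP (x \in vs); last first.
    move: (xv); rewrite mem -eqn0Ngt => /eqP->.
    by apply: eq_card0 => y; rewrite !inE /e' (negbTE xv).
  have ix : index x vs < n by rewrite -sz index_mem.
  have := congr1 (fun s => nth 0 s (index x vs)) degs.
  rewrite /= (nth_map 0) ?size_iota // nth_iota // add0n (nth_map x) ?sz // nth_index // => <-.
  have -> : iota 0 n = map (index^~ vs) vs.
    apply: (@eq_from_nth _ 0); first by rewrite size_map size_iota.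
    move=> i; rewrite size_iota => iv.
    by rewrite (nth_map x) ?sz // index_uniq ?sz // nth_iota.
  rewrite count_map -size_filter -(card_uniqP (filter_uniq _ un)).
  by apply: eq_card => y; rewrite mem_filter inE /e' xv /= andbC.
exists e'; split=> // r r3; have [||c [c1 c2 c3 c4]] := @cyclicP (coded E) n r.
- by case/andP: r3 => /ltnW/ltnW.
- by apply: cyc; rewrite mem_iota; move: r3; clear; lia.
have [x0 _] : exists x0, x0 \in vs.
  case: vs un sz {mem degs G' D' e'} => [|x0 vs'] un sz; last by exists x0; rewrite inE eqxx.
  by case: c c3 c4 {c1 c2} => [|i c] /=; [move=> _ h; move: r3; rewrite -h | rewrite -sz].
have lt i : i \in c -> i < size vs by rewrite sz; apply: (allP c3).
exists (map (nth x0 vs) c); split; last by rewrite size_map.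
- rewrite cycle_map; apply: (sub_in_cycle (P := gtn n)) c1; last exact: c3.
  move=> i j; rewrite !inE => ii jj ij; rewrite /= /e' !mem_nth ?sz //.
  by rewrite !index_uniq ?sz.
- rewrite map_inj_in_uniq // => i j ic jc /eqP; rewrite nth_uniq ?lt //.
  by move/eqP.
Qed.

Lemma handshake e : graph e -> ~~ odd (\sum_x dg e x).
Proof.
move=> G; have dE x : dg e x = \sum_y (e x y : nat).
  by rewrite /dg -sum1_card big_mkcond /=; apply: eq_bigr => y _; rewrite in_nb; case: (e x y).
rewrite (eq_bigr _ (fun x _ => dE x)).
(* Comparing [enum_rank] splits the ordered adjacent pairs into two equal halves. *)
have -> : \sum_x \sum_y (e x y : nat) =
    \sum_x \sum_y (e x y && (enum_rank x < enum_rank y) : nat) +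
    \sum_x \sum_y (e x y && (enum_rank y < enum_rank x) : nat).
  rewrite -big_split; apply: eq_bigr => x _; rewrite -big_split; apply: eq_bigr => y _ /=.
  case E : (e x y) => //=; case: ltngtP => // /val_inj/enum_rank_inj xy.
  by move: E; rewrite xy graph_irr.
rewrite [X in _ + X]exchange_big /=.
under [X in _ + X]eq_bigr => x _ do under eq_bigr => y _ do rewrite (graph_sym y x G).
by rewrite addnn odd_double.
Qed.

Lemma covered_potentially l n e t tab : covered l n tab -> graph e -> degcond l e -> ndeg e 1 = n -> 5 <= l ->
    0 < dg e t -> (forall x, 0 < dg e x -> dg e t <= dg e x) ->
    ~~ [|| dg e t <= #|deggt e (uphalf l)|, l + 3 <= ndeg e 1 + #|deggt e (uphalf l)|
      | (dg e t == 1) && (l + 2 <= ndeg e 1)] ->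
  potentially l e.
Proof.
move=> cov G C n1 l5 t0 tmin; rewrite !negb_or => /and3P[pj np j1].
pose vs := sort (fun x y => dg e y <= dg e x) (enum (degge e 1)).
have un : uniq vs by rewrite sort_uniq enum_uniq.
have mem x : (x \in vs) = (0 < dg e x) by rewrite mem_sort mem_enum in_degge.
have sz : size vs = n by rewrite size_sort -cardE.
have pvs : perm_eq vs (enum (degge e 1)) by rewrite perm_sort.
set s := map (dg e) vs.
have srt : sorted geq s.
  by rewrite sorted_map; apply: sort_sorted => x y; apply: leq_total.
have cnt m : 0 < m -> count (leq m) s = ndeg e m.
  move=> m0; rewrite count_map (permP pvs) -size_filter /ndeg.
  rewrite -(card_uniqP (filter_uniq _ (enum_uniq _))); apply: eq_card => x.
  rewrite mem_filter mem_enum !in_degge /=; apply: andb_idr; exact: leq_trans.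
have lst : last 0 s = dg e t.
  have tv : t \in vs by rewrite mem.
  have [x [vs' E]] : exists x vs', vs = rcons vs' x.
    by case/lastP: (vs) tv => // vs' x _; exists x, vs'.
  rewrite /s E map_rcons last_rcons; apply/eqP; rewrite eqn_leq tmin; last by rewrite -mem E mem_rcons inE eqxx.
  rewrite andbT; move: tv; rewrite E mem_rcons inE => /orP[/eqP->//|tv].
  have : sorted geq (rcons (map (dg e) vs') (dg e x)) by rewrite -map_rcons -E.
  have tr : transitive geq by move=> a b c ab bc; apply: leq_trans bc ab.
  rewrite -(rev_sorted) rev_rcons /= => /(order_path_min _) /allP h.
  by apply: h; [move=> a b c ab bc; apply: leq_trans bc | rewrite mem_rev map_f].
have rem : remaining l n s.
  rewrite /remaining lst cnt // -deggt_ndeg; apply/and5P; split.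
  - rewrite sumnE big_map (perm_big _ pvs) /= big_enum /=.
    have := handshake G; rewrite (bigID (fun x => x \in degge e 1)) /=.
    rewrite [X in _ + X]big1 ?addn0 // => x; rewrite in_degge lt0n negbK => /eqP.
    by [].
  - apply/allP => m; rewrite mem_iota => mm; rewrite cnt; last by case/andP: mm => /ltnW.
    by have /andP[_ h] := uphalfP l; apply: C; move: mm h l5; clear; lia.
  - by rewrite ltnNge.
  - by rewrite -n1 ltnNge.
  - by rewrite -n1.
have sm : s \in mono n n.-1.
  apply: mem_mono; first by rewrite size_map.
    by apply/allP => d /mapP[x xv ->]; rewrite -mem.
  case E : s => [|d s'] //; rewrite E /= in srt; rewrite /= srt andbT.
  have : d \in s by rewrite E inE eqxx.
  case/mapP=> x; rewrite mem => /(dg_lt_ndeg G) + ->; rewrite n1 /=; clear; lia.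
move: cov => /allP/(_ s sm); rewrite rem => /searchP[E _]; exact: fits_potentially.
Qed.

Lemma base_case l tab1 tab2 e : 5 <= l -> graph e -> degcond l e ->
    covered l l.+1 tab1 -> covered l l.+2 tab2 ->
    (ndeg e 1 = l -> potentially l e) ->
    (forall e', graph e' -> degcond l e' -> ndeg e' 1 < ndeg e 1 -> potentially l e') ->
  potentially l e.
Proof.
move=> l5 G C cov1 cov2 full IHn.
have nl : l <= ndeg e 1.
  apply: leq_trans (ndeg_mono e (_ : 1 <= 2)) => //.
  by have := C 2; move: l5; clear; lia.
move: nl; rewrite leq_eqVlt => /orP[/eqP nl|nl]; first exact: full.
have [|t [t0 tmin]] := @min_vertex V e; first exact: leq_trans nl.
have [red|nred] := boolP [|| dg e t <= #|deggt e (uphalf l)|, l + 3 <= ndeg e 1 + #|deggt e (uphalf l)|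
      | (dg e t == 1) && (l + 2 <= ndeg e 1)].
  by apply: reducible_potentially IHn; apply: (reduce_plain l5 G C nl t0 tmin).
have [n1|n1] := eqVneq (ndeg e 1) l.+1; first exact: (covered_potentially cov1 G C n1 l5 t0 tmin nred).
apply: (covered_potentially cov2 G C _ l5 t0 tmin nred).
by move: nred; rewrite !negb_or -!ltnNge => /and3P[_ h _]; move: h n1 nl; clear; lia.
Qed.

Theorem degcond_potentially l e : 5 <= l -> graph e -> degcond l e -> potentially l e.
Proof.
have [m] := ubnP l; elim: m l e => // m IHm l e lm l5 G C.
have IHl l' e' : 5 <= l' -> l' < l -> graph e' -> degcond l' e' -> potentially l' e'.
  by move=> h1 h2; apply: IHm => //; apply: leq_trans h2 _.
have [n] := ubnP (ndeg e 1); elim: n e G C => // n IHn e G C ln.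
have {}IHn e' : graph e' -> degcond l e' -> ndeg e' 1 < ndeg e 1 -> potentially l e'.
  by move=> G' C' lt; apply: IHn => //; apply: leq_trans lt _.
have full_odd : odd l -> ndeg e 1 = l -> potentially l e.
  move=> ol n1; exists e; split=> //; apply: posa_odd_all => //; first exact: leq_trans l5.
  split=> [m' m2 ml|]; first by rewrite addn2; apply: C => //; apply: leqW.
  by have := C (uphalf l); have := uphalfP l; move: l5; clear; lia.
have full_even : 6 <= l -> ~~ odd l -> ndeg e 1 = l -> potentially l e.
  move=> l6 ol n1; apply: even_spanning => //; apply: IHl => //; try by move: l6; clear; lia.
  by apply: degcond_pred; rewrite prednK //; apply: leq_trans l6.
have [l5E|l5E] := eqVneq l 5.
  rewrite l5E in C IHn full_odd *.
  exact: (base_case _ G C covered_5_6 covered_5_7 (full_odd _) IHn).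
have [l6E|l6E] := eqVneq l 6.
  rewrite l6E in C IHn full_even *.
  exact: (base_case _ G C covered_6_7 covered_6_8 (full_even _ _) IHn).
have [l8E|l8E] := eqVneq l 8.
  rewrite l8E in C IHn full_even *.
  exact: (base_case _ G C covered_8_9 covered_8_10 (full_even _ _) IHn).
have l7 : 7 <= l by move: l5 l5E l6E; clear; lia.
have [ol|ol] := boolP (odd l).
  by apply: odd_case => // e' G' C'; apply: IHl => //; move: l7; clear; lia.
have l10 : 10 <= l.
  have : l != 7 by apply: contraNneq ol => ->.
  have : l != 9 by apply: contraNneq ol => ->.
  by move: l7 l8E; clear; lia.
apply: even_case => // e' G' C'; apply: IHl => //; move: l10; clear; lia.
Qed.

End Tables.

Lemma sorted_geq_count s m i : sorted geq s -> 0 < m -> m <= nth 0 s i -> i < count (leq m) s.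
Proof.
move=> srt m0 mi; have is_ : i < size s.
  by rewrite ltnNge; apply: contraTN mi => si; rewrite nth_default // -ltnNge.
rewrite -(cat_take_drop i.+1 s) count_cat; apply: leq_trans (leq_addr _ _).
have -> : count (leq m) (take i.+1 s) = size (take i.+1 s).
  apply/eqP; rewrite -all_count; apply/(all_nthP 0) => j; rewrite size_takel // => ji.
  rewrite nth_take //; apply: leq_trans mi _.
  have tr : transitive geq by move=> a b c ab bc; apply: leq_trans bc ab.
  by apply: (sorted_leq_nth tr leqnn 0 srt); rewrite ?inE //; apply: leq_ltn_trans is_.
by rewrite size_takel.
Qed.

Theorem theorem1p3 (l n : nat) (hl : 5 <= l) (hn : l <= n)
  (pi : n.-tuple nat) (hpi : GS pi)
  (hd : forall i : nat, 1 <= i -> 2 * i < l -> i + 1 <= dterm pi (l + 1 - i)) :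
  potentially_3C l pi.
Proof.
case: hpi => -[G real] srt _.
have gG : graph (@adj G) by split; [exact: adj_sym | exact: adj_irr].
have C : degcond l (@adj G).
  move=> m m2 ml; have := hd m.-1; rewrite /dterm => /(_ _ _) h.
  have mi : m <= nth 0 pi (l + 1 - m.-1).-1.
    by apply: leq_trans (h _ _); move: m2 ml; clear; lia.
  have := sorted_geq_count srt (ltnW m2) mi.
  rewrite -(permP real) count_map -size_filter.
  have -> : size [seq x <- enum G | preim (@degree G) (leq m) x] = ndeg (@adj G) m.
    rewrite -(card_uniqP (filter_uniq _ (enum_uniq _))); apply: eq_card => x.
    by rewrite mem_filter mem_enum in_degge andbT.
  by move: m2 ml; clear; lia.
have [e' [[s' i'] D' H]] := degcond_potentially hl gG C.
exists (SGraph s' i'); split.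
  rewrite /realization; have -> // : [seq degree x | x <- enum (SGraph s' i')] = [seq degree x | x <- enum G].
  by apply: eq_map => x; apply: D'.
by move=> r /H[c [cy un sz]]; exists c; split=> //; apply/andP.
Qed.
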